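(* Let $m\ge 1$ and let $*_\nu$ and $*'_\nu$ be two universal star products on $\mathbb{R}^m$ (in the sense of the context). Then there exists a sequence $(T_r)_{r\ge 1}$ of linear universal differential operators on $\mathbb{R}^m$ (that is, each $T_r=T_r(P)$ is given by a graph formula as in the context whose scalar coefficients do not depend on the Poisson tensor $P$) such that the following holds. For every $m$-dimensional real Lie algebra $\mathfrak{g}$, with $\mathfrak{g}^*$ identified with $\mathbb{R}^m$ by a choice of basis and endowed with its linear Poisson tensor $P$, there is a formal series $\nu'=\nu+\sum_{n>1}f_n\nu^n$ with $f_n\in\mathbb{R}$ such that, writing $$T(\nu)=\mathrm{Id}+\sum_{r=1}^\infty \nu^r\,T_r(P),$$ one has, for all $u,v\in C^\infty(\mathfrak{g}^* )$, $$u*'_{\nu'}v=T(\nu)^{-1}\bigl(T(\nu)u*_\nu T(\nu)v\bigr),$$ where $*_\nu$ and $*'_\nu$ denote the star products on $(\mathfrak{g}^*,P)$ given by the two universal formulas evaluated at $P$. In other words, two universal star products on the dual of a Lie algebra are always equivalent modulo a change of parameter.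
   Context: **Star products.** Let $M$ be a manifold with Poisson tensor $P$ and Poisson bracket $\{u,v\}=P(du\wedge dv)$, which in coordinates is $\sum_{i,j}P^{ij}\partial_iu\,\partial_jv$ with $P^{ij}=-P^{ji}$. A star product on $(M,P)$ is a bilinear map $C^\infty(M)\times C^\infty(M)\to C^\infty(M)[[\nu]]$, $u*_\nu v=\sum_{r\ge0}\nu^rC_r(u,v)$, such that: (1) its $\nu$-linear, $\nu$-adically continuous extension to $C^\infty(M)[[\nu]]$ is associative; (2) $C_0(u,v)=uv$ and $C_1(u,v)-C_1(v,u)=\{u,v\}$; (3) $1*u=u*1=u$. For $\nu'=\nu+\sum_{n>1}f_n\nu^n$ with $f_n\in\mathbb{R}$, the product $u*_{\nu'}v$ is obtained by substituting $\nu'$ for $\nu$: $u*_{\nu'}v=\sum_{r\ge0}(\nu')^rC_r(u,v)$. **Linear Poisson structure.** For a finite-dimensional real Lie algebra $\mathfrak{g}$, the Poisson tensor on $\mathfrak{g}^*$ is $P_\xi(X,Y)=\xi([X,Y])$ for $\xi\in\mathfrak{g}^*$ and $X,Y\in\mathfrak{g}\cong(T_\xi\mathfrak{g}^* )^*$. In linear coordinates, $P^{ij}(\xi)=\sum_k c_{ij}^k\xi_k$ with $c_{ij}^k$ the structure constants. **Graphs.** For $k\ge0$, $G_k$ is the set of labelled oriented graphs $\Gamma=(V_\Gamma,E_\Gamma)$ such that: - the vertex set is $V_\Gamma=\{1,\dots,k\}\sqcup\{L,R\}$; - there are $2k$ labelled edges, $E_\Gamma=\{e_1^1,e_1^2,\dots,e_k^1,e_k^2\}\subset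 V_\Gamma\times V_\Gamma$, where $e_j^1$ and $e_j^2$ start at $j$ (an edge $(v_1,v_2)$ starts at $v_1$ and ends at $v_2$); - there are no multiple edges and no edges of the form $(v,v)$. Put $G=\bigcup_kG_k$. For a skew-symmetric contravariant $2$-tensor $P$ on $\mathbb{R}^m$ and $\Gamma\in G_k$, define the bidifferential operator $$C_\Gamma(P)(u,v)=\sum_{I:E_\Gamma\to\{1,\dots,m\}}\Bigl[\prod_{j=1}^k\Bigl(\prod_{e=(\cdot,j)\in E_\Gamma}\partial_{I(e)}\Bigr)P^{I(e_j^1)I(e_j^2)}\Bigr]\Bigl(\prod_{e=(\cdot,L)\in E_\Gamma}\partial_{I(e)}\Bigr)u\;\Bigl(\prod_{e=(\cdot,R)\in E_\Gamma}\partial_{I(e)}\Bigr)v .$$ **Universal star product.** A star product on $\mathbb{R}^m$ is universal if it is given, for every Poisson tensor $P$ on $\mathbb{R}^m$, by $u*_\nu v=uv+\sum_{n>0}\nu^nC_n(P)(u,v)$ with $C_n(P)=\sum_{\Gamma\in G}w_n(\Gamma)\,C_\Gamma(P)$. Here, for each $n$, the sum is finite (only finitely many $w_n(\Gamma)$ are nonzero), and the real scalars $w_n(\Gamma)$ are independent of $P$. **Linear universal differential operator.** This is a family $P\mapsto E(P)$ of linear differential operators on $C^\infty(\mathbb{R}^m)$ of the form $E(P)=\sum_\Gamma t(\Gamma)E_\Gamma(P)$. The sum is finite, the real scalars $t(\Gamma)$ are independent of $P$, and $\Gamma$ runs over graphs defined exactly as in $G_k$ ($k\ge 0$) but with vertex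 set $\{1,\dots,k\}\sqcup\{L\}$. The operator $E_\Gamma(P)$ is $$E_\Gamma(P)(u)=\sum_{I:E_\Gamma\to\{1,\dots,m\}}\Bigl[\prod_{j=1}^k\Bigl(\prod_{e=(\cdot,j)}\partial_{I(e)}\Bigr)P^{I(e_j^1)I(e_j^2)}\Bigr]\Bigl(\prod_{e=(\cdot,L)}\partial_{I(e)}\Bigr)u .$$ *)

(* Defs.v *)
From HB Require Import structures.
From mathcomp Require Import all_boot all_order all_algebra.
From mathcomp Require Import all_classical all_reals all_analysis.

Set Implicit Arguments.
Unset Strict Implicit.
Unset Printing Implicit Defensive.

Import Order.TTheory GRing.Theory Num.Theory.
Import numFieldNormedType.Exports.

Local Open Scope classical_set_scope.
Local Open Scope ring_scope.

(* Sums, products and scalings of functions are those of the pointwise ring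
   structure on ['rV[R]_m -> R]. *)
Section Calculus.
Context {R : realType} {m : nat}.
Local Notation fct := ('rV[R]_m -> R).

Definition partial (i : 'I_m) (f : fct) : fct :=
  fun x => 'D_(delta_mx 0 i) f x.

Definition partials (s : seq 'I_m) (f : fct) : fct := foldr partial f s.

(* C^oo: all iterated partial derivatives exist and are continuous. *)
Definition smooth (f : fct) : Prop :=
  forall s : seq 'I_m, continuous (partials s f) /\
    forall (i : 'I_m) (x : 'rV[R]_m), derivable (partials s f) x (delta_mx 0 i).

Definition tensor2 := 'I_m -> 'I_m -> fct.

Definition bracket (P : tensor2) (u v : fct) : fct :=
  \sum_(i < m) \sum_(j < m) P i j * partial i u * partial j v.

Record poisson_tensor (P : tensor2) : Prop := {
  poisson_smooth : forall i j, smooth (P i j);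
  poisson_skew : forall i j, P i j = - P j i;
  poisson_jacobi : forall u v w, smooth u -> smooth v -> smooth w ->
    bracket P u (bracket P v w) + bracket P v (bracket P w u)
      + bracket P w (bracket P u v) = 0 }.

End Calculus.
Arguments tensor2 : clear implicits.

(* A formal series in nu with coefficients in V is the sequence nat -> V of its
   coefficients. *)
Section FormalSeries.
Context {R : realType} {m : nat}.
Local Notation fct := ('rV[R]_m -> R).

Definition smooth_series (U : nat -> fct) : Prop := forall n, smooth (U n).

Definition const_series (u : fct) : nat -> fct :=
  fun n => if n == 0%N then u else 0.

(* The nu-linear, nu-adically continuous extension of
   (u, v) |-> \sum_r nu^r C_r(u, v). *)
Definition bilin_ext (C : nat -> fct -> fct -> fct) (U V : nat -> fct) :
    nat -> fct :=
  fun n => \sum_(a < n.+1) \sum_(b < n.+1) \sum_(r < n.+1 | (a + b + r == n)%N)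
    C r (U a) (V b).

(* Same for \sum_r nu^r T_r. *)
Definition lin_ext (T : nat -> fct -> fct) (U : nat -> fct) : nat -> fct :=
  fun n => \sum_(r < n.+1) T r (U (n - r)%N).

(* Inverse of [lin_ext T] when T_0 = Id, obtained by solving
   \sum_(r <= n) T_r U_(n-r) = V_n successively for the U_n: see
   [lin_extK] and [lin_ext_invK]. *)
Fixpoint lin_ext_inv_prefix (T : nat -> fct -> fct) (V : nat -> fct) (n : nat) :
    seq fct :=
  if n is n'.+1 then
    let s := lin_ext_inv_prefix T V n' in
    rcons s (V n' - \sum_(i < n') T i.+1 (nth 0 s (n' - i.+1)))
  else [::].

Definition lin_ext_inv (T : nat -> fct -> fct) (V : nat -> fct) : nat -> fct :=
  fun n => nth 0 (lin_ext_inv_prefix T V n.+1) n.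

Lemma size_lin_ext_inv_prefix T V n : size (lin_ext_inv_prefix T V n) = n.
Proof. by elim: n => //= n IHn; rewrite size_rcons IHn. Qed.

Lemma nth_lin_ext_inv_prefix T V n i : (i < n)%N ->
  nth 0 (lin_ext_inv_prefix T V n) i = lin_ext_inv T V i.
Proof.
elim: n => // n IHn; rewrite ltnS leq_eqVlt => /orP[/eqP -> //|lt_in].
by rewrite /= nth_rcons size_lin_ext_inv_prefix lt_in IHn.
Qed.

Lemma lin_ext_invE T V n : lin_ext_inv T V n =
  V n - \sum_(i < n) T i.+1 (lin_ext_inv T V (n - i.+1)%N).
Proof.
rewrite {1}/lin_ext_inv /= nth_rcons size_lin_ext_inv_prefix ltnn eqxx.
congr (_ - _); apply: eq_bigr => i _.
by rewrite nth_lin_ext_inv_prefix // subnSK // leq_subr.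
Qed.

Lemma lin_ext_invK T : T 0%N = id -> cancel (lin_ext_inv T) (lin_ext T).
Proof.
move=> T0 V; apply/funext => n.
by rewrite /lin_ext big_ord_recl T0 subn0 /= lin_ext_invE subrK.
Qed.

Lemma lin_extK T : T 0%N = id -> cancel (lin_ext T) (lin_ext_inv T).
Proof.
move=> T0 U; apply/funext => n; elim/ltn_ind: n => n IHn.
rewrite lin_ext_invE /lin_ext big_ord_recl T0 subn0 /=.
apply/eqP; rewrite subr_eq; apply/eqP; congr (_ + _).
by apply: eq_bigr => i _; rewrite IHn // subnSK // leq_subr.
Qed.

Definition fps_mul (a b : nat -> R) : nat -> R :=
  fun n => \sum_(i < n.+1) a i * b (n - i)%N.

Definition fps_exp (a : nat -> R) (r : nat) : nat -> R :=
  iter r (fps_mul a) (fun n => (n == 0%N)%:R).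

(* nu' = nu + \sum_(n > 1) f_n nu^n; the values f 0 and f 1 are irrelevant. *)
Definition new_parameter (f : nat -> R) : nat -> R :=
  fun n => if (n <= 1)%N then (n == 1%N)%:R else f n.

(* Coefficients of \sum_r a(nu)^r C_r(u, v) for a series a with zero constant
   term: a^r is then divisible by nu^r, so that only r <= n contributes to
   nu^n. *)
Definition substitute (C : nat -> fct -> fct -> fct) (a : nat -> R)
    (u v : fct) : nat -> fct :=
  fun n => \sum_(r < n.+1) fps_exp a r n *: C r u v.

Record star_product (P : tensor2 R m) (C : nat -> fct -> fct -> fct) : Prop := {
  star_smooth : forall r u v, smooth u -> smooth v -> smooth (C r u v);
  star_linearl : forall r a u1 u2 v, smooth u1 -> smooth u2 -> smooth v ->
    C r (a *: u1 + u2) v = a *: C r u1 v + C r u2 v;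
  star_linearr : forall r a u v1 v2, smooth u -> smooth v1 -> smooth v2 ->
    C r u (a *: v1 + v2) = a *: C r u v1 + C r u v2;
  star_assoc : forall U V W,
    smooth_series U -> smooth_series V -> smooth_series W ->
    bilin_ext C (bilin_ext C U V) W = bilin_ext C U (bilin_ext C V W);
  star_order0 : forall u v, smooth u -> smooth v -> C 0%N u v = u * v;
  star_order1 : forall u v, smooth u -> smooth v ->
    C 1%N u v - C 1%N v u = bracket P u v;
  star_unitl : forall u, smooth u ->
    forall n, C n (cst 1) u = const_series u n;
  star_unitr : forall u, smooth u ->
    forall n, C n u (cst 1) = const_series u n }.

End FormalSeries.

(* Graphs with k vertices of the first kind and ground vertices B. The edge
   (j, false) is e_j^1 and (j, true) is e_j^2; as its source is j, a graph is
   determined by the targets of its edges. *)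
Section Graphs.
Variables (B : finType) (k : nat).

Definition vertex : finType := ('I_k + B)%type.
Definition edge : finType := ('I_k * bool)%type.

Definition graph_axiom (t : {ffun edge -> vertex}) : bool :=
  [forall e : edge, t e != inl e.1]
  && injectiveb (fun e : edge => (inl e.1 : vertex, t e)).

Record graph := Graph {
  target :> {ffun edge -> vertex};
  graphP : graph_axiom target }.

HB.instance Definition _ := [isSub for target].
HB.instance Definition _ := [Finite of graph by <:].

End Graphs.

Notation star_graph := {k : nat & graph bool k}.
Notation op_graph := {k : nat & graph unit k}.

Section GraphOperators.
Context {R : realType} {m : nat}.
Local Notation fct := ('rV[R]_m -> R).

(* (\prod_(e = (., x)) \partial_(I e)) f; the order of the derivatives is
   immaterial on smooth functions. *)
Definition partials_at B k (G : graph B k) (I : {ffun edge k -> 'I_m})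
    (x : vertex B k) (f : fct) : fct :=
  partials [seq I e | e <- enum (edge k) & G e == x] f.

Definition graph_coef B k (G : graph B k) (P : tensor2 R m)
    (I : {ffun edge k -> 'I_m}) : fct :=
  \prod_(j < k) partials_at G I (inl j) (P (I (j, false)) (I (j, true))).

(* L = inr false, R = inr true. *)
Definition graph_bidiff k (G : graph bool k) (P : tensor2 R m) (u v : fct) :
    fct :=
  \sum_(I : {ffun edge k -> 'I_m})
    graph_coef G P I * partials_at G I (inr false) u
                     * partials_at G I (inr true) v.

(* L = inr tt. *)
Definition graph_diff k (G : graph unit k) (P : tensor2 R m) (u : fct) : fct :=
  \sum_(I : {ffun edge k -> 'I_m})
    graph_coef G P I * partials_at G I (inr tt) u.

(* Below, w n and t r are finitely supported, so that the sums over all graphs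
   are genuine finite sums. *)
Definition universal_coef (w : nat -> star_graph -> R) (P : tensor2 R m)
    (n : nat) (u v : fct) : fct :=
  if n == 0%N then u * v
  else \sum_(G \in [set: star_graph]) w n G *: graph_bidiff (tagged G) P u v.

Definition universal_star_product (w : nat -> star_graph -> R) : Prop :=
  (forall n, (0 < n)%N -> finite_set [set G | w n G != 0]) /\
  (forall P : tensor2 R m, poisson_tensor P ->
     star_product P (universal_coef w P)).

Definition universal_op (t : op_graph -> R) (P : tensor2 R m) (u : fct) : fct :=
  \sum_(G \in [set: op_graph]) t G *: graph_diff (tagged G) P u.

(* Id + \sum_(r >= 1) nu^r T_r(P) *)
Definition gauge (t : nat -> op_graph -> R) (P : tensor2 R m) :
    nat -> fct -> fct :=
  fun r => if r == 0%N then id else universal_op (t r) P.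

End GraphOperators.
Arguments universal_star_product : clear implicits.

Section LieAlgebra.
Context {R : realType} {g : vectType R}.

Record lie_bracket (br : g -> g -> g) : Prop := {
  lie_linearl : forall Y, linear (br^~ Y);
  lie_linearr : forall X, linear (br X);
  lie_alternating : forall X, br X X = 0;
  lie_jacobi : forall X Y Z, br X (br Y Z) + br Y (br Z X) + br Z (br X Y) = 0 }.

(* The linear form on g whose value on the basis vector b_k is xi_k. *)
Definition dual_vector m (b : m.-tuple g) (xi : 'rV[R]_m) : g -> R :=
  fun X => \sum_(k < m) xi 0 k * coord b k X.

(* P_xi(X, Y) = xi([X, Y]) in the coordinates on g^* given by the basis b. *)
Definition linear_poisson (br : g -> g -> g) m (b : m.-tuple g) : tensor2 R m :=
  fun i j xi => dual_vector b xi (br b`_i b`_j).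

End LieAlgebra.

(* Main.v *)
(* The series f and the operators T_n are built order by order, with scalars and
   graphs chosen independently of the Lie algebra. Once T_1, ..., T_(n-1) and
   f_2, ..., f_(n-1) intertwine the products modulo nu^n, the failure D of the
   intertwining at order n is a Hochschild 2-cocycle of the algebra of smooth
   functions, and is itself given by graphs.
   - The skew-symmetric part of D is a biderivation, hence is determined by the
     bidegree (1, 1) part of D. When P is linear, a graph with one edge into
     each ground vertex contributes only if every other vertex receives at most
     one edge, so that it has at most two such vertices: one gives a multiple of
     the Poisson bracket, two give the symmetric Killing form. So the skew part
     of D is a universal multiple of the bracket. It is zero for n = 1, and is
     cancelled by the choice of f_n for n > 1.
   - A symmetric cocycle that is a bidifferential operator is the coboundary of
     an explicit operator: on exponentials D becomes a polynomial sigma(X, Y)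
     satisfying an additive cocycle identity, and Euler's homogeneity identity
     recovers sigma from its terms of degree one in Y. Gluing the two ground
     vertices of the graphs of D that have one edge into the second one gives a
     graph formula for T_n. *)
From HB Require Import structures.
Require Import Defs.
From mathcomp Require Import all_boot all_order all_algebra.
From mathcomp Require Import all_classical all_reals all_analysis.
From mathcomp Require Import ring lra zify.

Set Implicit Arguments.
Unset Strict Implicit.
Unset Printing Implicit Defensive.

Import Order.TTheory GRing.Theory Num.Theory.
Import numFieldNormedType.Exports.

Local Open Scope classical_set_scope.
Local Open Scope ring_scope.

(** * Smooth functions *)

(** The choices at order n must precede P, whereas D is known to be a cocycle only when P is
    Poisson. Each step is therefore split: the operator and the scalar are read off from a graph
    formula valid for all linear skew tensors, and only afterwards is the identity checked at each
    such P that is also Poisson. Changing f_n by c changes the defect by c C'_1, whose skew part is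
    c times the bracket; this is why f_n can cancel it. At n = 1 there is no such freedom, and the
    common normalisation of the skew parts of C_1 and C'_1 takes over. Cocycles are compared at one
    point xi, where a bidifferential operator is a finite real combination of products of
    derivatives, determined by its values on exponentials. Symmetry is tested on affine functions
    vanishing at xi, which isolate bidegree (1, 1). The condition D(1, 1) = 0 is carried along
    because Euler's identity says nothing in degree zero. Gluing the ground vertices can produce
    double edges, so the induction runs with nets, and skewness of P brings it back to graphs at the
    end. *)

Section SmoothFunctions.
Context {R : realType} {m : nat}.
Local Notation fct := ('rV[R]_m -> R).
Local Notation "''e_' i" := (delta_mx 0 i : 'rV[R]_m) (at level 8, i at level 2).
Implicit Types (f g : fct) (i j : 'I_m).

Definition derivables f := forall i x, derivable f x 'e_i.

(** Smoothness truncated at a finite order and unfolded one derivative at a time. Closure under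
    products is then an induction on the order, with no formula for iterated derivatives of a
    product. *)
Fixpoint cdiff n f : Prop :=
  if n is n'.+1 then
    [/\ continuous f, derivables f & forall i, cdiff n' (partial i f)]
  else continuous f.

Lemma cdiffW n f : cdiff n.+1 f -> cdiff n f.
Proof.
elim: n f => [|n IHn] f; first by case.
by move=> [cf df pf]; split=> // i; apply: IHn; apply: pf.
Qed.

Lemma smooth_partial f i : smooth f -> smooth (partial i f).
Proof.
move=> sf s; have := sf (rcons s i).
by rewrite /partials foldr_rcons.
Qed.

Lemma smoothP f : smooth f <-> forall n, cdiff n f.
Proof.
split=> [sf n|cf s].
  elim: n f sf => [|n IHn] f sf; first by case: (sf [::]).
  split; [by case: (sf [::])|by move=> i x; case: (sf [::])|].
  by move=> i; apply/IHn/smooth_partial.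
suff /(_ 1%N) [] : forall n, cdiff n (partials s f) by [].
by elim: s => // i s IHs n; have [_ _] := IHs n.+1; apply.
Qed.

Lemma smooth_cont f : smooth f -> continuous f.
Proof. by move=> sf; case: (sf [::]). Qed.

Lemma smooth_derivable f i x : smooth f -> derivable f x 'e_i.
Proof. by move=> sf; case: (sf [::]). Qed.

Lemma smooth_partials s f : smooth f -> smooth (partials s f).
Proof. by move=> sf; elim: s => [|i s IHs]; [exact: sf|exact: smooth_partial IHs]. Qed.

Lemma derivable_partialD f g i : derivables f -> derivables g ->
  partial i (f + g) = partial i f + partial i g.
Proof. by move=> df dg; apply/funext => x; rewrite /partial deriveD. Qed.

Lemma derivable_partialM f g i : derivables f -> derivables g ->
  partial i (f * g) = f * partial i g + g * partial i f.
Proof. by move=> df dg; apply/funext => x; rewrite /partial deriveM. Qed.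

Lemma cdiffD n f g : cdiff n f -> cdiff n g -> cdiff n (f + g).
Proof.
elim: n f g => [|n IHn] f g; first by move=> cf cg x; exact: (continuousD (cf x) (cg x)).
move=> [cf df pf] [cg dg pg]; split=> [x|i x|i]; first by exact: (continuousD (cf x) (cg x)).
  exact: derivableD.
rewrite derivable_partialD//; exact: (IHn _ _ (pf i) (pg i)).
Qed.

Lemma cdiffM n f g : cdiff n f -> cdiff n g -> cdiff n (f * g).
Proof.
elim: n f g => [|n IHn] f g; first by move=> cf cg x; exact: (continuousM (cf x) (cg x)).
move=> Df Dg; have [cf df pf] := Df; have [cg dg pg] := Dg.
split=> [x|i x|i]; [by exact: (continuousM (cf x) (cg x))|exact: derivableM|].
rewrite derivable_partialM//; apply: cdiffD; apply: IHn.
- exact: cdiffW Df.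
- exact: pg.
- exact: cdiffW Dg.
- exact: pf.
Qed.

Lemma partial_cst i (c : R) : partial i (cst c : fct) = 0.
Proof. by apply/funext => x; rewrite /partial derive_cst. Qed.

Lemma cdiff_cst n (c : R) : cdiff n (cst c : fct).
Proof.
elim: n c => [|n IHn] c; first exact: cst_continuous.
split=> [|i x|i]; [exact: cst_continuous|exact: derivable_cst|].
by rewrite partial_cst; apply: (IHn 0).
Qed.

Lemma smoothD f g : smooth f -> smooth g -> smooth (f + g).
Proof. by move=> /smoothP sf /smoothP sg; apply/smoothP => n; apply: cdiffD. Qed.

Lemma smoothM f g : smooth f -> smooth g -> smooth (f * g).
Proof. by move=> /smoothP sf /smoothP sg; apply/smoothP => n; apply: cdiffM. Qed.

Lemma smooth_cst (c : R) : smooth (cst c : fct).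
Proof. by apply/smoothP => n; apply: cdiff_cst. Qed.

Lemma smooth1 : smooth (1 : fct). Proof. exact: smooth_cst. Qed.

Lemma scale_cstM (a : R) f : a *: f = cst a * f.
Proof. by []. Qed.

Lemma smoothZ (a : R) f : smooth f -> smooth (a *: f).
Proof. by move=> sf; rewrite scale_cstM; apply: (smoothM (smooth_cst a) sf). Qed.

Lemma smoothN f : smooth f -> smooth (- f).
Proof. by move=> sf; rewrite -scaleN1r; apply: smoothZ sf. Qed.

Lemma smoothB f g : smooth f -> smooth g -> smooth (f - g).
Proof. by move=> sf sg; apply: (smoothD sf); apply: smoothN sg. Qed.

Lemma partialD i f g : smooth f -> smooth g ->
  partial i (f + g) = partial i f + partial i g.
Proof.
move=> sf sg; apply: derivable_partialD => j x.
  exact: smooth_derivable sf.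
exact: smooth_derivable sg.
Qed.

Lemma partialM i f g : smooth f -> smooth g ->
  partial i (f * g) = partial i f * g + f * partial i g.
Proof.
move=> sf sg; rewrite derivable_partialM => [|j x|j x]; last 2 first.
- exact: smooth_derivable sf.
- exact: smooth_derivable sg.
by rewrite addrC (mulrC g).
Qed.

Lemma partialZ i (a : R) f : smooth f -> partial i (a *: f) = a *: partial i f.
Proof.
move=> sf; rewrite scale_cstM (partialM i (smooth_cst a) sf).
by rewrite partial_cst mul0r add0r.
Qed.

Lemma partial1 i : partial i (1 : fct) = 0. Proof. exact: partial_cst. Qed.

(** Both derivatives are limits of the same difference quotient. *)
Lemma derive_line f (v y : 'rV[R]_m) (s : R) : derivable f (s *: v + y) v ->
  is_derive s (1 : R) (fun r : R => f (r *: v + y) : R) ('D_v f (s *: v + y)).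
Proof.
have E : (fun h : R => h^-1 *: (((fun r : R => f (r *: v + y)) \o shift s) (h *: 1)
      - f (s *: v + y)))
   = (fun h => h^-1 *: ((f \o shift (s *: v + y)) (h *: v) - f (s *: v + y))).
  by apply/funext => h /=; rewrite [_ *: 1]mulr1 scalerDl addrA.
by move=> df; constructor; rewrite /derivable /derive E.
Qed.

Lemma derive_translate f (v y z : 'rV[R]_m) : derivable f (z + y) v ->
  is_derive z v (fun x => f (x + y)) ('D_v f (z + y)).
Proof.
have E : (fun h : R => h^-1 *: (((fun x => f (x + y)) \o shift z) (h *: v) - f (z + y)))
   = (fun h => h^-1 *: ((f \o shift (z + y)) (h *: v) - f (z + y))).
  by apply/funext => h /=; rewrite addrA.
by move=> df; constructor; rewrite /derivable /derive E.
Qed.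

Lemma mvt_line f i (y : 'rV[R]_m) (t : R) : 0 < t ->
  (forall x, derivable f x 'e_i) ->
  exists s : R, [/\ 0 < s, s < t & f (t *: 'e_i + y) - f y = t * partial i f (s *: 'e_i + y)].
Proof.
move=> t0 df; pose g (r : R) : R := f (r *: 'e_i + y).
have dg s : is_derive s (1 : R) g (partial i f (s *: 'e_i + y)) by exact: derive_line.
have [s /[!in_itv]/= /andP[s0 st] E] := @MVT R g _ 0 t t0 (fun x _ => dg x)
  (continuous_subspaceT (fun x => differentiable_continuous
    ((derivable1_diffP _ _).1 (@ex_derive _ _ _ _ _ _ _ (dg x))))).
by exists s; split=> //; move: E; rewrite /g scale0r add0r subr0 mulrC.
Qed.

Lemma norm_delta i : `|'e_i : 'rV[R]_m| <= 1.
Proof.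
rewrite [X in X <= _]/Num.norm /= mx_normrE; apply/bigmax_leP; split=> // -[a b] _ /=.
by rewrite mxE; case: andP => _; rewrite ?normr1 ?normr0.
Qed.

Let dist_le (a a' b b' c c' t e : R) : 0 < t -> c = t * (t * a) -> c' = t * (t * b) ->
  c = c' -> `|a - a'| < e / 2 -> `|b - b'| < e / 2 -> `|a' - b'| <= e.
Proof.
move=> t0 -> -> /(mulfI (lt0r_neq0 t0)) /(mulfI (lt0r_neq0 t0)) ->.
by rewrite !real_ltr_norml ?num_real// real_ler_norml ?num_real// => ? ?; lra.
Qed.

(* Both mixed derivatives of a C^2 function are, at points arbitrarily close
   to x, the same second difference quotient. *)
Lemma partialC i j f : smooth f -> partial i (partial j f) = partial j (partial i f).
Proof.
move=> sf; apply/funext => x.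
(* Mean value theorem twice: along e_k for z -> f(z + t e_l) - f(z), then along e_l for the partial
   derivative so obtained. The resulting point is x moved by less than t in each of the two
   directions. *)
have mixed k l (t : R) : 0 < t -> exists2 y, `|y - x| <= 2 * t &
    f (t *: 'e_k + (t *: 'e_l + x)) - f (t *: 'e_k + x) - f (t *: 'e_l + x) + f x
    = t * (t * partial l (partial k f) y).
  move=> t0; pose g : fct := fun z => f (z + t *: 'e_l) - f z.
  have dg z : is_derive z 'e_k g (partial k f (z + t *: 'e_l) - partial k f z).
    apply: is_deriveB; last exact: derivableP (smooth_derivable sf).
    exact: derive_translate (smooth_derivable sf).
  have [s [s0 st E1]] := @mvt_line g k x t t0 (fun z => @ex_derive _ _ _ _ _ _ _ (dg z)).
  have [r [r0 rt E2]] := @mvt_line (partial k f) l (s *: 'e_k + x) t t0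
    (fun z => @smooth_derivable _ _ _ (smooth_partial k sf)).
  exists (r *: 'e_l + (s *: 'e_k + x)).
    rewrite addrA addrK (le_trans (ler_normD _ _))// mulr_natl mulr2n.
    rewrite !normrZ !gtr0_norm// lerD// -[leRHS]mulr1 ler_pM ?norm_delta//; exact: ltW.
  rewrite -E2 -[X in _ = t * (X - _)]/(partial k f _).
  have -> : t *: 'e_l + (s *: 'e_k + x) = s *: 'e_k + x + t *: 'e_l by rewrite addrC.
  move: E1; rewrite {1}/partial (@derive_val _ _ _ _ _ _ _ (dg _)) => <-.
  have -> : t *: 'e_k + (t *: 'e_l + x) = t *: 'e_k + x + t *: 'e_l by rewrite -addrA (addrC x).
  by rewrite /g (addrC x); ring.
apply/eqP; rewrite -subr_eq0 -normr_le0; apply/ler_addgt0Pr => e e0; rewrite add0r.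
have near_x (h : fct) : continuous h ->
    exists2 d : R, 0 < d & forall y, `|y - x| < d -> `|h y - h x| < e / 2.
  move=> /(_ x) /cvgrPdist_lt /(_ _ (divr_gt0 e0 (ltr0n _ 2))) /nbhs_normP [d /= d0 H].
  by exists d => // y yx; rewrite distrC; apply: H; rewrite /= /ball_ distrC.
have [d1 d10 H1] := near_x _ (smooth_cont (smooth_partial i (smooth_partial j sf))).
have [d2 d20 H2] := near_x _ (smooth_cont (smooth_partial j (smooth_partial i sf))).
pose t := Num.min d1 d2 / 4.
have t0 : 0 < t by rewrite divr_gt0// lt_min d10.
have [td1 td2] : 2 * t < d1 /\ 2 * t < d2.
  have : 0 < Num.min d1 d2 by rewrite lt_min d10.
  have : Num.min d1 d2 <= d1 by rewrite ge_min lexx.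
  have : Num.min d1 d2 <= d2 by rewrite ge_min lexx orbT.
  by rewrite /t; lra.
have [y1 Y1 E1] := mixed j i t t0.
have [y2 Y2 E2] := mixed i j t t0.
have A1 := H1 _ (le_lt_trans Y1 td1); have A2 := H2 _ (le_lt_trans Y2 td2).
by apply: (dist_le t0 E1 E2 _ A1 A2); rewrite [t *: 'e_i + (_ + x)]addrCA; ring.
Qed.

Lemma perm_partials s s' f : perm_eq s s' -> smooth f -> partials s f = partials s' f.
Proof.
move=> /[swap] sf; have move_to_front i t t' : partials (t ++ i :: t') f = partials (i :: t ++
  t') f.
  elim: t => [//|j t IHt].
  by rewrite /= IHt /= (partialC j i (smooth_partials (t ++ t') sf)).
elim: s s' => [|i s IHs] s' /[dup] ps; first by move=> /perm_size/esym/size0nil ->.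
have /splitPr [s1 s2] : i \in s' by rewrite -(perm_mem ps) mem_head.
by rewrite move_to_front /= perm_sym -cat1s perm_catCA /= perm_cons perm_sym => /IHs ->.
Qed.

End SmoothFunctions.

(** * The commutative algebra of smooth functions *)

Section SmoothAlgebra.
Variables (R : realType) (m : nat).
Local Notation fct := ('rV[R]_m -> R).

Definition smooth_pred : {pred fct} := fun f => `[< smooth f >].

Lemma smooth_predE (f : fct) : f \in smooth_pred <-> smooth f.
Proof. by rewrite unfold_in; split=> [/asboolP|/asboolP]. Qed.

Fact smooth_subring : subring_closed smooth_pred.
Proof.
split=> [|f g /smooth_predE sf /smooth_predE sg|f g /smooth_predE sf /smooth_predE sg].
- by apply/smooth_predE/smooth1.
- by apply/smooth_predE/(smoothB sf sg).
- by apply/smooth_predE/(smoothM sf sg).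
Qed.

HB.instance Definition _ := GRing.isSubringClosed.Build fct smooth_pred smooth_subring.

Fact smooth_scale : GRing.scaler_closed smooth_pred.
Proof. by move=> a f /smooth_predE sf; apply/smooth_predE/(smoothZ a sf). Qed.

HB.instance Definition _ := GRing.isScaleClosed.Build R fct smooth_pred smooth_scale.

(** Bundling smoothness gives a commutative algebra on which partial derivatives are total linear
    derivations, so that ring identities and big sums need no smoothness side conditions. *)
Record smfun := Sfun { sfun_val :> fct; sfunP : sfun_val \in smooth_pred }.

HB.instance Definition _ := [isSub for sfun_val].
HB.instance Definition _ := [Choice of smfun by <:].
HB.instance Definition _ := [SubChoice_isSubComNzRing of smfun by <:].
HB.instance Definition _ := [SubZmodule_isSubLmodule of smfun by <:].
Fact sfun_scalerAl (a : R) (f g : smfun) : a *: (f * g) = (a *: f) * g.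
Proof. by apply/val_inj/funext => x /=; rewrite [LHS]mulrA. Qed.
HB.instance Definition _ := GRing.Lmodule_isLalgebra.Build R smfun sfun_scalerAl.
HB.instance Definition _ := GRing.Lalgebra_isComAlgebra.Build R smfun.
End SmoothAlgebra.

(** * Derivations, affine functions and exponentials centred at a point *)

Section Derivations.
Context {R : realType} {m : nat}.
Local Notation fct := ('rV[R]_m -> R).
Local Notation "''e_' i" := (delta_mx 0 i : 'rV[R]_m) (at level 8, i at level 2).
Local Notation A := (smfun R m).

Lemma sfun_smooth (f : A) : smooth f.
Proof. exact/smooth_predE/sfunP. Qed.

Definition to_sfun (f : fct) (sf : smooth f) : A :=
  Sfun ((smooth_predE f).2 sf).

Definition dpart (i : 'I_m) (f : A) : A :=
  to_sfun (smooth_partial i (sfun_smooth f)).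

Lemma dpart_linear i : linear (dpart i).
Proof.
move=> a f g; apply/val_inj => /=.
by rewrite (partialD i (smoothZ a (sfun_smooth f)) (sfun_smooth g))
  (partialZ i a (sfun_smooth f)).
Qed.

HB.instance Definition _ i := GRing.isLinear.Build R A A _ (dpart i) (dpart_linear i).

Lemma dpartM i f g : dpart i (f * g) = dpart i f * g + f * dpart i g.
Proof. by apply/val_inj; rewrite /= (partialM i (sfun_smooth f) (sfun_smooth g)). Qed.

Lemma dpartC i j f : dpart i (dpart j f) = dpart j (dpart i f).
Proof. by apply/val_inj; rewrite /= (partialC i j (sfun_smooth f)). Qed.

Lemma smooth_intro (f : fct) : continuous f -> (forall i x, derivable f x 'e_i) ->
  (forall i, smooth (partial i f)) -> smooth f.
Proof.
move=> cf df pf; apply/smoothP => -[|n]; first exact: cf.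
by split=> // i; exact: ((smoothP _).1 (pf i) n).
Qed.

Lemma is_derive_derivable (V : normedModType R) (f : V -> R) x v df :
  is_derive x v f df -> derivable f x v.
Proof. by case. Qed.

Definition pairing (X x : 'rV[R]_m) : R := \sum_i X 0 i * x 0 i.

Lemma pairing_linear X : linear (pairing X).
Proof.
move=> a x y; rewrite /pairing scaler_sumr -big_split; apply: eq_bigr => i _ /=.
by rewrite !mxE mulrDr mulrCA.
Qed.

HB.instance Definition _ X := GRing.isLinear.Build R _ _ _ (pairing X) (pairing_linear X).

Lemma pairing_continuous X : continuous (pairing X).
Proof.
have -> : pairing X = \sum_i (fun x : 'rV[R]_m => X 0 i * x 0 i).
  by apply/funext => x; rewrite fct_sumE.
apply: (big_ind (fun f : fct => continuous f)) => [|f g cf cg x|i _ x].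
- exact: cst_continuous.
- exact: (continuousD (cf x) (cg x)).
- by apply: continuousM; [exact: cst_continuous|exact: coord_continuous].
Qed.

Lemma pairing_delta X i : pairing X 'e_i = X 0 i.
Proof.
rewrite /pairing (bigD1 i)//= big1 => [|j /negPf ji]; rewrite !mxE ?eqxx ?mulr1 ?addr0//.
by rewrite ji andbF mulr0.
Qed.

Lemma pairingDl X Y x : pairing (X + Y) x = pairing X x + pairing Y x.
Proof. by rewrite -big_split; apply: eq_bigr => i _; rewrite mxE mulrDl. Qed.

Lemma is_derive_pairing X x v : is_derive x v (pairing X) (pairing X v).
Proof.
have dX : differentiable (pairing X) x by exact/linear_differentiable/pairing_continuous.
split; first exact: diff_derivable.
by rewrite deriveE// diff_lin//; exact: pairing_continuous.
Qed.

Variable xi : 'rV[R]_m.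

(** The linear form X recentred at [xi]: value and second derivatives vanish there, so only
    first-order terms of an operator see it. *)
Definition affine_fun X : fct := pairing X - cst (pairing X xi).

Lemma is_derive_affine X x v : is_derive x v (affine_fun X) (pairing X v).
Proof.
have := is_deriveB (is_derive_pairing X x v) (is_derive_cst (pairing X xi) x v).
by rewrite subr0.
Qed.

Lemma partial_affine X i : partial i (affine_fun X) = cst (X 0 i).
Proof.
apply/funext => x; rewrite /partial (@derive_val _ _ _ _ _ _ _ (is_derive_affine X x _)).
exact: pairing_delta.
Qed.

Lemma affine_continuous X : continuous (affine_fun X).
Proof.
move=> x; apply: continuousB; [exact: pairing_continuous|exact: cst_continuous].
Qed.

Lemma affine_smooth X : smooth (affine_fun X).
Proof.
apply: smooth_intro => [|i x|i].
- exact: affine_continuous.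
- exact: is_derive_derivable (is_derive_affine X x _).
- by rewrite partial_affine; apply: smooth_cst.
Qed.

Definition affine X : A := to_sfun (affine_smooth X).

Lemma affineE X x : affine X x = pairing X (x - xi).
Proof. by rewrite linearB. Qed.

Lemma dpart_affine i X : dpart i (affine X) = (X 0 i)%:A.
Proof.
apply/val_inj; rewrite /= partial_affine; apply/funext => x /=.
by rewrite [RHS]mulr1.
Qed.

(** An eigenfunction of all partial derivatives, normalised to 1 at [xi]. Evaluating an operator on
    it at [xi] yields the symbol of the operator as a polynomial in X, and products of exponentials
    become sums of their parameters. *)
Definition exp_fun X : fct := fun x => expR (affine_fun X x).

Lemma is_derive_exp X x v : is_derive x v (exp_fun X) (pairing X v * exp_fun X x).
Proof.
pose g (h : R) : R := affine_fun X (h *: v + x).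
have gE h : g h = h * pairing X v + affine_fun X x.
  by rewrite /g /affine_fun !fctE linearP addrA.
have dg : is_derive (0 : R) (1 : R) g (pairing X v).
  rewrite (_ : g = affine_fun X \o (fun h => h *: v + x))//.
  have := @derive_line _ _ (affine_fun X) v x 0 (is_derive_derivable (is_derive_affine X _ _)).
  by rewrite (@derive_val _ _ _ _ _ _ _ (is_derive_affine X _ v)).
have de : is_derive (0 : R) (1 : R) (expR \o g) (pairing X v * exp_fun X x).
  have := is_derive1_comp (is_derive_expR (g 0)) dg.
  by rewrite gE mul0r add0r mulrC.
have dX : derivable (exp_fun X) x v by apply/derivable1P; exact: is_derive_derivable de.
split=> //.
have := @derive_line _ _ (exp_fun X) v x 0; rewrite scale0r add0r => /(_ dX) dl.
by rewrite -(@derive_val _ _ _ _ _ _ _ dl) -(@derive_val _ _ _ _ _ _ _ de).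
Qed.

Lemma partial_exp X i : partial i (exp_fun X) = X 0 i *: exp_fun X.
Proof.
apply/funext => x; rewrite /partial (@derive_val _ _ _ _ _ _ _ (is_derive_exp X x _)).
by rewrite pairing_delta.
Qed.

Lemma exp_continuous X : continuous (exp_fun X).
Proof.
move=> x; apply: (@continuous_comp _ _ _ (affine_fun X) expR).
  exact: affine_continuous.
exact: continuous_expR.
Qed.

Lemma partials_exp X s : partials s (exp_fun X) = (\prod_(i <- s) X 0 i) *: exp_fun X.
Proof.
elim: s => [|i s IHs]; first by rewrite big_nil scale1r.
rewrite big_cons mulrC -scalerA -partial_exp /= IHs.
apply/funext => x; rewrite /partial deriveZ//; apply: is_derive_derivable (is_derive_exp X x _).
Qed.

Lemma exp_smooth X : smooth (exp_fun X).
Proof.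
move=> s; rewrite partials_exp; split=> [x|i x].
  by apply: continuousM; [exact: cst_continuous|exact: exp_continuous].
by apply: derivableZ; exact: is_derive_derivable (is_derive_exp X x _).
Qed.

Definition exps X : A := to_sfun (exp_smooth X).

Lemma dpart_exps i X : dpart i (exps X) = X 0 i *: exps X.
Proof. by apply/val_inj; rewrite /= partial_exp. Qed.

Lemma expsD X Y : exps (X + Y) = exps X * exps Y.
Proof.
apply/val_inj/funext => x; rewrite /= [RHS]/GRing.mul /= /exp_fun -expRD.
by rewrite /affine_fun !fctE !pairingDl; congr expR; ring.
Qed.

Lemma exps_center X : exps X xi = 1.
Proof. by rewrite /= /exp_fun /affine_fun !fctE subrr expR0. Qed.

Lemma exps0 : exps 0 = 1.
Proof.
have p0 x : pairing 0 x = 0 by rewrite /pairing big1// => i _; rewrite mxE mul0r.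
by apply/val_inj/funext => x; rewrite /= /exp_fun /affine_fun !fctE !p0 subrr expR0.
Qed.

Lemma affine_center X : affine X xi = 0.
Proof. by rewrite /= /affine_fun !fctE subrr. Qed.

End Derivations.

(** * Symbols of bidifferential cocycles *)

Section PolynomialLemmas.
Variables (R : realFieldType) (m : nat).
Implicit Types (X Y Z : 'rV[R]_m) (s r : seq 'I_m).

Lemma poly_nat_roots (p : {poly R}) : (forall n : nat, p.[n%:R] = 0) -> p = 0.
Proof.
move=> p0; apply/eqP/negPn/negP => pn0.
have := max_poly_roots pn0 (rs := [seq n%:R | n <- iota 0 (size p)]).
rewrite size_map size_iota ltnn map_inj_uniq ?iota_uniq => [|i j /eqP]; last first.
  by rewrite eqr_nat => /eqP.
have roots_p : all (root p) [seq n%:R | n <- iota 0 (size p)].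
  by apply/allP => x /mapP[n _ ->]; exact/rootP.
by move=> /(_ roots_p isT).
Qed.

Lemma all_lt_bigmax I (J : seq I) (k : I -> nat) :
  all (fun j => k j < (\max_(i <- J) k i).+1)%N J.
Proof.
elim: J => //= j J IHJ; rewrite big_cons ltnS leq_maxl /=.
by apply: sub_all IHJ => i; rewrite !ltnS leq_max => ->; rewrite orbT.
Qed.

(** The polynomial with terms a_j X^(k_j) vanishes at every natural number, so its coefficients
    vanish exponent by exponent, and n^k may be replaced by any function of k. Indicators of k = 1
    extract a homogeneous part; k -> 1/k divides each part by its degree. *)
Lemma power_sum_moments I (J : seq I) (a : I -> R) (k : I -> nat) :
  (forall n : nat, \sum_(j <- J) a j * n%:R ^+ k j = 0) ->
  forall g : nat -> R, \sum_(j <- J) a j * g (k j) = 0.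
Proof.
move=> H g; pose p : {poly R} := \sum_(j <- J) a j *: 'X^(k j).
have p0 : p = 0.
  apply: poly_nat_roots => n; rewrite -(H n) /p horner_sum.
  by apply: eq_bigr => j _; rewrite hornerZ hornerXn.
have pE i : p`_i = \sum_(j <- J) a j * (i == k j)%:R.
  by rewrite coef_sum; apply: eq_bigr => j _; rewrite coefZ coefXn.
have : \sum_(i < (\max_(j <- J) k j).+1) \sum_(j <- J) a j * (i == k j :> nat)%:R * g i = 0.
  by rewrite big1// => i _; rewrite -mulr_suml -pE p0 coef0 mul0r.
rewrite exchange_big /= => E; rewrite -[RHS]E.
have := all_lt_bigmax J k; set N := (_.+1) => /all_filterP JN.
rewrite -JN !big_filter; apply: eq_bigr => j kj.
rewrite (bigD1 (Ordinal kj))//= big1 => [|i ij]; rewrite ?eqxx ?mulr1 ?addr0//.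
by rewrite -val_eqE /= in ij; rewrite (negPf ij) mulr0 mul0r.
Qed.

Lemma power_sum_moments2 (J : seq (R * (nat * nat))) :
  (forall n k : nat, \sum_(j <- J) j.1 * (n%:R ^+ j.2.1 * k%:R ^+ j.2.2) = 0) ->
  forall g h : nat -> R, \sum_(j <- J) j.1 * (g j.2.1 * h j.2.2) = 0.
Proof.
move=> H g h; under eq_bigr do rewrite mulrA.
apply: (power_sum_moments (a := fun j => j.1 * g j.2.1)) => k.
under eq_bigr do rewrite mulrAC.
apply: (power_sum_moments (a := fun j => j.1 * k%:R ^+ j.2.2)) => n.
by rewrite -[RHS](H n k); apply: eq_bigr => j _; rewrite -mulrA [k%:R ^+ _ * _]mulrC.
Qed.

Lemma poly_sum_coef (J : seq (R * {poly R})) i :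
  (forall n : nat, \sum_(j <- J) j.1 * j.2.[n%:R] = 0) -> \sum_(j <- J) j.1 * j.2`_i = 0.
Proof.
move=> H; transitivity (\sum_(j <- J) j.1 *: j.2)`_i.
  by rewrite coef_sum; apply: eq_bigr => j _; rewrite coefZ.
have -> : \sum_(j <- J) j.1 *: j.2 = 0; last by rewrite coef0.
apply: poly_nat_roots => n; rewrite -[RHS](H n) horner_sum.
by apply: eq_bigr => j _; rewrite hornerZ.
Qed.

Lemma coef1_exp_X1 k : (('X + 1) ^+ k : {poly R})`_1 = k%:R.
Proof.
have := coef_deriv (('X + 1) ^+ k : {poly R}) 0; rewrite mulr1n => <-.
rewrite deriv_exp derivD derivX derivC addr0 mul1r coefMn -horner_coef0.
by rewrite horner_exp hornerD hornerX hornerC add0r expr1n.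
Qed.

Definition mon X s : R := \prod_(i <- s) X 0 i.

Lemma mon_cat X s r : mon X (s ++ r) = mon X s * mon X r.
Proof. exact: big_cat. Qed.

Lemma monZ (a : R) X s : mon (a *: X) s = a ^+ size s * mon X s.
Proof.
elim: s => [|i s IHs]; first by rewrite /mon !big_nil mulr1.
by rewrite /mon !big_cons -!/(mon _ _) IHs mxE exprS; ring.
Qed.

Lemma mon0 s : mon 0 s = (size s == 0)%N%:R.
Proof.
by case: s => [|i s]; rewrite /mon ?big_nil// big_cons mxE mul0r.
Qed.

Lemma perm_mon X s r : perm_eq s r -> mon X s = mon X r.
Proof. exact: perm_big. Qed.

Lemma mon1D X Y s : size s = 1%N -> mon (X + Y) s = mon X s + mon Y s.
Proof. by case: s => [|i []]//= _; rewrite /mon !big_seq1 mxE. Qed.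

(** The product is the monomial [s] evaluated at X + t e_i, as a polynomial in t; this is its
    partial derivative in the i-th variable. *)
Lemma mon_deriv X i s :
  (\prod_(k <- s) ((X 0 k)%:P + (k == i)%:R *: 'X))^`().[0]
  = (count_mem i s)%:R * mon X (rem i s).
Proof.
have at0 s' : (\prod_(k <- s') ((X 0 k)%:P + (k == i)%:R *: 'X)).[0] = mon X s'.
  rewrite horner_prod; apply: eq_bigr => k _.
  by rewrite hornerD hornerC hornerZ hornerX mulr0 addr0.
elim: s => [|k s IHs]; first by rewrite big_nil derivC horner0 mul0r.
rewrite big_cons derivM hornerD !hornerM IHs at0 derivD derivC derivZ derivX add0r.
rewrite hornerZ hornerC mulr1 hornerD hornerC hornerZ hornerX mulr0 addr0 /=.
case: eqP => [->|ki]; last by rewrite mul0r add0r add0n /mon big_cons mulrCA.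
rewrite mul1r natrD mulrDl mul1r; congr (_ + _).
have [si|si] := boolP (i \in s); last by rewrite (count_memPn si) !mul0r mulr0.
by rewrite (perm_mon X (perm_to_rem si)) /mon big_cons mulrCA.
Qed.

(** Monomials in commuting variables satisfy no relation other than permuting their factors, so a
    vanishing combination survives replacing each monomial by a permutation-invariant [phi].
    Induction on the degree: each partial derivative of the relation is a relation of lower degree,
    and Euler's identity puts them back together. *)
Lemma monomials_independent (V : lmodType R) J (a : J -> R) (s : J -> seq 'I_m)
    (l : seq J) (phi : seq 'I_m -> V) :
  (forall t t', perm_eq t t' -> phi t = phi t') ->
  (forall X, \sum_(j <- l) a j * mon X (s j) = 0) ->
  \sum_(j <- l) a j *: phi (s j) = 0.
Proof.
have := all_lt_bigmax l (size \o s); move: (_.+1) => N.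
elim: N J a s l phi => [|N IHN] J a s l phi sN phiP H.
  by case: l sN {H} => //; rewrite big_nil.
(* Summing over i the multiplicity of i in [s] gives the length of [s]; this weight cancels that
   factor. *)
pose phi' t := (size t)%:R^-1 *: phi t.
have step i : \sum_(j <- l) (a j * (count_mem i (s j))%:R) *: phi' (s j) = 0.
  pose l' := [seq j <- l | i \in s j].
  have -> : \sum_(j <- l) (a j * (count_mem i (s j))%:R) *: phi' (s j) =
      \sum_(j <- l') (a j * (count_mem i (s j))%:R) *: phi' (i :: rem i (s j)).
    rewrite big_filter [RHS]big_mkcond; apply: eq_bigr => j _.
    case: ifPn => [si|/count_memPn ->]; last by rewrite mulr0 scale0r.
    by rewrite /phi' (perm_size (perm_to_rem si)) (phiP _ _ (perm_to_rem si)).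
  apply: (IHN _ _ (fun j => rem i (s j)) l' (fun t => phi' (i :: t))) => [||X].
  - rewrite all_filter; apply: sub_all sN => j /= sjN; apply/implyP => si.
    by rewrite size_rem// -ltnS prednK//; case: (s j) si.
  - move=> t t' tt'; have itt' : perm_eq (i :: t) (i :: t') by rewrite perm_cons.
    by rewrite /phi' (perm_size itt') (phiP _ _ itt').
  (* The relation along the line X + t e_i. It vanishes for all natural t, hence identically, and
     its derivative at t = 0 is the relation of lower degree. *)
  pose p : {poly R} := \sum_(j <- l) a j *: \prod_(k <- s j) ((X 0 k)%:P + (k == i)%:R *: 'X).
  have p0 : p = 0.
    apply: poly_nat_roots => n; rewrite -(H (\row_k (X 0 k + (k == i)%:R * n%:R))).
    rewrite horner_sum; apply: eq_bigr => j _.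
    rewrite hornerZ horner_prod; congr (_ * _); apply: eq_bigr => k _.
    by rewrite hornerD hornerC hornerZ hornerX mxE.
  have : p^`().[0] = 0 by rewrite p0 derivC horner0.
  rewrite /p raddf_sum horner_sum => E; rewrite -[RHS]E big_filter big_mkcond.
  apply: eq_bigr => j _; rewrite /= derivZ hornerZ mon_deriv mulrA.
  by case: ifPn => // /count_memPn ->; rewrite mulr0 mul0r.
have S1 : \sum_(j <- l | size (s j) != 0%N) a j *: phi (s j) = 0.
  have : \sum_i \sum_(j <- l) (a j * (count_mem i (s j))%:R) *: phi' (s j) = 0.
    by rewrite big1.
  rewrite exchange_big /= => E; rewrite -[RHS]E big_mkcond /=; apply: eq_bigr => j _.
  rewrite -scaler_suml -mulr_sumr -natr_sum.
  have -> : (\sum_i count_mem i (s j))%N = size (s j).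
    elim: (s j) => [|x t IHt] /=; first by rewrite big1.
    rewrite big_split /= IHt (bigD1 x)//= eqxx big1 ?addn0// => i.
    by rewrite eq_sym => /negPf ->.
  rewrite /phi' !scalerA -mulrA; case: ifPn => [sj|/negPn/eqP ->].
    by rewrite mulfV ?mulr1// pnatr_eq0.
  by rewrite mul0r mulr0 scale0r.
have S2 : \sum_(j <- l | size (s j) == 0%N) a j *: phi (s j) = 0.
  transitivity ((\sum_(j <- l | size (s j) == 0%N) a j) *: phi [::]).
    by rewrite scaler_suml; apply: eq_bigr => j /nilP ->.
  have := H 0; rewrite (eq_bigr (fun j => if size (s j) == 0%N then a j else 0)).
    by rewrite -big_mkcond => ->; rewrite scale0r.
  by move=> j _; rewrite mon0; case: eqP => _; rewrite ?mulr1 ?mulr0.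
by rewrite (bigID (fun j => size (s j) == 0%N)) /= S2 S1 add0r.
Qed.

(** * Polynomial cocycles with symmetric part of bidegree (1, 1) are coboundaries *)

Section SymbolHKR.
Variables (I : Type) (J : seq I) (a : I -> R) (s r : I -> seq 'I_m).

Let sigma X Y := \sum_(j <- J) a j * (mon X (s j) * mon Y (r j)).
Let eta X := - \sum_(j <- J | size (r j) == 1%N)
  a j / (size (s j)).+1%:R * mon X (s j ++ r j).

Hypothesis cocycle : forall X Y Z,
  sigma Y Z - sigma (X + Y) Z + sigma X (Y + Z) - sigma X Y = 0.
(** Removes the constant term, the only one that cannot be recovered after multiplication by the
    degree. *)
Hypothesis sigma00 : sigma 0 0 = 0.
Hypothesis skew_part : forall X Y,
  \sum_(j <- J | (size (s j) == 1%N) && (size (r j) == 1%N))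
    a j * (mon X (s j) * mon Y (r j) - mon Y (s j) * mon X (r j)) = 0.

Let alt X Y := sigma X Y - sigma Y X.

(* The alternating part of a cocycle of a commutative algebra is a
   biderivation, so that its symbol is biadditive. *)
Let altDl X Y Z : alt (X + Y) Z = alt X Z + alt Y Z.
Proof.
(* The combination c1 - c2 + c3 inserts Z in all positions with sign: every term with a sum
   involving Z cancels. *)
have c1 := cocycle X Y Z; have c2 := cocycle X Z Y; have c3 := cocycle Z X Y.
move: c1 c2 c3; rewrite /alt (addrC Z X) (addrC Z Y) => c1 c2 c3.
lra.
Qed.

Let altN X Y : alt Y X = - alt X Y. Proof. by rewrite /alt opprB. Qed.

Let altMl n X Y : alt (n%:R *: X) Y = n%:R * alt X Y.
Proof.
elim: n => [|n IHn]; last by rewrite -!natr1 scalerDl scale1r altDl IHn mulrDl mul1r.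
rewrite scale0r mul0r; have := altDl 0 0 Y; rewrite addr0; lra.
Qed.

Let altMr n X Y : alt X (n%:R *: Y) = n%:R * alt X Y.
Proof. by rewrite altN altMl altN mulrN opprK. Qed.

Let altE X Y : alt X Y = \sum_(j <- J)
  a j * (mon X (s j) * mon Y (r j) - mon Y (s j) * mon X (r j)).
Proof. by rewrite /alt -sumrB; apply: eq_bigr => j _; rewrite mulrBr. Qed.

(** Biadditivity gives alt(nX, kY) = n k alt(X, Y), while the left side is a polynomial in n and k.
    Comparing coefficients of n k identifies [alt] with its bidegree (1, 1) part, which [skew_part]
    annihilates. *)
Let alt0 X Y : alt X Y = 0.
Proof.
pose c j := a j * (mon X (s j) * mon Y (r j)).
pose c' j := a j * (mon Y (s j) * mon X (r j)).
have E (n k : nat) : \sum_(j <- J) (c j * (n%:R ^+ size (s j) * k%:R ^+ size (r j))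
    - c' j * (k%:R ^+ size (s j) * n%:R ^+ size (r j))) = n%:R * (k%:R * alt X Y).
  rewrite -altMr -altMl altE; apply: eq_bigr => j _.
  by rewrite !monZ /c /c'; ring.
pose l := [seq (c j, (size (s j), size (r j))) | j <- J] ++
  [seq (- c' j, (size (r j), size (s j))) | j <- J] ++ [:: (- alt X Y, (1, 1)%N)].
have /power_sum_moments2 : forall n k : nat,
    \sum_(j <- l) j.1 * (n%:R ^+ j.2.1 * k%:R ^+ j.2.2) = 0.
  move=> n k; rewrite !big_cat !big_map big_seq1 /= addrA -big_split /=.
  transitivity (n%:R * (k%:R * alt X Y) - alt X Y * (n%:R * k%:R)); last by ring.
  by rewrite -(E n k); congr (_ + _); [apply: eq_bigr => j _; ring|ring].
move=> /(_ (fun n => (n == 1%N)%:R) (fun n => (n == 1%N)%:R)).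
rewrite !big_cat !big_map big_seq1 /= addrA -big_split /= !mulr1 => /eqP.
rewrite subr_eq0 => /eqP <-; rewrite -[RHS](skew_part X Y) [RHS]big_mkcond.
apply: eq_bigr => j _ /=; rewrite /c /c'.
by case: (size (s j) == 1%N); case: (size (r j) == 1%N); rewrite /=; ring.
Qed.

Let sigmaC X Y : sigma X Y = sigma Y X.
Proof. by apply/eqP; rewrite -subr_eq0; apply/eqP/alt0. Qed.

Let d X Z := \sum_(j <- J | size (r j) == 1%N) a j * (mon X (s j) * mon Z (r j)).

Let dD X Y Z : d X (Y + Z) = d X Y + d X Z.
Proof.
by rewrite -big_split; apply: eq_bigr => j /eqP r1 /=; rewrite mon1D// !mulrDr.
Qed.

(* Coefficient of t in the cocycle identity at (X, Y, tY). *)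
Let euler_r X Y : \sum_(j <- J) a j * (size (r j))%:R * (mon X (s j) * mon Y (r j))
  = d (X + Y) Y - d Y Y.
Proof.
pose l := [seq (a j * (mon Y (s j) * mon Y (r j)), 'X^(size (r j))) | j <- J] ++
  [seq (- a j * (mon (X + Y) (s j) * mon Y (r j)), 'X^(size (r j))) | j <- J] ++
  [seq (a j * (mon X (s j) * mon Y (r j)), ('X + 1) ^+ (size (r j))) | j <- J] ++
  [seq (- a j * (mon X (s j) * mon Y (r j)), 1 : {poly R}) | j <- J].
have /poly_sum_coef : forall n : nat, \sum_(j <- l) j.1 * j.2.[n%:R] = 0.
  move=> n; have := cocycle X Y (n%:R *: Y); have -> : Y + n%:R *: Y = (1 + n%:R) *: Y by rewrite
    scalerDl scale1r.
  move=> E.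
  rewrite -[RHS]E !big_cat !big_map /= !addrA; congr (_ + _ + _ + _).
  - by apply: eq_bigr => j _; rewrite hornerXn monZ; ring.
  - by rewrite -sumrN; apply: eq_bigr => j _; rewrite hornerXn monZ; ring.
  - apply: eq_bigr => j _; rewrite horner_exp hornerD hornerX hornerC monZ addrC; ring.
  - by rewrite -sumrN; apply: eq_bigr => j _; rewrite hornerC; ring.
move=> /(_ 1%N); rewrite !big_cat !big_map /= !addrA.
have -> : \sum_(j <- J) a j * (mon Y (s j) * mon Y (r j)) * ('X^(size (r j)) : {poly R})`_1 = d Y Y.
  rewrite /d [RHS]big_mkcond; apply: eq_bigr => j _.
  by rewrite coefXn eq_sym; case: eqP; rewrite ?mulr1 ?mulr0.
have -> : \sum_(j <- J) - a j * (mon (X + Y) (s j) * mon Y (r j)) * ('X^(size (r j)) : {poly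
  R})`_1 = - d (X + Y) Y.
  rewrite /d -sumrN [RHS]big_mkcond; apply: eq_bigr => j _.
  by rewrite coefXn eq_sym; case: eqP; rewrite ?mulr1 ?mulr0 ?mulNr.
rewrite [X in _ + X]big1 ?addr0 => [|j _]; last by rewrite coef1 mulr0.
under eq_bigr do rewrite coef1_exp_X1 mulrAC.
lra.
Qed.

(* Coefficient of t in sigma((1 + t)X, Y) = sigma(Y, (1 + t)X). *)
Let euler_l X Y : \sum_(j <- J) a j * (size (s j))%:R * (mon X (s j) * mon Y (r j))
  = d (X + Y) X - d X X.
Proof.
rewrite (addrC X) -euler_r.
pose l := [seq (a j * (mon X (s j) * mon Y (r j)), ('X + 1) ^+ (size (s j)) : {poly R}) | j <- J] ++
  [seq (- a j * (mon Y (s j) * mon X (r j)), ('X + 1) ^+ (size (r j))) | j <- J].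
have /poly_sum_coef : forall n : nat, \sum_(j <- l) j.1 * j.2.[n%:R] = 0.
  move=> n; apply/eqP; rewrite big_cat !big_map /=.
  have := sigmaC ((n%:R + 1) *: X) Y => /eqP; rewrite -subr_eq0 /sigma -sumrN => /eqP E.
  apply/eqP; rewrite -[RHS]E; congr (_ + _); apply: eq_bigr => j _;
    rewrite horner_exp hornerD hornerX hornerC monZ; ring.
move=> /(_ 1%N); rewrite !big_cat !big_map /= => /eqP; rewrite addr_eq0 -sumrN => /eqP E.
transitivity (\sum_(j <- J) a j * (mon X (s j) * mon Y (r j)) * (('X + 1) ^+ size (s j) : {poly
  R})`_1).
  by apply: eq_bigr => j _; rewrite coef1_exp_X1; ring.
by rewrite E; apply: eq_bigr => j _; rewrite coef1_exp_X1; ring.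
Qed.

(* The degree n part of sigma, multiplied by n, is the coboundary of -d(X, X) by
   [euler_l] and [euler_r]; a term of d(X, X) with |r| = 1 has degree |s| + 1,
   whence the denominators in eta. *)
Lemma symbol_hkr X Y : sigma X Y = eta X + eta Y - eta (X + Y).
Proof.
pose e j := mon (X + Y) (s j ++ r j) - mon X (s j ++ r j) - mon Y (s j ++ r j).
pose l := [seq (a j * (size (s j) + size (r j))%:R * (mon X (s j) * mon Y (r j)),
    (size (s j) + size (r j))%N) | j <- J] ++
  [seq (- a j * e j, (size (s j)).+1) | j <- J & size (r j) == 1%N].
have : forall n : nat, \sum_(j <- l) j.1 * n%:R ^+ j.2 = 0.
  move=> n; pose nX := n%:R *: X; pose nY := n%:R *: Y.
  have E : \sum_(j <- J) a j * (size (s j) + size (r j))%:R * (mon nX (s j) * mon nY (r j))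
      = d (nX + nY) (nX + nY) - d nX nX - d nY nY.
    under eq_bigr do rewrite natrD mulrDr mulrDl.
    by rewrite big_split /= euler_l euler_r dD; ring.
  rewrite big_cat !big_map big_filter /=; apply/eqP; rewrite addr_eq0; apply/eqP.
  rewrite -sumrN; transitivity (\sum_(j <- J) a j * (size (s j) + size (r j))%:R * (mon nX (s j)
    * mon nY (r j))).
    by apply: eq_bigr => j _; rewrite !monZ exprD; ring.
  rewrite E /d -!sumrB; apply: eq_bigr => j /eqP r1.
  by rewrite /e !mon_cat /nX /nY -scalerDr !monZ r1 [_ ^+ (size _).+1]exprS expr1; ring.
move=> /power_sum_moments /(_ (fun k => k%:R^-1)); rewrite big_cat !big_map big_filter /=.
have -> : \sum_(j <- J) a j * (size (s j) + size (r j))%:R * (mon X (s j) * mon Y (r j)) *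
   (size (s j) + size (r j))%:R^-1 = sigma X Y.
  (* The inverse of 0 is 0, so dividing by the degree loses the terms of degree zero; these add up
     to [sigma 0 0]. *)
  transitivity (sigma X Y - sigma 0 0); last by rewrite sigma00 subr0.
  rewrite /sigma -sumrB; apply: eq_bigr => j _.
  rewrite !mon0; have [k0|k0] := eqVneq (size (s j) + size (r j))%N 0%N.
    move/eqP: k0; rewrite addn_eq0 => /andP[/nilP -> /nilP ->] /=.
    by rewrite /mon !big_nil; ring.
  have kN0 : (size (s j) + size (r j))%:R != 0 :> R by rewrite pnatr_eq0.
  rewrite mulrAC mulfK//.
  by move: k0; rewrite addn_eq0; do 2?case: eqP => _ //=; rewrite ?mulr0 ?mul0r ?mulr0 subr0.
move=> /eqP; rewrite addr_eq0 => /eqP ->; rewrite /eta -!sumrN -!big_split /=.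
by apply: eq_bigr => j /eqP r1; rewrite /e; ring.
Qed.

End SymbolHKR.

End PolynomialLemmas.

(** * Symmetric Hochschild cocycles at a point *)

Section PointwiseHKR.
Variables (R : realType) (m : nat) (xi : 'rV[R]_m).
Local Notation A := (smfun R m).
Implicit Types (u v w f : A) (X Y : 'rV[R]_m).

Definition dparts (s : seq 'I_m) f : A := foldr (@dpart R m) f s.

Lemma perm_dparts s t f : perm_eq s t -> dparts s f = dparts t f.
Proof.
have E q : val (dparts q f) = partials q f by elim: q => //= i q <-.
by move=> st; apply/val_inj; rewrite !E; apply: (perm_partials st (sfun_smooth f)).
Qed.

Lemma dpart_cst i (c : R) : dpart i (c%:A : A) = 0.
Proof.
rewrite linearZ /= (_ : dpart i 1 = 0) ?scaler0//.
by apply/val_inj; rewrite /= partial1.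
Qed.

Lemma dparts_exps s X : dparts s (exps xi X) = mon X s *: exps xi X.
Proof.
elim: s => [|i s IHs]; first by rewrite /mon big_nil scale1r.
by rewrite /= IHs linearZ /= dpart_exps scalerA /mon big_cons mulrC.
Qed.

Lemma dparts_affine s X : s != [::] ->
  dparts s (affine xi X) = (if size s == 1%N then mon X s else 0)%:A.
Proof.
elim: s => // i [|j s] IHs _; first by rewrite /= dpart_affine /mon big_seq1.
by rewrite /= in IHs *; rewrite IHs// dpart_cst scale0r.
Qed.

Fixpoint splits (s : seq 'I_m) : seq (seq 'I_m * seq 'I_m) :=
  if s is i :: s' then
    [seq (i :: p.1, p.2) | p <- splits s'] ++ [seq (p.1, i :: p.2) | p <- splits s']
  else [:: ([::], [::])].

Lemma dpartsM s u v :
  dparts s (u * v) = \sum_(p <- splits s) dparts p.1 u * dparts p.2 v.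
Proof.
elim: s => [|i s IHs]; first by rewrite /= big_seq1.
rewrite /= IHs raddf_sum big_cat /= !big_map -big_split /=.
by apply: eq_bigr => p _; rewrite dpartM.
Qed.

(** A bidifferential operator followed by evaluation at [xi]: its coefficients are frozen to real
    numbers, so it is determined by a polynomial symbol. *)
Definition bidiff_at (F : A -> A -> R) := exists l : seq (R * (seq 'I_m * seq 'I_m)),
  forall u v, F u v = \sum_(j <- l) j.1 * (dparts j.2.1 u xi * dparts j.2.2 v xi).

Lemma bidiff_atD F G : bidiff_at F -> bidiff_at G -> bidiff_at (fun u v => F u v + G u v).
Proof.
by move=> [l lF] [l' lG]; exists (l ++ l') => u v; rewrite big_cat lF lG.
Qed.

Lemma bidiff_at_sum I (r : seq I) (P : pred I) F : (forall i, bidiff_at (F i)) ->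
  bidiff_at (fun u v => \sum_(i <- r | P i) F i u v).
Proof.
move=> bF; elim: r => [|i r IHr].
  by exists [::] => u v; rewrite !big_nil.
have [Pi|Pi] := boolP (P i); last first.
  by case: IHr => l lE; exists l => u v; rewrite big_cons (negPf Pi).
have [l lE] := bidiff_atD (bF i) IHr.
by exists l => u v; rewrite big_cons Pi lE.
Qed.

Lemma bidiff_at1 (a : R) s r :
  bidiff_at (fun u v => a * (dparts s u xi * dparts r v xi)).
Proof. by exists [:: (a, (s, r))] => u v; rewrite big_seq1. Qed.

Lemma dparts_exps_center s X : dparts s (exps xi X) xi = mon X s.
Proof. by rewrite dparts_exps -[LHS]/(mon X s * exps xi X xi) exps_center mulr1. Qed.

(* At xi, the exponentials e^(X (x - xi)) have arbitrary monomials as partial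
   derivatives. *)
Lemma bidiff_at_eq0 F : bidiff_at F ->
  (forall X Y, F (exps xi X) (exps xi Y) = 0) -> forall u v, F u v = 0.
Proof.
move=> [l lF] F0 u v; rewrite lF.
have E X Y : \sum_(j <- l) j.1 * (mon X j.2.1 * mon Y j.2.2) = 0.
  by rewrite -[RHS](F0 X Y) lF; apply: eq_bigr => j _; rewrite !dparts_exps_center.
(* Independence of monomials is applied in one argument at a time: first in X with Y fixed, then in
   Y. *)
have E1 Y : \sum_(j <- l) (j.1 * mon Y j.2.2) *: (dparts j.2.1 u xi : R^o) = 0.
  apply: (monomials_independent (s := fun j => j.2.1) (phi := fun s => dparts s u xi : R^o)) =>
    [t t' /perm_dparts ->//|X].
  by rewrite -[RHS](E X Y); apply: eq_bigr => j _; ring.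
rewrite -[RHS](_ : \sum_(j <- l) (j.1 * dparts j.2.1 u xi) *: (dparts j.2.2 v xi : R^o) = 0).
  by apply: eq_bigr => j _; rewrite mulrA.
apply: (monomials_independent (s := fun j => j.2.2) (phi := fun s => dparts s v xi : R^o)) => [t
  t' /perm_dparts ->//|Y].
by rewrite -[RHS](E1 Y); apply: eq_bigr => j _; rewrite -[RHS]/(_ * _); ring.
Qed.

(** Both sides are bidifferential at [xi], so it suffices to compare them on exponentials, where the
    claim is [symbol_hkr]. The symmetry assumed on affine functions is the condition on the bidegree
    (1, 1) terms. *)
Lemma hkr_at (I : Type) (l : seq I) (a : I -> R) (s r : I -> seq 'I_m)
    (D : A -> A -> R) (E : A -> R) :
  (forall u v, D u v = \sum_(j <- l) a j * (dparts (s j) u xi * dparts (r j) v xi)) ->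
  (forall u, E u = - \sum_(j <- l | size (r j) == 1%N)
     a j / (size (s j)).+1%:R * dparts (s j ++ r j) u xi) ->
  (forall u v w, u xi * D v w - D (u * v) w + D u (v * w) - D u v * w xi = 0) ->
  D 1 1 = 0 ->
  (forall X Y, D (affine xi X) (affine xi Y) = D (affine xi Y) (affine xi X)) ->
  forall u v, D u v = u xi * E v - E (u * v) + E u * v xi.
Proof.
move=> lD lE cocycle D11 Dsym u v; apply/eqP; rewrite -subr_eq0; apply/eqP.
have DX X Y : D (exps xi X) (exps xi Y) = \sum_(j <- l) a j * (mon X (s j) * mon Y (r j)).
  by rewrite lD; apply: eq_bigr => j _; rewrite !dparts_exps_center.
have EX X : E (exps xi X) = - \sum_(j <- l | size (r j) == 1%N)
     a j / (size (s j)).+1%:R * mon X (s j ++ r j).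
  by rewrite lE; congr (- _); apply: eq_bigr => j _; rewrite dparts_exps_center.
have DA X Y : D (affine xi X) (affine xi Y) =
    \sum_(j <- l | (size (s j) == 1%N) && (size (r j) == 1%N)) a j * (mon X (s j) * mon Y (r j)).
  rewrite lD [RHS]big_mkcond; apply: eq_bigr => j _.
  have AX t Z : dparts t (affine xi Z) xi = if size t == 1%N then mon Z t else 0.
    have [->|t0] := eqVneq t [::]; first exact: affine_center.
    by rewrite dparts_affine// -[LHS]/(_ * 1) mulr1.
  by rewrite !AX; do 2?case: ifP => _ //=; rewrite ?mul0r ?mulr0.
pose F u v := D u v - (u xi * E v - E (u * v) + E u * v xi).
apply: (@bidiff_at_eq0 F) => [|X Y]; last first.
  rewrite /F -expsD DX !EX !exps_center mul1r mulr1.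
  apply/eqP; rewrite subr_eq0; apply/eqP.
  rewrite (@symbol_hkr R m I l a s r) => [|X' Y' Z'||X' Y']; first by ring.
  - have := cocycle (exps xi X') (exps xi Y') (exps xi Z').
    by rewrite -!expsD !DX !exps_center mul1r mulr1.
  - by rewrite -DX exps0.
  - under eq_bigr do rewrite mulrBr.
    rewrite sumrB -DA Dsym DA; apply/eqP; rewrite subr_eq0; apply/eqP.
    by apply: eq_bigr => j _.
(* Coefficients extended by zero, so that D and E are sums over the same list and their difference
   is bidifferential term by term; E(uv) is expanded by the Leibniz rule. *)
pose c j := if size (r j) == 1%N then a j / (size (s j)).+1%:R else 0.
have Ec w : E w = \sum_(j <- l) - c j * dparts (s j ++ r j) w xi.
  rewrite lE -sumrN big_mkcond; apply: eq_bigr => j _.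
  by rewrite /c; case: ifP; rewrite ?mulNr// mul0r oppr0.
pose G j u v := a j * (dparts (s j) u xi * dparts (r j) v xi) +
  (c j * (dparts [::] u xi * dparts (s j ++ r j) v xi) +
  (c j * (dparts (s j ++ r j) u xi * dparts [::] v xi) +
  \sum_(p <- splits (s j ++ r j)) - c j * (dparts p.1 u xi * dparts p.2 v xi))).
have bG : bidiff_at (fun u v => \sum_(j <- l) G j u v).
  apply: bidiff_at_sum => j; do 3 apply: (bidiff_atD (bidiff_at1 _ _ _)).
  by apply: bidiff_at_sum => p; exact: bidiff_at1.
case: bG => l' El'; exists l' => w z; rewrite -El' /F lD !Ec.
rewrite mulr_sumr mulr_suml -sumrB -big_split -sumrB /=; apply: eq_bigr => j _.
rewrite /G dpartsM.
have -> : (\sum_(p <- splits (s j ++ r j)) dparts p.1 w * dparts p.2 z) xi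
    = \sum_(p <- splits (s j ++ r j)) dparts p.1 w xi * dparts p.2 z xi.
  by elim: (splits _) => [|p q IHq]; rewrite ?big_nil// !big_cons -IHq.
by rewrite -mulr_sumr; ring.
Qed.

End PointwiseHKR.

(** * Graph operators *)

Section Leibniz.
Context {R : realType} {m : nat}.
Local Notation A := (smfun R m).

Lemma dparts_linear s : linear (@dparts R m s).
Proof.
by move=> a f g; elim: s => [//|i s IHs]; rewrite /= IHs linearP.
Qed.

HB.instance Definition _ s := GRing.isLinear.Build R A A _ (dparts s) (dparts_linear s).

Lemma dparts_cat s t (f : A) : dparts (s ++ t) f = dparts s (dparts t f).
Proof. exact: foldr_cat. Qed.

Lemma dpart1 i : dpart i (1 : A) = 0.
Proof. by rewrite -[1]scale1r dpart_cst. Qed.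

Lemma dpart_prod (V : eqType) (r : seq V) (K : V -> A) i : uniq r ->
  dpart i (\prod_(v <- r) K v)
  = \sum_(v0 <- r) \prod_(v <- r) (if v == v0 then dpart i (K v) else K v).
Proof.
elim: r => [|x r IHr] /=; first by rewrite !big_nil dpart1.
move=> /andP[xr ur]; rewrite big_cons dpartM IHr// big_cons big_cons eqxx.
congr (_ * _ + _).
  by rewrite !big_seq; apply: eq_bigr => v vr; case: eqP xr => // <-; rewrite vr.
rewrite mulr_sumr !big_seq; apply: eq_bigr => v vr.
by rewrite big_cons; case: eqP xr => // ->; rewrite vr.
Qed.

(** Leibniz rule: each derivative [e] chooses the factor [phi e] on which it acts. The list of
    choices depends neither on the directions [I] nor on the factors [H]; this lets each choice
    become a net. The given element of V is the default value of [phi] off [s]. *)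
Lemma dparts_prod (V E : finType) (s : seq E) : V -> uniq s ->
  exists Phi : seq (E -> V), forall (I : E -> 'I_m) (H : V -> A),
    dparts (map I s) (\prod_v H v)
    = \sum_(phi <- Phi) \prod_v dparts [seq I e | e <- s & phi e == v] (H v).
Proof.
move=> v0; elim: s => [|e s IHs] /=.
  by move=> _; exists [:: fun _ => v0] => I H; rewrite big_seq1.
move=> /andP[es /IHs[Phi HPhi]].
exists [seq (fun e' => if e' == e then v else phi e') | phi <- Phi, v <- index_enum V].
move=> I H; rewrite HPhi raddf_sum big_allpairs_dep; apply: eq_bigr => phi _ /=.
rewrite dpart_prod ?index_enum_uniq//; apply: eq_bigr => w _.
apply: eq_bigr => v _.
have -> : [seq e' <- s | (if e' == e then w else phi e') == v] = [seq e' <- s | phi e' == v].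
  by apply: eq_in_filter => e' e's; rewrite ifN//; apply: contraNneq es => <-.
by rewrite eqxx (eq_sym w); case: eqP.
Qed.

End Leibniz.

(* Graphs without the bound on multiple edges, which the Leibniz rule creates;
   see [double_edge_op]. *)
Record net (B : finType) := Net {
  nv : finType;
  tgt : nv * bool -> nv + B;
  noloop : forall e, tgt e != inl e.1 }.

Section Nets.
Context {R : realType} {m : nat}.
Local Notation A := (smfun R m).
Local Notation tensor := ('I_m -> 'I_m -> A).
Implicit Types (P : tensor).

Definition incoming (E : finType) (X : eqType) (t : E -> X) (I : E -> 'I_m) x :=
  [seq I e | e <- enum E & t e == x].

Definition net_coef B (N : net B) P (I : nv N * bool -> 'I_m) : A :=
  \prod_j dparts (incoming (tgt (n := N)) I (inl j)) (P (I (j, false)) (I (j, true))).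

Definition net_op B (N : net B) P (F : B -> A) : A :=
  \sum_(I : {ffun nv N * bool -> 'I_m})
    net_coef P I * \prod_b dparts (incoming (tgt (n := N)) I (inr b)) (F b).

Section EdgesOfSum.
Variables K K' : finType.
Local Notation K2 := (K + K')%type.
Definition edgel (e : K * bool) : K2 * bool := (inl e.1, e.2).
Definition edger (e : K' * bool) : K2 * bool := (inr e.1, e.2).

Lemma perm_enum_edges :
  perm_eq (enum {: K2 * bool})
    ([seq edgel e | e <- enum {: K * bool}] ++ [seq edger e | e <- enum {: K' * bool}]).
Proof.
apply: uniq_perm; first exact: enum_uniq.
  have injl : injective edgel by move=> [? ?] [? ?] [-> ->].
  have injr : injective edger by move=> [? ?] [? ?] [-> ->].
  rewrite cat_uniq (map_inj_uniq injl) (map_inj_uniq injr) !enum_uniq andbT /=.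
  by apply/hasPn => e /mapP[e' _ ->]; apply/mapP => -[].
move=> [[j|j] b]; rewrite mem_enum mem_cat !inE; apply/esym/orP.
  by left; apply/mapP; exists (j, b); rewrite ?mem_enum.
by right; apply/mapP; exists (j, b); rewrite ?mem_enum.
Qed.

Definition join_index (I : K * bool -> 'I_m) (I' : K' * bool -> 'I_m) (e : K2 * bool) :=
  match e.1 with inl j => I (j, e.2) | inr j => I' (j, e.2) end.

Lemma incoming_sum (X : eqType) (t : K2 * bool -> X) I I' x :
  perm_eq (incoming t (join_index I I') x)
    (incoming (t \o edgel) I x ++ incoming (t \o edger) I' x).
Proof.
rewrite (permPl (perm_map _ (perm_filter _ perm_enum_edges))).
rewrite /incoming filter_cat map_cat.
move: (enum {: K * bool}) (enum {: K' * bool}) => l l'.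
rewrite !filter_map -!map_comp.
have EI : (join_index I I') \o edgel =1 I by case.
have EI' : (join_index I I') \o edger =1 I' by case.
by rewrite (eq_map EI) (eq_map EI').
Qed.

Lemma sum_join_index (G : (K2 * bool -> 'I_m) -> A) :
  \sum_(J : {ffun K2 * bool -> 'I_m}) G J =
  \sum_(I : {ffun K * bool -> 'I_m}) \sum_(I' : {ffun K' * bool -> 'I_m})
    G (join_index I I').
Proof.
rewrite pair_big /= (reindex (fun q : {ffun K * bool -> 'I_m} * {ffun K' * bool -> 'I_m} =>
  [ffun e => join_index q.1 q.2 e])) /=.
  by apply: eq_bigr => q _; congr G; apply/funext => e; rewrite ffunE.
exists (fun J : {ffun K2 * bool -> 'I_m} => ([ffun e => J (edgel e)], [ffun e => J (edger e)])).
  by move=> [I I'] _ /=; congr (_, _); apply/ffunP => -[j b]; rewrite !ffunE.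
by move=> J _; apply/ffunP => -[[j|j] b]; rewrite ffunE /join_index /= ffunE.
Qed.

End EdgesOfSum.
Arguments edgel {K K'}.
Arguments edger {K K'}.

(** * Plugging one net into a ground vertex of another *)

Section Substitution.
Variables (B B' C : finType) (b0 : B) (k : B -> C) (r : B' -> C).
Hypothesis kr : forall b b', b != b0 -> k b != r b'.
Hypothesis k_inj : forall b1 b2, b1 != b0 -> b2 != b0 -> k b1 = k b2 -> b1 = b2.
Hypothesis r_inj : injective r.
Hypothesis kr_prod : forall G : C -> A,
  \prod_c G c = \prod_(b | b != b0) G (k b) * \prod_b G (r b).
Variables (N : net B) (N' : net B').

Section NewTarget.
Variable phi : nv N * bool -> nv N' + B'.

Definition sub_emb (x : nv N' + B') : (nv N + nv N') + C :=
  match x with inl j => inl (inr j) | inr b => inr (r b) end.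

(** The edges of [N] that ended at [b0] are redirected to the vertices of [N'] chosen by [phi],
    whose values on the other edges are never read. The maps [k] and [r] place the remaining ground
    vertices in [C]. *)
Definition sub_tgt (e : (nv N + nv N') * bool) : (nv N + nv N') + C :=
  match e.1 with
  | inl j =>
    match tgt (j, e.2) with
    | inl j2 => inl (inl j2)
    | inr b => if b == b0 then sub_emb (phi (j, e.2)) else inr (k b)
    end
  | inr j => sub_emb (tgt (j, e.2))
  end.

Lemma sub_noloop e : sub_tgt e != inl e.1.
Proof.
case: e => [[j|j] b]; rewrite /sub_tgt /=.
  have := noloop (j, b); case: (tgt (j, b)) => [j2|b1]; first by apply: contra => /eqP[->].
  by move=> _; case: ifP => // _; case: (phi _).
by have := noloop (j, b); case: (tgt (j, b)) => // j2; apply: contra => /eqP[->].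
Qed.

Let inrE (X Y : eqType) (x y : Y) : (inr x == inr y :> X + Y) = (x == y).
Proof. by []. Qed.

Lemma sub_emb_old x j : (sub_emb x == inl (inl j)) = false.
Proof. by case: x. Qed.

Lemma sub_emb_new x j : (sub_emb x == inl (inr j)) = (x == inl j).
Proof. by case: x. Qed.

Lemma sub_emb_k x b : b != b0 -> (sub_emb x == inr (k b)) = false.
Proof. by case: x => //= b' /(kr b') ; rewrite inrE eq_sym => /negPf. Qed.

Lemma sub_emb_r x b : (sub_emb x == inr (r b)) = (x == inr b).
Proof. by case: x => //= b'; rewrite !inrE (inj_eq r_inj). Qed.

Lemma sub_tgtr e : sub_tgt (edger e) = sub_emb (tgt e).
Proof. by case: e. Qed.

Lemma sub_tgtl e : sub_tgt (edgel e) = match tgt e with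
  | inl j => inl (inl j)
  | inr b => if b == b0 then sub_emb (phi e) else inr (k b) end.
Proof. by case: e. Qed.

Lemma sub_tgtl_old e j : (sub_tgt (edgel e) == inl (inl j)) = (tgt e == inl j).
Proof.
by rewrite sub_tgtl; case: (tgt e) => // b; case: ifP => // _; rewrite sub_emb_old.
Qed.

Lemma sub_tgtl_emb e x :
  (sub_tgt (edgel e) == sub_emb x) = (tgt e == inr b0) && (phi e == x).
Proof.
rewrite sub_tgtl; case: (tgt e) => [j|b]; first by case: x.
rewrite inrE; case: ifPn => bb0 /=; last by case: x => //= b'; exact: (negPf (@kr b b' bb0)).
by case: x => b'; rewrite /= ?sub_emb_new ?sub_emb_r.
Qed.

Lemma sub_tgtl_k e b : b != b0 -> (sub_tgt (edgel e) == inr (k b)) = (tgt e == inr b).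
Proof.
move=> bb0; rewrite sub_tgtl; case: (tgt e) => // b1; rewrite inrE.
case: (eqVneq b1 b0) => [->|b10]; first by rewrite sub_emb_k// eq_sym (negPf bb0).
by rewrite inrE; apply/eqP/eqP => [/k_inj->|->].
Qed.

Definition sub_net : net C := Net sub_noloop.

End NewTarget.

(** The inserted operator is a sum of products with one factor per vertex of [N']. The derivatives
    arriving at [b0] are distributed over these factors, and each distribution [phi] is a new
    net. *)
Lemma subst_net : B' -> exists Phi : seq (nv N * bool -> nv N' + B'), forall P (F : C -> A),
  net_op N P (fun b => if b == b0 then net_op N' P (F \o r) else F (k b))
  = \sum_(phi <- Phi) net_op (sub_net phi) P F.
Proof.
move=> b'0; pose s := [seq e <- enum {: nv N * bool} | tgt e == inr b0].
have us : uniq s by rewrite filter_uniq// enum_uniq.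
have [Phi HPhi] := dparts_prod (R := R) (m := m) (inr b'0 : nv N' + B') us.
exists Phi => P F; rewrite /net_op.
pose H (I' : nv N' * bool -> 'I_m) (v : nv N' + B') : A := match v with
  | inl j => dparts (incoming (tgt (n := N')) I' (inl j)) (P (I' (j, false)) (I' (j, true)))
  | inr b => dparts (incoming (tgt (n := N')) I' (inr b)) (F (r b)) end.
transitivity (\sum_(I : {ffun nv N * bool -> 'I_m}) \sum_(I' : {ffun nv N' * bool -> 'I_m})
   \sum_(phi <- Phi) net_coef (N := N) P I * (\prod_(b | b != b0)
     dparts (incoming (tgt (n := N)) I (inr b)) (F (k b)) *
     \prod_v dparts [seq I e | e <- s & phi e == v] (H I' v))).
  apply: eq_bigr => I _; rewrite (bigD1 b0)//= eqxx.
  rewrite (_ : \sum_(I' : {ffun nv N' * bool -> 'I_m}) _ = \sum_(I' : {ffun nv N' * bool ->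
    'I_m}) \prod_v H I' v); last first.
    by apply: eq_bigr => I' _; rewrite big_sumType.
  rewrite raddf_sum mulr_suml mulr_sumr; apply: eq_bigr => I' _ /=.
  rewrite -mulr_sumr -mulr_sumr -HPhi; congr (_ * _); rewrite mulrC.
  by congr (_ * _); apply: eq_bigr => b /negPf ->.
under [RHS]eq_bigr => phi _ do rewrite (sum_join_index (fun J => net_coef (N := sub_net phi) P J *
  \prod_b dparts (incoming (tgt (n := sub_net phi)) J (inr b)) (F b))).
rewrite [RHS]exchange_big; apply: eq_bigr => I _; rewrite [RHS]exchange_big; apply: eq_bigr => I' _.
apply: eq_bigr => phi _.
rewrite [X in _ * (_ * X)]big_sumType mulrA.
rewrite [X in _ = X * _]/net_coef [X in _ = X * _]big_sumType kr_prod mulrACA.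
have inc_emb x (e : nv N * bool -> 'I_m) :
    incoming (sub_tgt phi \o edgel) e (sub_emb x) = [seq e i | i <- s & phi i == x].
  rewrite /s -filter_predI; congr map; apply: eq_filter => i /=.
  by rewrite sub_tgtl_emb andbC.
have inc_r (x : nv N' + B') y (e : nv N' * bool -> 'I_m) :
    (forall z, (sub_emb z == y) = (z == x)) ->
    incoming (sub_tgt phi \o edger) e y = incoming (tgt (n := N')) e x.
  by move=> xy; congr map; apply: eq_filter => i /=; rewrite sub_tgtr xy.
have inc_r0 y (e : nv N' * bool -> 'I_m) : (forall z, (sub_emb z == y) = false) ->
    incoming (sub_tgt phi \o edger) e y = [::].
  move=> y0; rewrite /incoming (eq_filter (a2 := pred0)) ?filter_pred0// => i /=.
  by rewrite sub_tgtr y0.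
(* The incoming edges are compared for the four kinds of vertices in turn: vertices of [N], vertices
   of [N'], ground vertices kept from [N], ground vertices of [N']. *)
congr (_ * _ * (_ * _)); apply: eq_bigr => x Hx; rewrite (perm_dparts _ (incoming_sum _ _ _ _))
  dparts_cat.
- rewrite inc_r0 => [|z]; last exact: sub_emb_old.
  congr (dparts _ _); congr map; apply: eq_filter => i /=; by rewrite sub_tgtl_old.
- rewrite (inc_r (inl x)) => [|z]; last exact: sub_emb_new.
  by rewrite (inc_emb (inl x)).
- rewrite inc_r0 => [|z]; last exact: sub_emb_k.
  congr (dparts _ _); congr map; apply: eq_filter => i /=; by rewrite sub_tgtl_k.
- rewrite (inc_r (inr x)) => [|z]; last exact: sub_emb_r.
  by rewrite (inc_emb (inr x)).
Qed.

End Substitution.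

End Nets.

Section Universal.
Context {R : realType} {m : nat}.
Local Notation A := (smfun R m).
Local Notation tensor := ('I_m -> 'I_m -> A).
Implicit Types (P : tensor).

Lemma smfun_sumE I (r : seq I) (p : pred I) (F : I -> A) x :
  (\sum_(i <- r | p i) F i) x = \sum_(i <- r | p i) F i x.
Proof. exact: (big_morph (fun f : A => f x)). Qed.

Lemma smfun_prodE I (r : seq I) (p : pred I) (F : I -> A) x :
  (\prod_(i <- r | p i) F i) x = \prod_(i <- r | p i) F i x.
Proof. exact: (big_morph (fun f : A => f x)). Qed.

(** Skewness kills double edges, and vanishing second derivatives kill vertices with two incoming
    edges. The Jacobi identity is kept apart, in [good]. *)
Definition linear_tensor P := (forall i j, P i j = - P j i) /\
  (forall i j k l, dpart k (dpart l (P i j)) = 0).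

(** The quantifier order is the point: one list of nets and scalars serves every tensor. *)
Definition universal (B : finType) (Q : tensor -> (B -> A) -> A) :=
  exists L : seq (R * net B), forall P, linear_tensor P -> forall F,
    Q P F = \sum_(x <- L) x.1 *: net_op x.2 P F.

Lemma universal_ext (B : finType) (Q Q' : tensor -> (B -> A) -> A) :
  (forall P, linear_tensor P -> forall F, Q P F = Q' P F) -> universal Q' -> universal Q.
Proof. by move=> QQ' [L HL]; exists L => P lP F; rewrite QQ'// HL. Qed.

Lemma universal_sum (B : finType) (I : Type) (r : seq I) (p : pred I)
    (Q : I -> tensor -> (B -> A) -> A) :
  (forall i, p i -> universal (Q i)) -> universal (fun P F => \sum_(i <- r | p i) Q i P F).
Proof.
move=> uQ; elim: r => [|i r [L HL]].
  by exists [::] => P lP F; rewrite !big_nil.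
have [pi|pi] := boolP (p i); last first.
  by exists L => P lP F; rewrite big_cons (negPf pi) HL.
have [L' HL'] := uQ i pi; exists (L' ++ L) => P lP F.
by rewrite big_cons pi big_cat HL// HL'.
Qed.

Lemma universalZ (B : finType) (a : R) (Q : tensor -> (B -> A) -> A) :
  universal Q -> universal (fun P F => a *: Q P F).
Proof.
move=> [L HL]; exists [seq (a * x.1, x.2) | x <- L] => P lP F.
by rewrite HL// big_map scaler_sumr; apply: eq_bigr => x _; rewrite scalerA.
Qed.

Lemma universal_net (B : finType) (N : net B) : universal (fun P F => net_op N P F).
Proof. by exists [:: (1, N)] => P _ F; rewrite big_seq1 scale1r. Qed.

Lemma net_op_slotP (B : finType) (N : net B) b0 P (a : R) (g h : A) (H : B -> A) :
  net_op N P (fun b => if b == b0 then a *: g + h else H b)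
  = a *: net_op N P (fun b => if b == b0 then g else H b)
    + net_op N P (fun b => if b == b0 then h else H b).
Proof.
rewrite scaler_sumr -big_split; apply: eq_bigr => J _ /=.
have D1 f : \prod_b dparts (incoming (tgt (n := N)) J (inr b)) (if b == b0 then f else H b)
    = dparts (incoming (tgt (n := N)) J (inr b0)) f *
      \prod_(b | b != b0) dparts (incoming (tgt (n := N)) J (inr b)) (H b).
  by rewrite (bigD1 b0)//= eqxx; congr (_ * _); apply: eq_bigr => b /negPf ->.
by rewrite !D1 linearP mulrDl mulrDr -scalerAl -scalerAr.
Qed.

Lemma net_op_slot (B B' : finType) (N : net B) b0 P (L : seq (R * net B')) (F : B' -> A) H :
  net_op N P (fun b => if b == b0 then \sum_(y <- L) y.1 *: net_op y.2 P F else H b)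
  = \sum_(y <- L) y.1 *: net_op N P (fun b => if b == b0 then net_op y.2 P F else H b).
Proof.
elim: L => [|y L IHL].
  rewrite !big_nil; have := net_op_slotP N b0 P (-1) 0 0 H.
  by rewrite scaler0 addr0 => {1}->; rewrite scaleN1r addNr.
by rewrite !big_cons net_op_slotP IHL.
Qed.

Lemma universal_subst (B B' C : finType) (b0 : B) (k : B -> C) (r : B' -> C)
    (Q : tensor -> (B -> A) -> A) (Q' : tensor -> (B' -> A) -> A) :
  (forall b b', b != b0 -> k b != r b') ->
  (forall b1 b2, b1 != b0 -> b2 != b0 -> k b1 = k b2 -> b1 = b2) ->
  injective r ->
  (forall G : C -> A, \prod_c G c = \prod_(b | b != b0) G (k b) * \prod_b G (r b)) ->
  B' -> universal Q -> universal Q' ->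
  universal (fun P F => Q P (fun b => if b == b0 then Q' P (F \o r) else F (k b))).
Proof.
move=> kr k_inj r_inj kr_prod b'0 [L HL] [L' HL'].
apply: (@universal_ext _ _ (fun P F => \sum_(x <- L) x.1 *: \sum_(y <- L') y.1 *:
    net_op x.2 P (fun b => if b == b0 then net_op y.2 P (F \o r) else F (k b)))).
  move=> P lP F; rewrite HL//; apply: eq_bigr => x _; congr (_ *: _).
  by rewrite HL'// (net_op_slot x.2 b0 P L' (F \o r) (F \o k)).
apply: universal_sum => x _; apply: universalZ; apply: universal_sum => y _; apply: universalZ.
have [Phi HPhi] := subst_net kr k_inj r_inj kr_prod x.2 y.2 b'0.
apply: (universal_ext (fun P _ F => HPhi P F)); apply: universal_sum => phi _.
exact: universal_net.
Qed.

Definition univ1 (T : tensor -> A -> A) := universal (fun P (F : unit -> A) => T P (F tt)).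

Definition univ2 (D : tensor -> A -> A -> A) :=
  universal (fun P (F : bool -> A) => D P (F false) (F true)).

Lemma univ1_comp T D : univ1 T -> univ2 D -> univ2 (fun P u v => T P (D P u v)).
Proof.
move=> uT uD.
apply: (universal_ext _ (@universal_subst unit bool bool tt (fun _ => true) id _ _ _ _ _ _ false
  uT uD)) => //.
by move=> G; rewrite [X in X * _]big1 ?mul1r// => -[].
Qed.

Lemma univ2_compl T D : univ1 T -> univ2 D -> univ2 (fun P u v => D P (T P u) v).
Proof.
move=> uT uD.
apply: (universal_ext _ (@universal_subst bool unit bool false id (fun _ => false) _ _ _ _ _ _ tt
  uD uT)) => //.
- by move=> [] [].
- by move=> G; rewrite big_bool (bigD1 true)//= big1 ?mulr1 => [|[]//]; congr (_ * _); rewrite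
    (bigD1 tt)//= big1 ?mulr1// => -[].
Qed.

Lemma univ2_compr T D : univ1 T -> univ2 D -> univ2 (fun P u v => D P u (T P v)).
Proof.
move=> uT uD.
apply: (universal_ext _ (@universal_subst bool unit bool true id (fun _ => true) _ _ _ _ _ _ tt
  uD uT)) => //.
- by move=> [] [].
- by move=> G; rewrite big_bool (bigD1 false)//= big1 ?mulr1 => [|[]//]; rewrite mulrC; congr (_
    * _); rewrite (bigD1 tt)//= big1 ?mulr1// => -[].
Qed.

(** * Gluing the two ground vertices *)

Section Merge.
Variable N : net bool.

(** A vertex with one edge to L and one to R acquires a double edge, which a [net] tolerates. *)
Definition merge_tgt (e : nv N * bool) : nv N + unit :=
  match tgt e with inl j => inl j | inr _ => inr tt end.

Lemma merge_noloop e : merge_tgt e != inl e.1.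
Proof. by have := noloop e; rewrite /merge_tgt; case: (tgt e). Qed.

Lemma merge_tgt_inl e j : (merge_tgt e == inl j) = (tgt e == inl j).
Proof. by rewrite /merge_tgt; case: (tgt e). Qed.

Lemma merge_tgt_inr e : (merge_tgt e == inr tt) = (tgt e == inr false) || (tgt e == inr true).
Proof. by rewrite /merge_tgt; case: (tgt e) => // -[]. Qed.

Definition merge_net := Net merge_noloop.

(** The derivatives on [u] are those on L followed by those on R, which is the shape [s j ++ r j]
    required by [hkr_at]. *)
Lemma merge_net_op P u : net_op merge_net P (fun _ => u) =
  \sum_(I : {ffun nv N * bool -> 'I_m}) net_coef (N := N) P I *
    dparts (incoming (tgt (n := N)) I (inr false) ++ incoming (tgt (n := N)) I (inr true)) u.
Proof.
apply: eq_bigr => I _; congr (_ * _).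
  apply: eq_bigr => j _; congr (dparts _ _); congr map; apply: eq_filter => e /=.
  exact: merge_tgt_inl.
rewrite (bigD1 tt)//= big1 ?mulr1 => [|[]//]; apply: perm_dparts.
rewrite -map_cat; apply: perm_map.
move: (enum _) => S; rewrite perm_sym; pose p := [pred e : nv N * bool | tgt e == inr false].
apply: perm_trans (permEl (perm_filterC p _)); rewrite -!filter_predI.
rewrite (eq_filter (a1 := predI p _) (a2 := fun e => tgt e == inr false)) => [|e]; last first.
  by rewrite /= merge_tgt_inr; case: (tgt e == _).
rewrite (eq_filter (a1 := predI (predC p) _) (a2 := fun e => tgt e == inr true)) => [//|e].
by rewrite /= merge_tgt_inr; case: (tgt e) => // -[].
Qed.

End Merge.

Definition indeg B (N : net B) (x : nv N + B) := size [seq e <- enum {: nv N * bool} | tgt e == x].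

Lemma size_incoming B (N : net B) I x : size (incoming (tgt (n := N)) I x : seq 'I_m) = indeg x.
Proof. exact: size_map. Qed.

(** [T] is written down from the nets of [D] alone. The cocycle conditions are imposed on one P at a
    time, since they are available only for Poisson tensors. *)
Lemma univ_hkr D : univ2 D -> exists2 T, univ1 T & forall P, linear_tensor P ->
  (forall u v w, u * D P v w - D P (u * v) w + D P u (v * w) - D P u v * w = 0) ->
  D P 1 1 = 0 ->
  (forall xi X Y, D P (affine xi X) (affine xi Y) xi = D P (affine xi Y) (affine xi X) xi) ->
  forall u v, D P u v = u * T P v - T P (u * v) + T P u * v.
Proof.
move=> [L HL].
(* The sign and the denominator of the primitive in [symbol_hkr]; the number of derivatives in the
   first argument is the number of edges into L. *)
pose c (x : R * net bool) := - (x.1 / (indeg (inr false : nv x.2 + bool)).+1%:R).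
exists (fun P u => \sum_(x <- L | indeg (inr true : nv x.2 + bool) == 1%N) c x *: net_op
  (merge_net x.2) P (fun _ => u)).
  apply: universal_sum => x _; apply: universalZ.
  apply: universal_ext (universal_net _) => P _ F.
  by congr net_op; apply/funext => -[].
move=> P lP cocycle D11 Dsym u v; apply/val_inj/funext => xi.
pose l := [seq (x.1 * net_coef (N := x.2) P J xi, (incoming (tgt (n := x.2)) J (inr false),
    incoming (tgt (n := x.2)) J (inr true)))
  | x <- L, J : {ffun nv x.2 * bool -> 'I_m} <- index_enum {ffun nv x.2 * bool -> 'I_m}].
apply: (@hkr_at _ _ xi _ l (fun j => j.1) (fun j => j.2.1) (fun j => j.2.2)
  (fun u v => D P u v xi) (fun u => (\sum_(x <- L | indeg (inr true : nv x.2 + bool) == 1%N)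
     c x *: net_op (merge_net x.2) P (fun _ => u)) xi)).
- move=> u' v'; rewrite (HL P lP (fun b => if b then v' else u')) big_allpairs_dep smfun_sumE.
  apply: eq_bigr => x _ /=; rewrite -[LHS]/(_ * _) smfun_sumE mulr_sumr; apply: eq_bigr => J _.
  have E (f g h : A) : (f * (g * h)) xi = f xi * (g xi * h xi) by [].
  by rewrite big_bool E; ring.
- move=> u'; rewrite smfun_sumE [in RHS]big_mkcond big_allpairs_dep -sumrN big_mkcond.
  apply: eq_bigr => x _ /=; case: ifP => dx.
    rewrite merge_net_op -[LHS]/(_ * _) smfun_sumE mulr_sumr -sumrN; apply: eq_bigr => J _.
    rewrite !size_incoming dx -[X in _ * X]/(_ * _) /c /=.
    by rewrite mulNr mulrA; congr (- (_ * _)); ring.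
  by rewrite big1 ?oppr0// => J _; rewrite size_incoming dx.
- by move=> u' v' w'; have := congr1 (fun f : A => f xi) (cocycle u' v' w').
- by rewrite D11.
- exact: Dsym.
Qed.

End Universal.

(** * The skew-symmetric part *)

Section SkewPart.
Context {R : realType} {m : nat}.
Local Notation A := (smfun R m).
Local Notation tensor := ('I_m -> 'I_m -> A).
Implicit Types (P : tensor) (X Y : 'rV[R]_m).

Definition bracket_at P (xi : 'rV[R]_m) X Y : R :=
  \sum_i \sum_j P i j xi * X 0 i * Y 0 j.

Lemma bracket_atN P xi X Y : linear_tensor P -> bracket_at P xi Y X = - bracket_at P xi X Y.
Proof.
move=> [skew _]; rewrite /bracket_at exchange_big -sumrN; apply: eq_bigr => i _.
rewrite -sumrN; apply: eq_bigr => j _; rewrite skew.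
have E (f : A) : (- f) xi = - (f xi) by [].
by rewrite E; ring.
Qed.

Lemma dparts_affine_center (xi : 'rV[R]_m) X s :
  dparts s (affine xi X) xi = if size s == 1%N then mon X s else 0.
Proof.
have [->|s0] := eqVneq s [::]; first exact: affine_center.
by rewrite dparts_affine// -[LHS]/(_ * 1) mulr1.
Qed.

Variable N : net bool.
Local Notation K := (nv N).
Local Notation L := (inr false : K + bool).
Local Notation Rt := (inr true : K + bool).
Local Notation ins x := [seq e <- enum {: K * bool} | tgt e == x].

Let lin_fun xi X Y (b : bool) : A := if b then affine xi Y else affine xi X.

Let net_linE P xi X Y : net_op N P (lin_fun xi X Y) xi =
  \sum_(I : {ffun K * bool -> 'I_m}) net_coef (N := N) P I xi *
    ((if indeg L == 1%N then mon X (incoming (tgt (n := N)) I L) else 0) *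
     (if indeg Rt == 1%N then mon Y (incoming (tgt (n := N)) I Rt) else 0)).
Proof.
rewrite smfun_sumE; apply: eq_bigr => I _.
rewrite -[LHS]/(_ * (\prod_b dparts (incoming (tgt (n := N)) I (inr b)) (lin_fun xi X Y b)) xi).
rewrite smfun_prodE big_bool; congr (_ * _).
by rewrite mulrC /lin_fun !dparts_affine_center !size_incoming.
Qed.

Let coef_eq0 P I (j : K) : linear_tensor P -> (1 < size (ins (inl j)))%N ->
  net_coef (N := N) P I = 0.
Proof.
move=> [_ lP] j2; rewrite /net_coef (bigD1 j)//= -[RHS](mul0r (\prod_(i | i != j) dparts
  (incoming (tgt (n:=N)) I (inl i)) (P (I (i, false)) (I (i, true))))); congr (_ * _).
have : (1 < size (incoming (tgt (n := N)) I (inl j)))%N by rewrite size_map.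
case: (incoming _ _ _) => // k [//|l s] _.
have pk : perm_eq [:: k, l & s] (s ++ [:: k; l]) by exact: (permEl (perm_catC [:: k; l] s)).
by rewrite (perm_dparts _ pk) dparts_cat /= lP linear0.
Qed.

Let insE x (e0 : K * bool) : ins x = [:: e0] -> forall e, (tgt e == x) = (e == e0).
Proof. by move=> Ex e; have := mem_filter (fun e => tgt e == x) e (enum {: K * bool}); rewrite Ex
  mem_enum andbT inE. Qed.

Let incE x (e0 : K * bool) (I : K * bool -> 'I_m) : ins x = [:: e0] ->
  incoming (tgt (n := N)) I x = [:: I e0].
Proof. by move=> Ex; rewrite /incoming Ex. Qed.

Let fst_eqE (e : K * bool) b : ((e.1, b) == e) = (b == e.2).
Proof. by case: e => j b'; rewrite xpair_eqE eqxx. Qed.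

Section Connected.
Variables eL eR : K * bool.
Hypotheses (insL : ins L = [:: eL]) (insR : ins Rt = [:: eR]).
Hypothesis ins_le1 : forall j : K, (size (ins (inl j)) <= 1)%N.

Let tgtL : tgt eL = L. Proof. by apply/eqP; rewrite (insE insL). Qed.
Let tgtR : tgt eR = Rt. Proof. by apply/eqP; rewrite (insE insR). Qed.
Let LR : eL != eR. Proof. by apply/eqP => E; move: tgtL; rewrite E tgtR. Qed.

Let internal e : e != eL -> e != eR -> exists j, tgt e = inl j.
Proof.
rewrite -(insE insL) -(insE insR); case: (tgt e) => [j|[]]; rewrite ?eqxx//.
by exists j.
Qed.

Let tgt_inj (e e' : K * bool) (j : K) : tgt e = inl j -> tgt e' = inl j -> e = e'.
Proof.
move=> ej e'j; have := ins_le1 j.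
have : e \in ins (inl j) by rewrite mem_filter ej eqxx mem_enum.
have : e' \in ins (inl j) by rewrite mem_filter e'j eqxx mem_enum.
by case: (ins _) => [//|x [|//]]; rewrite !inE => /eqP-> /eqP->.
Qed.

(** Of the 2k edges, all but [eL] and [eR] end at vertices of [K], and at distinct ones; hence 2k -
    2 <= k. *)
Let card_le2 : (#|K| <= 2)%N.
Proof.
pose D := [predC [:: eL; eR]].
pose f e := if tgt e is inl j then j else eL.1.
have : (#|[seq f e | e in D]| <= #|K|)%N by exact: max_card.
rewrite card_in_image => [|e e']; last first.
  rewrite !inE !negb_or => /andP[e1 e2] /andP[e'1 e'2].
  have [j ej] := internal e1 e2; have [j' ej'] := internal e'1 e'2.
  by rewrite /f ej ej' => jj'; apply: (tgt_inj ej); rewrite ej' jj'.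
have : (#|[:: eL; eR]| + #|D| = #|{: K * bool}|)%N := cardC (mem [:: eL; eR]).
rewrite card_prod card_bool.
have /card_uniqP -> : uniq [:: eL; eR] by rewrite /= inE LR.
rewrite muln2 -addnn => E1 E2; rewrite -(leq_add2r #|K|) -E1; by rewrite leq_add2l.
Qed.

Let third (a b c : K) : a != b -> c != b -> a = c.
Proof.
move=> ab cb; apply/eqP/negPn/negP => ac.
have /card_uniqP E : uniq [:: a; b; c] by rewrite /= !inE negb_or ab ac eq_sym cb.
by have := leq_trans (max_card (mem [:: a; b; c])) card_le2; rewrite E.
Qed.

Let net_linE1 P xi X Y : net_op N P (lin_fun xi X Y) xi =
  \sum_(I : {ffun K * bool -> 'I_m}) net_coef (N := N) P I xi * (X 0 (I eL) * Y 0 (I eR)).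
Proof.
rewrite net_linE; apply: eq_bigr => I _.
by rewrite /indeg insL insR (incE _ insL) (incE _ insR) /mon !big_seq1.
Qed.

(** A vertex emitting neither [eL] nor [eR] would send both edges to vertices other than itself.
    With at most two vertices these coincide, giving a vertex with two incoming edges. *)
Let source_other (j : K) : j != eL.1 -> j = eR.1.
Proof.
move=> jL; apply/eqP/negPn/negP => jR.
have jeL b : (j, b) != eL by apply: contraNneq jL => <-.
have jeR b : (j, b) != eR by apply: contraNneq jR => <-.
have [a Ea] := internal (jeL false) (jeR false).
have [b Eb] := internal (jeL true) (jeR true).
have aj : a != j by have := noloop (j, false); rewrite Ea; apply: contraNneq => ->.
have bj : b != j by have := noloop (j, true); rewrite Eb; apply: contraNneq => ->.
by move: Eb; rewrite -(third aj bj) => /(tgt_inj Ea).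
Qed.

Lemma skew_one_vertex : eL.1 = eR.1 -> exists s : R, forall P, linear_tensor P ->
  forall xi X Y, net_op N P (lin_fun xi X Y) xi = s * bracket_at P xi X Y.
Proof.
move=> LR1; have K1 j : j = eL.1.
  by apply/eqP/negPn/negP => /[dup] /source_other -> /eqP; rewrite LR1.
have eLR e : e != eL -> e = eR.
  move: LR e; case: eL eR LR1 K1 => [jL p] [jR q] /= <- K1.
  move=> pq [j b]; rewrite (K1 j) !xpair_eqE !eqxx /= in pq *.
  by case: p q b pq => -[] [].
(* The sign of putting the edge into L first, since the Boolean [true] marks the second edge. *)
pose s : R := if eL.2 then -1 else 1.
exists s => P lP xi X Y; rewrite net_linE1 /bracket_at pair_big /= mulr_sumr.
rewrite (reindex (fun ij : 'I_m * 'I_m => [ffun e => if e == eL then ij.1 else ij.2])) /=; last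
  first.
  exists (fun I : {ffun K * bool -> 'I_m} => (I eL, I eR)) => [[i j]|I] _ /=.
    by rewrite !ffunE eqxx eq_sym (negPf LR).
  by apply/ffunP => e; rewrite !ffunE; have [->//|/eLR ->] := eqVneq e eL.
apply: eq_bigr => -[i j] _ /=; rewrite !ffunE eqxx eq_sym (negPf LR).
suff -> : net_coef (N := N) P [ffun e => if e == eL then i else j] = s *: P i j.
  by rewrite -[(s *: P i j) xi]/(s * P i j xi); ring.
rewrite /net_coef (bigD1 eL.1)//= big1 ?mulr1 => [|k]; last by rewrite (K1 k) eqxx.
rewrite (_ : incoming _ _ _ = [::]) /=; last first.
  rewrite /incoming (eq_filter (a2 := pred0)) ?filter_pred0// => e /=.
  by have [->|/eLR ->] := eqVneq e eL; rewrite ?tgtL ?tgtR.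
rewrite !ffunE /s !fst_eqE; case: eL.2 => /=.
  by rewrite scaleN1r lP.1.
by rewrite scale1r.
Qed.

(** The two vertices point to each other, and each has its other edge on the ground: the Killing
    form. Exchanging the vertices exchanges X and Y. *)
Lemma skew_two_vertices : eL.1 != eR.1 -> forall P, linear_tensor P ->
  forall xi X Y, net_op N P (lin_fun xi X Y) xi = net_op N P (lin_fun xi Y X) xi.
Proof.
move=> LR1 P [skew _] xi X Y.
pose e12 := (eL.1, ~~ eL.2); pose e21 := (eR.1, ~~ eR.2).
have tgt12 : tgt e12 = inl eR.1.
  have [|| a Ea] := @internal e12.
  - by rewrite fst_eqE; case: eL.2.
  - by apply: contraNneq LR1 => <-.
  have aL : a != eL.1 by have := noloop e12; rewrite Ea; apply: contraNneq => ->.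
  by rewrite Ea (source_other aL).
have tgt21 : tgt e21 = inl eL.1.
  have [|| a Ea] := @internal e21.
  - by apply: contraNneq LR1 => <-.
  - by rewrite fst_eqE; case: eR.2.
  have aR : a != eR.1 by have := noloop e21; rewrite Ea; apply: contraNneq => ->.
  by rewrite Ea (third aR LR1).
have ins1 e j : tgt e = inl j -> ins (inl j) = [:: e].
  move=> ej; have : e \in ins (inl j) by rewrite mem_filter ej eqxx mem_enum.
  by case: (ins _) (ins_le1 j) => [//|x [|//]] _; rewrite inE => /eqP ->.
(* True when [eL] and [eR] carry different labels; the exchange must then also flip the labels. *)
pose x := eL.2 (+) eR.2.
(* tau exchanges the two vertices, matching the edges into L and R. *)
pose tau (e : K * bool) := (if e.1 == eL.1 then eR.1 else eL.1, e.2 (+) x).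
have tauK : involutive tau.
  move=> [j b]; rewrite /tau /= -addbA addbb addbF.
  have [->|/source_other ->] := eqVneq j eL.1; last by rewrite eqxx.
  by rewrite eq_sym (negPf LR1).
have tauL : tau eL = eR by rewrite /tau eqxx /x addbA addbb addFb -surjective_pairing.
have tauR : tau eR = eL by rewrite -tauL tauK.
have tau12 : tau e12 = e21 by rewrite /tau /e12 /e21 eqxx /x /=; case: (eL.2); case: (eR.2).
have tau21 : tau e21 = e12 by rewrite -tau12 tauK.
(* Both tensor factors pick up this sign, so it disappears from their product. *)
pose s : R := if x then -1 else 1.
pose phi (I : {ffun K * bool -> 'I_m}) : {ffun K * bool -> 'I_m} := [ffun e => I (tau e)].
have phiK : involutive phi by move=> I; apply/ffunP => e; rewrite !ffunE tauK.
have coefE (I : K * bool -> 'I_m) : net_coef (N := N) P I =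
    dpart (I e21) (P (I (eL.1, false)) (I (eL.1, true))) *
    dpart (I e12) (P (I (eR.1, false)) (I (eR.1, true))).
  rewrite /net_coef (bigD1 eL.1)//= (bigD1 eR.1) 1?eq_sym//= big1 ?mulr1 => [|k].
    by rewrite (incE _ (ins1 _ _ tgt12)) (incE _ (ins1 _ _ tgt21)).
  by case/andP => /source_other -> /eqP.
have coef_phi (I : {ffun K * bool -> 'I_m}) : net_coef (N := N) P (phi I) = net_coef (N := N) P I.
  have vertex j j' : (forall b, tau (j, b) = (j', b (+) x)) ->
      P (phi I (j, false)) (phi I (j, true)) = s *: P (I (j', false)) (I (j', true)).
    move=> tauj; rewrite !ffunE !tauj /s; case: (x) => /=.
      by rewrite scaleN1r -skew.
    by rewrite scale1r.
  rewrite !coefE (vertex eL.1 eR.1) ?(vertex eR.1 eL.1) => [||b]; last 2 first.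
  - by move=> b; rewrite /tau /= eq_sym (negPf LR1).
  - by rewrite /tau /= eqxx.
  rewrite !ffunE tau12 tau21 !linearZ /= -scalerAl -scalerAr scalerA mulrC.
  by rewrite (_ : s * s = 1) ?scale1r// /s; case: (x); ring.
rewrite !net_linE1 (reindex_inj (inv_inj phiK)); apply: eq_bigr => I _.
by rewrite coef_phi !ffunE tauL tauR; ring.
Qed.

End Connected.

(** On recentred affine functions a net survives only with exactly one edge into each ground vertex
    and at most one into every other. One vertex gives kappa = 2s by antisymmetry of the bracket;
    every other case gives 0. *)
Lemma net_skew : exists kappa : R, forall P, linear_tensor P -> forall xi X Y,
  net_op N P (lin_fun xi X Y) xi - net_op N P (lin_fun xi Y X) xi = kappa * bracket_at P xi X Y.
Proof.
have [degL|degL] := eqVneq (indeg L) 1%N; last first.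
  exists 0 => P lP xi X Y; rewrite mul0r !net_linE -sumrB big1// => I _.
  by rewrite (negPf degL) !mul0r !mulr0 subrr.
have [degR|degR] := eqVneq (indeg Rt) 1%N; last first.
  exists 0 => P lP xi X Y; rewrite mul0r !net_linE -sumrB big1// => I _.
  by rewrite (negPf degR) !mulr0 subrr.
have [ins_le1|] := boolP [forall j : K, (size (ins (inl j)) <= 1)%N]; last first.
  move=> /forallPn[j]; rewrite -ltnNge => j2; exists 0 => P lP xi X Y.
  rewrite mul0r !net_linE -sumrB big1// => I _.
  by rewrite (coef_eq0 I lP j2) !mul0r subrr.
have [eL insL] : exists eL, ins L = [:: eL].
  by move: degL; rewrite /indeg; case: (ins L) => [|e []]// _; exists e.
have [eR insR] : exists eR, ins Rt = [:: eR].
  by move: degR; rewrite /indeg; case: (ins Rt) => [|e []]// _; exists e.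
have [LR1|LR1] := eqVneq eL.1 eR.1.
  have [s Hs] := skew_one_vertex insL insR (forallP ins_le1) LR1.
  exists (s + s) => P lP xi X Y; rewrite !Hs// (bracket_atN xi X Y lP); ring.
exists 0 => P lP xi X Y.
by rewrite (skew_two_vertices insL insR (forallP ins_le1) LR1 lP xi X Y) subrr mul0r.
Qed.

End SkewPart.

Section UniversalSkewPart.
Context {R : realType} {m : nat}.
Local Notation A := (smfun R m).
Implicit Types P : 'I_m -> 'I_m -> A.

Lemma nets_skew (L : seq (R * net bool)) : exists kappa : R,
  forall P, linear_tensor P -> forall xi X Y,
  (\sum_(x <- L) x.1 *: net_op x.2 P (fun b => if b then affine xi Y else affine xi X)) xi -
  (\sum_(x <- L) x.1 *: net_op x.2 P (fun b => if b then affine xi X else affine xi Y)) xi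
  = kappa * bracket_at P xi X Y.
Proof.
elim: L => [|x L [k IHL]].
  by exists 0 => P lP xi X Y; rewrite !big_nil subrr mul0r.
have [k' Hk'] := @net_skew R m x.2; exists (x.1 * k' + k) => P lP xi X Y.
have E (a b : smfun R m) (c : R) : (c *: a + b) xi = c * a xi + b xi by [].
by rewrite !big_cons mulrDl -IHL// -mulrA -Hk'// !E; ring.
Qed.

Lemma univ2_skew (D : ('I_m -> 'I_m -> A) -> A -> A -> A) : univ2 D ->
  exists kappa : R, forall P, linear_tensor P -> forall xi X Y,
  D P (affine xi X) (affine xi Y) xi - D P (affine xi Y) (affine xi X) xi
  = kappa * bracket_at P xi X Y.
Proof.
move=> [L HL]; have [kappa Hk] := nets_skew L; exists kappa => P lP xi X Y; rewrite -Hk//.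
by rewrite (HL P lP (fun b => if b then affine xi Y else affine xi X))
  (HL P lP (fun b => if b then affine xi X else affine xi Y)).
Qed.

End UniversalSkewPart.

(** * The obstruction at order n *)

Section Convolution.
Variable V : nmodType.
Implicit Types (f g : nat -> nat -> V).

(** The coefficient of order n in a Cauchy product. Nested instances encode products of several
    series, and the rules below replace explicit manipulation of indices. *)
Definition convol n f : V := \sum_(i < n.+1) f i (n - i)%N.

Lemma eq_convol n f g : (forall i j, (i + j)%N = n -> f i j = g i j) -> convol n f = convol n g.
Proof. by move=> fg; apply: eq_bigr => i _; rewrite fg// subnKC// -ltnS. Qed.

Lemma convolC n f : convol n f = convol n (fun i j => f j i).
Proof.
rewrite /convol (reindex_inj rev_ord_inj); apply: eq_bigr => i _ /=.
by rewrite subSS subKn// -ltnS.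
Qed.

Lemma convolD n f g : convol n (fun i j => f i j + g i j) = convol n f + convol n g.
Proof. exact: big_split. Qed.

Lemma convol_sum n I (r : seq I) (F : I -> nat -> nat -> V) :
  convol n (fun i j => \sum_(k <- r) F k i j) = \sum_(k <- r) convol n (F k).
Proof. exact: exchange_big. Qed.

Lemma convol_exchange n k (F : nat -> nat -> nat -> nat -> V) :
  convol n (fun i j => convol k (F i j)) = convol k (fun a b => convol n (fun i j => F i j a b)).
Proof. exact: exchange_big. Qed.

(** Both sides sum f i j l over i + j + l = n; the common form eliminates l. *)
Lemma convolA n (f : nat -> nat -> nat -> V) :
  convol n (fun i k => convol k (fun j l => f i j l))
  = convol n (fun k l => convol k (fun i j => f i j l)).
Proof.
pose F i j := f i j (n - i - j)%N.
transitivity (\sum_(i < n.+1) \sum_(j < n.+1 | (i + j <= n)%N) F i j).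
  apply: eq_bigr => i _; rewrite /convol /F.
  rewrite [RHS](eq_bigl (fun j : 'I_n.+1 => (j < (n - i).+1)%N)); last first.
    by move=> j; rewrite ltnS -leq_subRL// -ltnS.
  have le_n : ((n - i).+1 <= n.+1)%N by rewrite ltnS leq_subr.
  by rewrite (big_ord_narrow le_n).
transitivity (\sum_(k < n.+1) \sum_(i < k.+1) F i (k - i)%N); last first.
  apply: eq_bigr => k _; apply: eq_bigr => i _; rewrite /F; congr f.
  have := ltn_ord i; lia.
transitivity (\sum_(k < n.+1) \sum_(i < n.+1 | (i <= k)%N) F i (k - i)%N); last first.
  apply: eq_bigr => k _; rewrite [LHS](eq_bigl (fun j : 'I_n.+1 => (j < k.+1)%N)) => [|j]; last
    by rewrite ltnS.
  by rewrite (big_ord_narrow (ltn_ord k)).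
rewrite [RHS](exchange_big_dep xpredT)//=; apply: eq_bigr => i _.
rewrite (reindex_onto (fun k : 'I_n.+1 => inord (k - i)) (fun j : 'I_n.+1 => inord (j + i))) /=;
  last first.
  move=> j ij; apply/val_inj; rewrite /= !inordK; lia.
apply: eq_big => [k|k ik].
  apply/andP/idP => [[]|ik].
    rewrite inordK; last by have := ltn_ord k; lia.
    have := ltn_ord i; have := ltn_ord k => kn i_n _ /eqP/(congr1 (@nat_of_ord _)).
    rewrite inordK; lia.
  rewrite inordK; last by have := ltn_ord k; lia.
  split; first by have := ltn_ord k; lia.
  by apply/eqP/val_inj; rewrite /= !inordK; have := ltn_ord k; lia.
by rewrite inordK//; have := ltn_ord k; lia.
Qed.

Lemma convolCA n (f : nat -> nat -> nat -> V) :
  convol n (fun i k => convol k (fun j l => f i j l))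
  = convol n (fun j k => convol k (fun i l => f i j l)).
Proof.
rewrite convolA [RHS]convolA; apply: eq_convol => i j _; exact: convolC.
Qed.

Lemma convol0 f : convol 0 f = f 0%N 0%N.
Proof. by rewrite /convol big_ord1. Qed.

Lemma convol_zero n : convol n (fun _ _ => 0) = 0.
Proof. exact: big1. Qed.

Lemma convol_ends n f : (0 < n)%N -> (forall i, (0 < i < n)%N -> f i (n - i)%N = 0) ->
  convol n f = f 0%N n + f n 0%N.
Proof.
case: n => // n _ f0; rewrite /convol big_ord_recl big_ord_recr /= subn0 subnn.
rewrite big1 ?add0r// => i _; apply: f0; rewrite /bump /=; have := ltn_ord i; lia.
Qed.

Lemma convol_top n f : (forall i j, (i < n)%N -> f i j = 0) -> convol n f = f n 0%N.
Proof.
by move=> f0; rewrite /convol big_ord_recr /= subnn big1 ?add0r// => i _; rewrite f0.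
Qed.

Lemma convol_bot n f : (forall i j, (j < n)%N -> f i j = 0) -> convol n f = f 0%N n.
Proof. by move=> f0; rewrite convolC convol_top// => i j; apply: f0. Qed.

End Convolution.

Lemma additive_convol (V W : zmodType) (h : V -> W) n f :
  (forall x y, h (x + y) = h x + h y) -> h (convol n f) = convol n (fun i j => h (f i j)).
Proof.
move=> hD; have h0 : h 0 = 0 by apply: (addIr (h 0)); rewrite -hD !add0r.
by rewrite /convol; elim: (index_enum _) => [|i s IHs]; rewrite ?big_nil// !big_cons hD IHs.
Qed.

Section Cocycle.
Variables (A : comPzRingType) (C C' : nat -> A -> A -> A) (T : nat -> A -> A) (n : nat).
Hypotheses (CDl : forall r u1 u2 v, C r (u1 + u2) v = C r u1 v + C r u2 v)
  (CDr : forall r u v1 v2, C r u (v1 + v2) = C r u v1 + C r u v2)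
  (TD : forall r u v, T r (u + v) = T r u + T r v).
Hypotheses (CA : forall k u v w,
  convol k (fun i j => C j (C i u v) w) = convol k (fun i j => C j u (C i v w))).
Hypotheses (C'A : forall k u v w,
  convol k (fun i j => C' j (C' i u v) w) = convol k (fun i j => C' j u (C' i v w))).
Hypotheses (C0 : forall u v, C 0 u v = u * v) (C'0 : forall u v, C' 0 u v = u * v)
  (T0 : forall u, T 0 u = u).

(** The order k coefficient of T(u *' v); [prod_push] is that of Tu * Tv. *)
Definition push_prod k u v := convol k (fun i j => T i (C' j u v)).

Definition prod_push k u v := convol k (fun i l => convol l (fun j r => C r (T i u) (T j v))).

Hypothesis IH : forall k u v, (k < n)%N -> push_prod k u v = prod_push k u v.

Definition defect u v := push_prod n u v - prod_push n u v.

Let defectE k u v : (k <= n)%N ->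
  push_prod k u v = prod_push k u v + (if (k < n)%N then 0 else defect u v).
Proof.
rewrite leq_eqVlt => /orP[/eqP ->|kn]; first by rewrite ltnn /defect addrC subrK.
by rewrite kn addr0 IH.
Qed.

Let push_assoc u v w : convol n (fun i k => push_prod k (C' i u v) w)
  = convol n (fun i k => push_prod k u (C' i v w)).
Proof.
rewrite /push_prod convolCA [RHS]convolCA; apply: eq_convol => j k _.
by rewrite -!additive_convol// C'A.
Qed.

(** The order n coefficient of X * Tw for a series X, and in [pp_r] that of Tu * X. *)
Let pp_l (X : nat -> A) w := convol n (fun p l => convol l (fun j r => C r (X p) (T j w))).

Let pp_r u (X : nat -> A) := convol n (fun a k => convol k (fun p r => C r (T a u) (X p))).

Let prod_push_l u v w :
  convol n (fun i k => prod_push k (C' i u v) w) = pp_l (fun p => push_prod p u v) w.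
Proof.
rewrite /prod_push convolA; apply: eq_convol => p l _.
rewrite convol_exchange; apply: eq_convol => j r _.
by rewrite convolC /push_prod (additive_convol (h := fun x => C r x (T j w))).
Qed.

Let prod_push_r u v w :
  convol n (fun i k => prod_push k u (C' i v w)) = pp_r u (fun p => push_prod p v w).
Proof.
rewrite /prod_push convolCA; apply: eq_convol => a k _.
rewrite convolA; apply: eq_convol => p r _.
by rewrite convolC /push_prod (additive_convol (h := fun x => C r (T a u) x)).
Qed.

Let pp_assoc u v w :
  pp_l (fun p => prod_push p u v) w = pp_r u (fun p => prod_push p v w).
Proof.
transitivity (convol n (fun a k => convol k (fun b k' => convol k' (fun j l =>
    convol l (fun s r => C r (C s (T a u) (T b v)) (T j w)))))).
  transitivity (convol n (fun p l => convol p (fun a q => convol q (fun b s => convol l (fun j r =>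
      C r (C s (T a u) (T b v)) (T j w)))))).
    apply: eq_convol => p l _; transitivity (convol l (fun j r => convol p (fun a q => convol q
      (fun b s =>
      C r (C s (T a u) (T b v)) (T j w))))).
      apply: eq_convol => j r _; rewrite (additive_convol (h := fun x => C r x (T j w)))//.
      by apply: eq_convol => a q _; rewrite (additive_convol (h := fun x => C r x (T j w))).
    rewrite convol_exchange; apply: eq_convol => a q _; exact: convol_exchange.
  rewrite -convolA; apply: eq_convol => a k _; rewrite -convolA; apply: eq_convol => b k' _.
  exact: convolCA.
apply: eq_convol => a k _; transitivity (convol k (fun p r => convol p (fun b q => convol q (fun
  j s =>
    C r (T a u) (C s (T b v) (T j w)))))); last first.
  apply: eq_convol => p r _; rewrite (additive_convol (h := fun x => C r (T a u) x))//.
  by apply: eq_convol => b q _; rewrite (additive_convol (h := fun x => C r (T a u) x)).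
rewrite -convolA; apply: eq_convol => b k' _; rewrite -convolA; apply: eq_convol => j l _.
exact: CA.
Qed.

Let CZl r v : C r 0 v = 0.
Proof. by apply: (addIr (C r 0 v)); rewrite -CDl !add0r. Qed.

Let CZr r u : C r u 0 = 0.
Proof. by apply: (addIr (C r u 0)); rewrite -CDr !add0r. Qed.

(** The two series agree below order n, so the discrepancy already uses up the whole order and meets
    only C_0 and T_0. *)
Let pp_l_push u v w :
  pp_l (fun p => push_prod p u v) w = pp_l (fun p => prod_push p u v) w + defect u v * w.
Proof.
pose F p l := convol l (fun j r => C r (if (p < n)%N then 0 else defect u v) (T j w)).
have -> : defect u v * w = convol n F.
  rewrite convol_top => [|p l pn]; first by rewrite /F ltnn convol0 C0 T0.
  by rewrite /F pn; under eq_convol do rewrite CZl; exact: convol_zero.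
rewrite -convolD; apply: eq_convol => p l pl; rewrite -convolD; apply: eq_convol => j r _.
by rewrite -CDl -defectE// -pl leq_addr.
Qed.

Let pp_r_push u v w :
  pp_r u (fun p => push_prod p v w) = pp_r u (fun p => prod_push p v w) + u * defect v w.
Proof.
pose F a k := convol k (fun p r => C r (T a u) (if (p < n)%N then 0 else defect v w)).
have -> : u * defect v w = convol n F.
  rewrite convol_bot => [|a k kn]; last first.
    rewrite -[RHS](convol_zero A k); apply: eq_convol => p r pr.
    by rewrite ifT ?CZr// (leq_ltn_trans _ kn)// -pr leq_addr.
  rewrite /F convol_top => [|p r ->]; first by rewrite ltnn C0 T0.
  by rewrite CZr.
rewrite -convolD; apply: eq_convol => a k ak; rewrite -convolD; apply: eq_convol => p r pr.
by rewrite -CDr -defectE//; lia.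
Qed.

Let defect_part (f g : nat -> A -> A) (d : A -> A) (X : nat -> A) :
  (forall k x, (k <= n)%N -> f k x = g k x + (if (k < n)%N then 0 else d x)) ->
  convol n (fun i k => f k (X i)) = convol n (fun i k => g k (X i)) + d (X 0%N).
Proof.
move=> fg; have -> : d (X 0%N) = convol n (fun i k => if (k < n)%N then 0 else d (X i)).
  by rewrite convol_bot ?ltnn// => i j ->.
by rewrite -convolD; apply: eq_convol => i j ij; rewrite fg// -ij leq_addl.
Qed.

(** Expand T((u *' v) *' w) = T(u *' (v *' w)) at order n, passing twice on each side from T of a
    product to the product of images. Each passage costs one defect term with order-zero companions,
    and associativity of * cancels the rest. *)
Lemma defect_cocycle u v w :
  u * defect v w - defect (u * v) w + defect u (v * w) - defect u v * w = 0.
Proof.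
have E : defect u v * w + defect (u * v) w = u * defect v w + defect u (v * w).
  have := push_assoc u v w.
  rewrite (defect_part (fun i => C' i u v) (fun k x => @defectE k x w)).
  rewrite (defect_part (fun i => C' i v w) (fun k x => @defectE k u x)).
  by rewrite prod_push_l prod_push_r pp_l_push pp_r_push pp_assoc !C'0 -!addrA => /addrI.
by apply/eqP; rewrite subr_eq0 addrAC subr_eq E.
Qed.

End Cocycle.

Section Unit.
Variables (A : comPzRingType) (C C' : nat -> A -> A -> A) (T : nat -> A -> A).
Hypotheses (CDl : forall r u1 u2 v, C r (u1 + u2) v = C r u1 v + C r u2 v)
  (CDr : forall r u v1 v2, C r u (v1 + v2) = C r u v1 + C r u v2)
  (TD : forall r u v, T r (u + v) = T r u + T r v).
Hypotheses (C0 : forall u v, C 0 u v = u * v) (C'0 : forall u v, C' 0 u v = u * v)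
  (T0 : forall u, T 0 u = u).
Hypotheses (C1 : forall r, (0 < r)%N -> C r 1 1 = 0) (C'1 : forall r, (0 < r)%N -> C' r 1 1 = 0).

Let TZ r : T r 0 = 0.
Proof. by apply: (addIr (T r 0)); rewrite -TD !add0r. Qed.

Let CZl r v : C r 0 v = 0.
Proof. by apply: (addIr (C r 0 v)); rewrite -CDl !add0r. Qed.

Let CZr r u : C r u 0 = 0.
Proof. by apply: (addIr (C r u 0)); rewrite -CDr !add0r. Qed.

Lemma push_unit k : push_prod C' T k 1 1 = T k 1.
Proof.
rewrite /push_prod; case: k => [|k]; first by rewrite convol0 C'0 mul1r.
rewrite convol_ends => [|//|i ik]; first by rewrite C'1// TZ C'0 mul1r add0r.
by rewrite C'1 ?TZ//; lia.
Qed.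

Lemma unit_push k : (0 < k)%N -> (forall i, (0 < i < k)%N -> T i 1 = 0) ->
  prod_push C T k 1 1 = T k 1 + T k 1.
Proof.
move=> k0 T1; rewrite /prod_push convol_ends => [||i ik]//; last first.
  by rewrite T1//; under eq_convol do rewrite CZl; exact: convol_zero.
rewrite convol0 C0 !T0 mulr1 convol_ends => [||j jk]//; last by rewrite T1// CZr.
by rewrite T0 C1// add0r C0 mul1r.
Qed.

(** At order k the identity on (1, 1) reads T_k 1 = 2 T_k 1 once the lower T_i 1 vanish. *)
Lemma gauge_unit n : (forall k, (k < n)%N -> push_prod C' T k 1 1 = prod_push C T k 1 1) ->
  forall k, (0 < k < n)%N -> T k 1 = 0.
Proof.
move=> E; elim/ltn_ind => k IHk /andP[k0 kn].
have := E k kn; rewrite push_unit unit_push//; last first.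
  by move=> i /andP[i0 ik]; apply: IHk => //; rewrite i0 (ltn_trans ik).
by move=> /eqP; rewrite -subr_eq subrr => /eqP.
Qed.

Lemma defect_unit n : (0 < n)%N -> T n = (fun _ => 0) ->
  (forall k, (k < n)%N -> push_prod C' T k 1 1 = prod_push C T k 1 1) ->
  defect C C' T n 1 1 = 0.
Proof.
move=> n0 Tn E; rewrite /defect push_unit unit_push ?Tn ?addr0 ?subrr//.
exact: gauge_unit.
Qed.

Variables (n : nat) (E : A -> A).
Hypotheses (n0 : (0 < n)%N) (Tn : T n = (fun _ => 0)).

Definition extend i u := if i == n then E u else T i u.

Let E0 i u : (if i == n then E u else 0) + T i u = extend i u.
Proof. by rewrite /extend; case: eqP => [->|_]; rewrite ?Tn ?addr0 ?add0r. Qed.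

(** At order n, inserting E as T_n adds E(uv) to one side and E(u)v + uE(v) to the other. *)
Lemma extend_defect u v : defect C C' T n u v = u * E v - E (u * v) + E u * v ->
  push_prod C' extend n u v = prod_push C extend n u v.
Proof.
pose d i x := if i == n then E x else 0.
have push' : push_prod C' extend n u v = E (u * v) + push_prod C' T n u v.
  have -> : E (u * v) = convol n (fun i j => d i (C' j u v)).
    by rewrite convol_top /d ?eqxx ?C'0// => i j /ltn_eqF ->.
  by rewrite -convolD; apply: eq_convol => i j _; rewrite E0.
have -> : prod_push C extend n u v = E u * v + (u * E v + prod_push C T n u v).
  have -> : E u * v = convol n (fun i l => convol l (fun j r => C r (d i u) (extend j v))).
    rewrite convol_top => [|i l /ltn_eqF id].
      by rewrite convol0 C0 /d eqxx /extend ltn_eqF// T0.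
    by rewrite /d id; under eq_convol do rewrite CZl; exact: convol_zero.
  have -> : u * E v = convol n (fun i l => convol l (fun j r => C r (T i u) (d j v))).
    rewrite convol_bot => [|i l ln].
      rewrite convol_top => [|j r /ltn_eqF jd]; first by rewrite C0 T0 /d eqxx.
      by rewrite /d jd CZr.
    rewrite -[RHS](convol_zero A l); apply: eq_convol => j r jr.
    by rewrite /d ifF ?CZr//; apply/eqP; lia.
  rewrite -!convolD; apply: eq_convol => i l _; rewrite -!convolD; apply: eq_convol => j r _.
  by rewrite -CDr E0 -CDl E0.
rewrite push' /defect => /eqP; rewrite subr_eq => /eqP ->.
by rewrite addrCA !addrA; congr (_ + _); rewrite -!addrA addrC -!addrA; ring.
Qed.

End Unit.

(** * Change of the formal parameter *)

Section Substitution.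
Variables (R : realType).

Lemma fps_mulE (a b : nat -> R) n : fps_mul a b n = convol n (fun i j => a i * b j).
Proof. by []. Qed.

Lemma fps_mulA (a b c : nat -> R) : fps_mul a (fps_mul b c) = fps_mul (fps_mul a b) c.
Proof.
apply/funext => n; rewrite !fps_mulE; transitivity (convol n (fun i k => convol k (fun j l => a i
  * (b j * c l)))).
  by apply: eq_convol => i k _; rewrite fps_mulE (additive_convol (h := fun x => a i * x))// => x
    y; rewrite mulrDr.
rewrite convolA; apply: eq_convol => k l _.
rewrite fps_mulE (additive_convol (h := fun x => x * c l)); last by move=> x y; rewrite mulrDl.
by apply: eq_convol => i j _; rewrite mulrA.
Qed.

Lemma fps_expD (a : nat -> R) r s : fps_exp a (r + s) = fps_mul (fps_exp a r) (fps_exp a s).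
Proof.
elim: r => [|r IHr]; last first.
  by rewrite addSn; transitivity (fps_mul a (fps_exp a (r + s))); rewrite // IHr fps_mulA.
apply/funext => n; rewrite /fps_mul big_ord_recl /= subn0 mul1r big1 ?addr0// => i _.
by rewrite mul0r.
Qed.

Lemma fps_exp1 (a : nat -> R) : fps_exp a 1 = a.
Proof.
apply/funext => n; rewrite /= fps_mulE convolC /convol big_ord_recl /= mulr1 subn0.
by rewrite big1 ?addr0// => i _; rewrite mulr0.
Qed.

Lemma fps_exp_small (a : nat -> R) r n : a 0%N = 0 -> (n < r)%N -> fps_exp a r n = 0.
Proof.
move=> a0; elim: r n => // r IHr n nr.
rewrite /= fps_mulE -[RHS](convol_zero R n); apply: eq_convol => -[|i] j ij.
  by rewrite a0 mul0r.
by rewrite IHr ?mulr0//; lia.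
Qed.

(** For r >= 2 every factor has positive order, so none can reach order n. The n-th coefficient of
    the parameter thus enters order n through r = 1 alone. *)
Lemma fps_exp_congr (a b : nat -> R) n r : (forall k, (k < n)%N -> a k = b k) ->
  a 0%N = 0 -> b 0%N = 0 -> r != 1%N -> fps_exp a r n = fps_exp b r n.
Proof.
move=> ab a0 b0.
have below q k : (k < n)%N -> fps_exp a q k = fps_exp b q k.
  elim: q k => // q IHq k kn; rewrite /= !fps_mulE; apply: eq_convol => i j ij.
  by rewrite ab ?IHq//; lia.
case: r => [|[|r]] // _; have -> : forall c : nat -> R, fps_exp c r.+2 = fps_mul c (fps_exp c
  r.+1) by [].
have -> : fps_exp b r.+2 = fps_mul b (fps_exp b r.+1) by [].
rewrite !fps_mulE; apply: eq_convol => -[|i] j ij; first by rewrite a0 b0 !mul0r.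
have [i_n|i_n] := eqVneq i.+1 n.
  by rewrite (_ : j = 0%N) ?fps_exp_small ?mulr0//; lia.
by rewrite ab ?below//; lia.
Qed.

Variables (A : comAlgType R) (C : nat -> A -> A -> A) (a : nat -> R).
Hypothesis a0 : a 0%N = 0.
Hypotheses (CPl : forall r c u1 u2 v, C r (c *: u1 + u2) v = c *: C r u1 v + C r u2 v)
  (CPr : forall r c u v1 v2, C r u (c *: v1 + v2) = c *: C r u v1 + C r u v2).
Hypotheses (CA : forall k u v w,
  convol k (fun i j => C j (C i u v) w) = convol k (fun i j => C j u (C i v w))).

Definition subst_param n u v := \sum_(r < n.+1) fps_exp a r n *: C r u v.

Let subst_paramE N n u v : (n < N)%N ->
  subst_param n u v = \sum_(r < N) fps_exp a r n *: C r u v.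
Proof.
move=> nN; rewrite /subst_param (big_ord_widen _ (fun r => fps_exp a r n *: C r u v) nN) big_mkcond.
apply: eq_bigr => r _; case: ifPn => //; rewrite -leqNgt => nr.
by rewrite fps_exp_small ?scale0r.
Qed.

Let linear_sum (h : A -> A) N (c : nat -> R) (x : nat -> A) :
  (forall c u v, h (c *: u + v) = c *: h u + h v) ->
  h (\sum_(r < N) c r *: x r) = \sum_(r < N) c r *: h (x r).
Proof.
move=> hl; have h0 : h 0 = 0.
  by have := hl (-1) 0 0; rewrite scaler0 addr0 scaleN1r addNr.
by elim: (index_enum _) => [|i s IHs]; rewrite ?big_nil// !big_cons hl IHs.
Qed.

Let sum_convol N (g : nat -> R) (f : nat -> nat -> A) :
  (forall t, (N <= t)%N -> g t = 0) ->
  \sum_(s < N) \sum_(r < N) g (s + r)%N *: f s r = \sum_(t < N) g t *: convol t f.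
Proof.
move=> g0; under [RHS]eq_bigr do rewrite scaler_sumr.
transitivity (\sum_(t < N) \sum_(s < N | (s <= t)%N) g t *: f s (t - s)%N); last first.
  apply: eq_bigr => t _; rewrite [LHS](eq_bigl (fun j : 'I_N => (j < t.+1)%N)) => [|j]; last by
    rewrite ltnS.
  by rewrite (big_ord_narrow (ltn_ord t)).
rewrite [RHS](exchange_big_dep xpredT)//=; apply: eq_bigr => s _.
rewrite (bigID (fun r : 'I_N => (s + r < N)%N)) /= [X in _ + X]big1 ?addr0 => [|r]; last first.
  by rewrite -leqNgt => /g0 ->; rewrite scale0r.
pose dec (t : 'I_N) : 'I_N := Ordinal (leq_ltn_trans (leq_subr s t) (ltn_ord t)).
rewrite (reindex_onto dec (fun r : 'I_N => insubd s (s + r)%N)) /=; last first.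
  move=> r sr; apply/val_inj; rewrite /= insubdK ?addKn//.
apply: eq_big => [t|t].
  apply/andP/idP => [[H /eqP/(congr1 val)]|st] /=.
    by rewrite insubdK//= => <-; lia.
  have E : (s + (t - s))%N = t by rewrite subnKC.
  by rewrite E ltn_ord; split=> //; apply/eqP/val_inj; rewrite insubdK ?E// -topredE /= ltn_ord.
by move=> /andP[H /eqP/(congr1 val)] /=; rewrite insubdK//= => ->.
Qed.

(** Since a^s a^r = a^(s + r), each side is the sum over t of a^t times the order t associativity
    expression for [C]. *)
Lemma subst_param_assoc n u v w :
  convol n (fun i j => subst_param j (subst_param i u v) w)
  = convol n (fun i j => subst_param j u (subst_param i v w)).
Proof.
pose g t := fps_exp a t n.
have g0 t : (n.+1 <= t)%N -> g t = 0 by move=> nt; apply: fps_exp_small.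
have rearrange (X : nat -> nat -> A) :
    convol n (fun i j => \sum_(s < n.+1) fps_exp a s i *: \sum_(r < n.+1) fps_exp a r j *: X s r)
    = \sum_(t < n.+1) g t *: convol t X.
  rewrite -sum_convol// convol_sum; apply: eq_bigr => s _.
  under eq_convol do rewrite scaler_sumr.
  rewrite convol_sum; apply: eq_bigr => r _.
  rewrite /g fps_expD fps_mulE (additive_convol (h := fun c => c *: X s r)); last first.
    by move=> x y; rewrite scalerDl.
  by apply: eq_convol => i j _; rewrite scalerA.
transitivity (\sum_(t < n.+1) g t *: convol t (fun s r => C r (C s u v) w)).
  rewrite -rearrange; apply: eq_convol => i j ij.
  rewrite (@subst_paramE n.+1 i); last by lia.
  rewrite (@subst_paramE n.+1 j); last by lia.
  under eq_bigr => r _ do rewrite (linear_sum n.+1 (fun q => fps_exp a q i)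
    (fun q => C q u v) (fun c x y => CPl r c x y w)) scaler_sumr.
  rewrite exchange_big /=; apply: eq_bigr => s _; rewrite scaler_sumr.
  by apply: eq_bigr => r _; rewrite !scalerA mulrC.
under eq_bigr do rewrite CA.
rewrite -rearrange; apply: eq_convol => i j ij.
rewrite (@subst_paramE n.+1 i); last by lia.
rewrite (@subst_paramE n.+1 j); last by lia.
under [RHS]eq_bigr => r _ do rewrite (linear_sum n.+1 (fun q => fps_exp a q i)
  (fun q => C q v w) (fun c x y => CPr r c u x y)) scaler_sumr.
rewrite [RHS]exchange_big /=; apply: eq_bigr => s _; rewrite scaler_sumr.
by apply: eq_bigr => r _; rewrite !scalerA mulrC.
Qed.

End Substitution.

(** * Graphs and nets *)

Section ValSums.
Context {R : realType} {m : nat}.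
Local Notation A := (smfun R m).
Local Notation fct := ('rV[R]_m -> R).

Lemma val_sum I (r : seq I) (p : pred I) (F : I -> A) :
  val (\sum_(i <- r | p i) F i) = \sum_(i <- r | p i) val (F i).
Proof. exact: (big_morph val). Qed.

Lemma val_prod I (r : seq I) (p : pred I) (F : I -> A) :
  val (\prod_(i <- r | p i) F i) = \prod_(i <- r | p i) val (F i).
Proof. exact: (big_morph val). Qed.

Lemma val_mul (f g : A) : val (f * g) = val f * val g.
Proof. by []. Qed.

Lemma prod_unit (X : unit -> fct) : \prod_b X b = X tt.
Proof. by rewrite (bigD1 tt)//= big1 ?mulr1// => -[]. Qed.

Lemma val_dparts s (f : A) : val (dparts s f) = partials s (val f).
Proof. by elim: s => //= i s <-. Qed.

End ValSums.

Section GraphsAsNets.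
Context {R : realType} {m : nat}.
Local Notation A := (smfun R m).
Local Notation tensor := ('I_m -> 'I_m -> A).
Implicit Types (P : tensor).

Lemma graph_noloop (B : finType) k (G : graph B k) (e : 'I_k * bool) : G e != inl e.1.
Proof. by have /andP[/forallP/(_ e)] := graphP G. Qed.

Definition net_of_graph (B : finType) k (G : graph B k) : net B :=
  @Net B 'I_k G (@graph_noloop B k G).

Definition val_tensor P : tensor2 R m := fun i j => val (P i j).

Lemma val_net_coef (B : finType) k (G : graph B k) P (I : {ffun edge k -> 'I_m}) :
  val (net_coef (N := net_of_graph G) P I) = graph_coef G (val_tensor P) I.
Proof. by rewrite val_prod; apply: eq_bigr => j _; rewrite val_dparts. Qed.

Lemma graph_bidiffE k (G : graph bool k) P (u v : A) :
  graph_bidiff G (val_tensor P) (val u) (val v)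
  = val (net_op (net_of_graph G) P (fun b => if b then v else u)).
Proof.
rewrite val_sum; apply: eq_bigr => I _.
rewrite val_mul val_net_coef val_prod big_bool !val_dparts.
by rewrite -mulrA; congr (_ * _); rewrite mulrC.
Qed.

Lemma graph_diffE k (G : graph unit k) P (u : A) :
  graph_diff G (val_tensor P) (val u) = val (net_op (net_of_graph G) P (fun _ => u)).
Proof.
rewrite val_sum; apply: eq_bigr => I _.
by rewrite val_mul val_net_coef val_prod prod_unit val_dparts.
Qed.

Definition nets_op (B : finType) (L : seq (R * net B)) P (F : B -> A) : A :=
  \sum_(x <- L) x.1 *: net_op x.2 P F.

Lemma fsbig_seqE (T : choiceType) (V : nmodType) (s : seq T) (F : T -> V) : uniq s ->
  (forall x, x \notin s -> F x = 0) -> \sum_(x \in [set: T]) F x = \sum_(x <- s) F x.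
Proof.
move=> us F0; rewrite (fsbigE s)//; last by move=> x _ /F0.
by apply: eq_bigl => x; rewrite in_setT.
Qed.

Lemma universal_coefE (w : nat -> star_graph -> R) :
  (forall n, (0 < n)%N -> finite_set [set G | w n G != 0]) ->
  exists L : nat -> seq (R * net bool), forall n, (0 < n)%N -> forall P (u v : A),
    universal_coef w (val_tensor P) n (val u) (val v)
    = val (nets_op (L n) P (fun b => if b then v else u)).
Proof.
move=> fin_w.
exists (fun n => [seq (w n G, net_of_graph (tagged G)) | G <- finmap.enum_fset (fset_set [set G |
  w n G != 0])]).
move=> n n0 P u v; rewrite /universal_coef gtn_eqF// /nets_op big_map val_sum.
rewrite (fsbig_seqE (s := finmap.enum_fset (fset_set [set G | w n G != 0])))//.
  by apply: eq_bigr => G _; rewrite graph_bidiffE.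
move=> G; rewrite in_fset_set; last exact: fin_w.
by rewrite notin_setE /= => /negP/negPn/eqP ->; rewrite scale0r.
Qed.

Lemma perm_map_filter (E E' : finType) (h : E -> E') (p : pred E) (p' : pred E') :
  bijective h -> (forall e, p' (h e) = p e) ->
  perm_eq [seq h e | e <- enum E & p e] [seq e <- enum E' | p' e].
Proof.
move=> [g hK gK] ph; apply: uniq_perm => [||e].
- by rewrite (map_inj_uniq (can_inj hK)) filter_uniq ?enum_uniq.
- by rewrite filter_uniq ?enum_uniq.
rewrite mem_filter mem_enum andbT; apply/mapP/idP => [[e' + ->]|pe].
  by rewrite mem_filter ph => /andP[].
by exists (g e); rewrite ?gK// mem_filter mem_enum andbT -ph gK.
Qed.

Section Isomorphism.
Variables (B : finType) (N N' : net B) (h : nv N -> nv N').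
Hypothesis h_bij : bijective h.
Let hE (e : nv N * bool) : nv N' * bool := (h e.1, e.2).
Let hV (x : nv N + B) : nv N' + B := match x with inl j => inl (h j) | inr b => inr b end.
Hypothesis h_tgt : forall e, tgt (hE e) = hV (tgt e).

Let hE_bij : bijective hE.
Proof.
by have [g hK gK] := h_bij; exists (fun e => (g e.1, e.2)) => -[j b]; rewrite /hE /= ?hK ?gK.
Qed.

Lemma net_op_iso P (F : B -> A) : net_op N P F = net_op N' P F.
Proof.
have [g hK gK] := hE_bij.
have incE (I : nv N' * bool -> 'I_m) x :
    perm_eq (incoming (tgt (n := N)) (I \o hE) x) (incoming (tgt (n := N')) I (hV x)).
  rewrite /incoming (map_comp I hE); apply: perm_map; apply: perm_map_filter => // e.
  rewrite h_tgt; case: (tgt e) x => [j|b] [j'|b'] //=.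
  by apply/eqP/eqP => [[/(bij_inj h_bij) ->]|[->]].
rewrite /net_op (reindex (fun I : {ffun nv N' * bool -> 'I_m} => [ffun e => I (hE e)])) /=; last
  first.
  exists (fun I : {ffun nv N * bool -> 'I_m} => [ffun e => I (g e)]) => I _;
    by apply/ffunP => e; rewrite !ffunE ?hK ?gK.
apply: eq_bigr => I _.
have E : [ffun e => I (hE e)] =1 I \o hE by move=> e; rewrite ffunE.
have E' x : incoming (tgt (n := N)) [ffun e => I (hE e)] x = incoming (tgt (n := N)) (I \o hE) x.
  exact: eq_map.
congr (_ * _); last by apply: eq_bigr => b _; rewrite E' (perm_dparts _ (incE I (inr b))).
rewrite /net_coef [RHS](reindex h) /=; last exact: onW_bij.
by apply: eq_bigr => j _; rewrite E' !ffunE (perm_dparts _ (incE I (inl j))).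
Qed.

End Isomorphism.

(* Exchanging the two edges out of j0 reverses the sign, as P is skew. *)
Lemma double_edge_op (B : finType) (N : net B) (j0 : nv N) P F :
  tgt (j0, false) = tgt (j0, true) -> linear_tensor P -> net_op N P F = 0.
Proof.
move=> dbl [skew _].
pose tau (e : nv N * bool) := if e.1 == j0 then (j0, ~~ e.2) else e.
have tauK : involutive tau.
  by move=> [j b]; rewrite /tau /=; have [->|/negPf jj] := eqVneq j j0; rewrite /= ?eqxx ?negbK ?jj.
have tgt_tau e : tgt (tau e) = tgt e.
  by rewrite /tau; case: e => j b /=; have [->|//] := eqVneq j j0; case: b.
have incE (I : nv N * bool -> 'I_m) x :
    perm_eq (incoming (tgt (n := N)) (I \o tau) x) (incoming (tgt (n := N)) I x).
  rewrite /incoming (map_comp I tau); apply: perm_map; apply: perm_map_filter; first exact: inv_bij.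
  by move=> e; rewrite tgt_tau.
have opN : net_op N P F = - net_op N P F.
  rewrite {1}/net_op -sumrN.
  rewrite (reindex (fun I : {ffun nv N * bool -> 'I_m} => [ffun e => I (tau e)])) /=; last first.
    exists (fun I : {ffun nv N * bool -> 'I_m} => [ffun e => I (tau e)]) => I _;
      by apply/ffunP => e; rewrite !ffunE tauK.
  apply: eq_bigr => I _.
  have E' x : incoming (tgt (n := N)) [ffun e => I (tau e)] x = incoming (tgt (n := N)) (I \o
    tau) x.
    by apply: eq_map => e; rewrite ffunE.
  rewrite -mulNr; congr (_ * _).
    rewrite /net_coef (bigD1 j0)//= [in RHS](bigD1 j0)//= -mulNr; congr (_ * _).
      by rewrite E' (perm_dparts _ (incE I (inl j0))) !ffunE /tau eqxx /= skew linearN.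
    apply: eq_bigr => j /negPf jj.
    by rewrite E' (perm_dparts _ (incE I (inl j))) !ffunE /tau /= jj.
  by apply: eq_bigr => b _; rewrite E' (perm_dparts _ (incE I (inr b))).
have : 2%:R *: net_op N P F = 0 by rewrite scaler_nat mulr2n {1}opN addNr.
by move=> /eqP; rewrite scaler_eq0 pnatr_eq0 => /eqP.
Qed.

(** Finite support is carried by an explicit list, so that sums of two such operators can be taken
    over the union of the lists. *)
Definition graphical (Q : tensor -> A -> A) := exists (t : op_graph -> R) (s : seq op_graph),
  [/\ uniq s, forall G, G \notin s -> t G = 0 & forall P, linear_tensor P -> forall u,
    val (Q P u) = \sum_(G <- s) t G *: graph_diff (tagged G) (val_tensor P) (val u)].

Lemma graphical0 : graphical (fun _ _ => 0).
Proof. by exists (fun _ => 0), [::]; split=> // P _ u; rewrite big_nil. Qed.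

Lemma graphicalD a Q Q' : graphical Q -> graphical Q' ->
  graphical (fun P u => a *: Q P u + Q' P u).
Proof.
move=> [t [s [us ts EQ]]] [t' [s' [us' ts' EQ']]].
have sum_widen (t0 : op_graph -> R) s0 (X : op_graph -> 'rV[R]_m -> R) :
    uniq s0 -> (forall G, G \notin s0 -> t0 G = 0) -> {subset s0 <= undup (s ++ s')} ->
    \sum_(G <- s0) t0 G *: X G = \sum_(G <- undup (s ++ s')) t0 G *: X G.
  move=> us0 t00 sub; have : perm_eq s0 [seq G <- undup (s ++ s') | G \in s0].
    apply: uniq_perm => [||G]; rewrite ?filter_uniq ?undup_uniq// mem_filter.
    by case: (boolP (G \in s0)) => // /sub ->.
  move=> ps; rewrite (perm_big _ ps) big_filter big_mkcond; apply: eq_bigr => G _.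
  by case: ifPn => // /t00 ->; rewrite scale0r.
exists (fun G => a * t G + t' G), (undup (s ++ s')); split=> [|G|P lP u].
- exact: undup_uniq.
- by rewrite mem_undup mem_cat negb_or => /andP[/ts -> /ts' ->]; rewrite mulr0 addr0.
rewrite -[LHS]/(a *: val (Q P u) + val (Q' P u)) EQ// EQ'//.
rewrite (sum_widen t s)//; last by move=> G Gs; rewrite mem_undup mem_cat Gs.
rewrite (sum_widen t' s')//; last by move=> G Gs; rewrite mem_undup mem_cat Gs orbT.
rewrite scaler_sumr -big_split; apply: eq_bigr => G _ /=.
by rewrite scalerDl scalerA.
Qed.

(** A net with a double edge contributes nothing; any other becomes a graph after numbering its
    vertices. *)
Lemma graphical_net (N : net unit) : graphical (fun P u => net_op N P (fun _ => u)).
Proof.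
have [[j0 dbl]|inj] := pselect (exists j0 : nv N, tgt (j0, false) = tgt (j0, true)).
  exists (fun _ => 0), [::]; split=> // P lP u.
  by rewrite (double_edge_op _ dbl lP) big_nil.
pose k := #|nv N|.
pose h (j : nv N) : 'I_k := enum_rank j.
pose g (i : 'I_k) : nv N := enum_val i.
pose t : {ffun edge k -> vertex unit k} := [ffun e => match tgt (g e.1, e.2) with
  inl j => inl (h j) | inr b => inr b end].
have tP : graph_axiom t.
  apply/andP; split.
    apply/forallP => e; rewrite ffunE; have := noloop (g e.1, e.2).
    case: (tgt _) => // j; apply: contra => /eqP[] jE.
    by rewrite -jE /g enum_rankK.
  apply/injectiveP => -[i b] [i' b'] [<-]; rewrite !ffunE /= => E.
  have {}E : tgt (g i, b) = tgt (g i, b').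
    move: E; case: (tgt (g i, b)) (tgt (g i, b')) => [j|[]] [j'|[]]//.
    by move=> [/enum_rank_inj ->].
  congr (_, _); apply/eqP/negPn/negP => bb'; apply: inj; exists (g i).
  by case: b b' bb' E => -[].
pose G : op_graph := Tagged (graph unit) (Graph tP).
exists (fun G' => (G' == G)%:R), [:: G]; split=> // [G'|P lP u].
  by rewrite inE => /negPf ->.
rewrite big_seq1 eqxx scale1r graph_diffE; congr val.
apply: (@net_op_iso _ N (net_of_graph (Graph tP)) h).
  by exists g => x; rewrite /h /g ?enum_rankK ?enum_valK.
by move=> [j b]; rewrite /= ffunE /= /g /h enum_rankK; case: (tgt _).
Qed.

Lemma graphical_nets (L : seq (R * net unit)) : graphical (fun P u => nets_op L P (fun _ => u)).
Proof.
elim: L => [|x L IHL].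
  have [t [s [us ts E]]] := graphical0; exists t, s; split=> // P lP u.
  by rewrite -E// /nets_op big_nil.
have [t [s [us ts E]]] := graphicalD x.1 (graphical_net x.2) IHL; exists t, s; split=> // P lP u.
by rewrite -E// /nets_op big_cons.
Qed.

Lemma universal_opE (L : seq (R * net unit)) : exists t : op_graph -> R,
  finite_set [set G | t G != 0] /\ forall P, linear_tensor P -> forall u : A,
    universal_op t (val_tensor P) (val u) = val (nets_op L P (fun _ => u)).
Proof.
have [t [s [us ts E]]] := graphical_nets L; exists t; split.
  apply: (@sub_finite_set _ _ [set` s]); last exact: finite_seq.
  by move=> G /=; apply: contra_neqT => /ts.
move=> P lP u; rewrite E// /universal_op (fsbig_seqE us)// => G /ts ->.
by rewrite scale0r.
Qed.

End GraphsAsNets.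

Lemma smfunP (R : realType) (m : nat) (f g : smfun R m) : (forall x, f x = g x) -> f = g.
Proof. by move=> fg; apply/val_inj/funext. Qed.

(** * Linear Poisson structures *)

Section BracketJacobi.
Context {R : realType} {m : nat}.
Local Notation A := (smfun R m).
Local Notation pair := ('I_m * 'I_m)%type.
Variable P : 'I_m -> 'I_m -> A.
Hypothesis skew : forall i j, P i j = - P j i.
Implicit Types (u v w : A).

Definition smbracket u v : A := \sum_i \sum_j P i j * dpart i u * dpart j v.

Let brE u v : smbracket u v = \sum_(p : pair) P p.1 p.2 * dpart p.1 u * dpart p.2 v.
Proof. by rewrite /smbracket pair_big. Qed.

Let swap (F : pair -> A) : \sum_(p : pair) P p.1 p.2 * F p = - \sum_(p : pair) P p.1 p.2 * F
  (p.2, p.1).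
Proof.
rewrite (reindex_inj (h := fun p : pair => (p.2, p.1))) /=; last by move=> [? ?] [? ?] [-> ->].
by rewrite -sumrN; apply: eq_bigr => p _; rewrite skew mulNr.
Qed.

Let first_order u v w := \sum_(p : pair) \sum_(q : pair)
  P p.1 p.2 * dpart p.2 (P q.1 q.2) * (dpart p.1 u * dpart q.1 v * dpart q.2 w).

Let second_order u v w := \sum_(p : pair) P p.1 p.2 * \sum_(q : pair)
  P q.1 q.2 * (dpart p.1 u * dpart p.2 (dpart q.1 v) * dpart q.2 w).

(** The middle argument carries both derivatives of second order. Reversing both copies of P costs
    two signs, after which the copies trade places because derivatives commute. *)
Let second_orderC u v w : second_order u v w = second_order w v u.
Proof.
rewrite /second_order swap.
under eq_bigr do rewrite swap /= mulrN.
rewrite sumrN opprK.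
under eq_bigr do rewrite mulr_sumr.
under [RHS]eq_bigr do rewrite mulr_sumr.
rewrite exchange_big; apply: eq_bigr => p _; apply: eq_bigr => q _ /=.
by rewrite dpartC; ring.
Qed.

Let bracket_expand u v w : smbracket u (smbracket v w) =
  first_order u v w + second_order u v w - second_order u w v.
Proof.
have -> : second_order u w v = - \sum_(p : pair) P p.1 p.2 * \sum_(q : pair)
    P q.1 q.2 * (dpart p.1 u * dpart q.1 v * dpart p.2 (dpart q.2 w)).
  rewrite -sumrN; apply: eq_bigr => p _; rewrite swap mulrN; congr (- (_ * _)).
  by apply: eq_bigr => q _ /=; ring.
rewrite opprK brE -!big_split; apply: eq_bigr => p _ /=.
rewrite brE raddf_sum !mulr_sumr -!big_split; apply: eq_bigr => q _ /=.
by rewrite !dpartM; ring.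
Qed.

Hypothesis structure_jacobi : forall a c d,
  \sum_b (P a b * dpart b (P c d) + P c b * dpart b (P d a) + P d b * dpart b (P a c)) = 0.

Let first_orderE u v w : first_order u v w = \sum_a \sum_c \sum_d
  (\sum_b P a b * dpart b (P c d)) * (dpart a u * dpart c v * dpart d w).
Proof.
rewrite /first_order -(pair_big xpredT xpredT (fun a b => \sum_(q : pair)
  P a b * dpart b (P q.1 q.2) * (dpart a u * dpart q.1 v * dpart q.2 w))) /=.
apply: eq_bigr => a _; rewrite [LHS]exchange_big [RHS]pair_big /=; apply: eq_bigr => q _.
by rewrite mulr_suml.
Qed.

Let rotate (H : 'I_m -> 'I_m -> 'I_m -> A) :
  \sum_a \sum_c \sum_d H a c d = \sum_a \sum_c \sum_d H c d a.
Proof. by rewrite [RHS]exchange_big; apply: eq_bigr => c _; exact: exchange_big. Qed.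

(** In the cyclic sum the second-order terms cancel in pairs by [second_orderC], and the first-order
    ones assemble into the coordinate Jacobi identity for P. *)
Lemma smbracket_jacobi u v w : smbracket u (smbracket v w) + smbracket v (smbracket w u)
  + smbracket w (smbracket u v) = 0.
Proof.
have F0 : first_order u v w + first_order v w u + first_order w u v = 0.
  rewrite !first_orderE [X in _ + X + _]rotate [X in _ + X]rotate [X in _ + X]rotate.
  rewrite -!big_split big1// => a _; rewrite -!big_split big1// => c _.
  rewrite -!big_split big1// => d _ /=.
  have := structure_jacobi a c d; rewrite !big_split /=.
  set M1 := \sum_i _; set M2 := \sum_i _; set M3 := \sum_i _ => M0.
  transitivity ((M1 + M2 + M3) * (dpart a u * dpart c v * dpart d w)); first by ring.
  by rewrite M0 mul0r.
rewrite !bracket_expand (second_orderC w v u) (second_orderC u w v) (second_orderC v u w) -[RHS]F0.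
ring.
Qed.

End BracketJacobi.

Section LieTensor.
Context {R : realType} {g : vectType R} {m : nat}.
Variables (br : g -> g -> g) (b : m.-tuple g).
Hypotheses (lie : lie_bracket br) (b_basis : basis_of fullv b).
Local Notation A := (smfun R m).

Definition structure_row (X : g) : 'rV[R]_m := \row_k coord b k X.

Definition lie_tensor (i j : 'I_m) : A := affine 0 (structure_row (br b`_i b`_j)).

Lemma linear_poissonE i j : linear_poisson br b i j = lie_tensor i j.
Proof.
apply/funext => xi; rewrite affineE subr0; apply: eq_bigr => k _.
by rewrite mxE mulrC.
Qed.

Lemma structure_row_linear : linear structure_row.
Proof. by move=> a X Y; apply/rowP => k; rewrite !mxE linearP. Qed.

Lemma lie_skew X Y : br X Y = - br Y X.
Proof.
have lin_l Z := lie_linearl lie Z; have lin_r Z := lie_linearr lie Z.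
have Dl X1 X2 Z : br (X1 + X2) Z = br X1 Z + br X2 Z by have := lin_l Z 1 X1 X2; rewrite !scale1r.
have Dr Z X1 X2 : br Z (X1 + X2) = br Z X1 + br Z X2 by have := lin_r Z 1 X1 X2; rewrite !scale1r.
have := lie_alternating lie (X + Y); rewrite Dl !Dr !(lie_alternating lie) add0r addr0.
by move=> /eqP; rewrite addr_eq0 => /eqP.
Qed.

Lemma affine_linear xi : linear (fun X : 'rV[R]_m => affine xi X : A).
Proof.
move=> a X Y; apply: smfunP => x; rewrite affineE.
rewrite -[RHS]/(a * affine xi X x + affine xi Y x) !affineE /pairing mulr_sumr -big_split.
by apply: eq_bigr => i _ /=; rewrite !mxE; ring.
Qed.

Lemma affineN xi X : affine xi (- X) = - affine xi X :> A.
Proof.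
have a0 : affine xi 0 = 0 :> A.
  by have := affine_linear xi (-1) 0 0; rewrite scaler0 addr0 scaleN1r addNr.
by have := affine_linear xi (-1) X 0; rewrite !scaleN1r a0 !addr0.
Qed.

Lemma lie_tensor_linear : linear_tensor lie_tensor.
Proof.
split=> [i j|i j k l].
  rewrite /lie_tensor lie_skew -affineN; congr affine.
  by apply/rowP => q; rewrite !mxE linearN.
by rewrite /lie_tensor dpart_affine dpart_cst.
Qed.

Lemma dpart_lie_tensor l i j : dpart l (lie_tensor i j) = (coord b l (br b`_i b`_j))%:A.
Proof. by rewrite dpart_affine mxE. Qed.

Lemma lie_tensor_contract X i xi :
  \sum_l coord b l X * lie_tensor i l xi = pairing (structure_row (br b`_i X)) xi.
Proof.
pose h Y := pairing (structure_row (br b`_i Y)) xi.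
have hlin c Y Z : h (c *: Y + Z) = c * h Y + h Z.
  rewrite /h (lie_linearr lie) structure_row_linear /pairing mulr_sumr -big_split.
  by apply: eq_bigr => k _ /=; rewrite !mxE; ring.
have h0 : h 0 = 0 by have := hlin (-1) 0 0; rewrite scaler0 addr0 mulN1r addNr.
transitivity (\sum_l coord b l X * h b`_l).
  by apply: eq_bigr => l _; rewrite affineE subr0.
rewrite -[RHS]/(h X) {2}(coord_basis b_basis (memvf X)).
by elim: (index_enum _) => [|l s IHs]; rewrite ?big_nil// !big_cons hlin IHs.
Qed.

(** The derivatives of P_cd are the coordinates of [b_c, b_d], so contracting them with P_a gives
    the linear function of [b_a, [b_c, b_d]]; the Lie Jacobi identity concludes. *)
Lemma lie_structure_jacobi a c d :
  \sum_l (lie_tensor a l * dpart l (lie_tensor c d) + lie_tensor c l * dpart l (lie_tensor d a)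
    + lie_tensor d l * dpart l (lie_tensor a c)) = 0.
Proof.
apply: smfunP => xi; rewrite smfun_sumE.
have E (f : A) (s : R) : (f * s%:A) xi = s * f xi.
  by rewrite -[LHS]/(f xi * (s * 1)) mulr1 mulrC.
transitivity (\sum_l (coord b l (br b`_c b`_d) * lie_tensor a l xi +
  coord b l (br b`_d b`_a) * lie_tensor c l xi + coord b l (br b`_a b`_c) * lie_tensor d l xi)).
  by apply: eq_bigr => l _; rewrite !dpart_lie_tensor -!E.
rewrite !big_split /= !lie_tensor_contract -!pairingDl.
have D X Y : structure_row X + structure_row Y = structure_row (X + Y).
  by have := structure_row_linear 1 X Y; rewrite !scale1r.
rewrite !D (lie_jacobi lie) /pairing big1// => k _.
by rewrite mxE linear0 mul0r.
Qed.

Lemma lie_poisson : poisson_tensor (linear_poisson br b).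
Proof.
have PE : linear_poisson br b = fun i j => val (lie_tensor i j).
  by apply/funext => i; apply/funext => j; exact: linear_poissonE.
have brA (u v : A) : bracket (linear_poisson br b) (val u) (val v) = val (smbracket lie_tensor u v).
  rewrite PE /smbracket /bracket val_sum; apply: eq_bigr => i _.
  by rewrite val_sum; apply: eq_bigr.
split=> [i j|i j|u v w su sv sw].
- by rewrite linear_poissonE; apply: sfun_smooth.
- by rewrite !linear_poissonE lie_tensor_linear.1.
rewrite -[u]/(val (to_sfun su)) -[v]/(val (to_sfun sv)) -[w]/(val (to_sfun sw)) !brA.
exact: (congr1 val (smbracket_jacobi lie_tensor_linear.1 lie_structure_jacobi
  (to_sfun su) (to_sfun sv) (to_sfun sw))).
Qed.

End LieTensor.

(** * Construction of the equivalence *)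

Section StarLift.
Context {R : realType} {m : nat}.
Local Notation A := (smfun R m).
Variables (P : 'I_m -> 'I_m -> A) (K : nat -> ('rV[R]_m -> R) -> ('rV[R]_m -> R) -> ('rV[R]_m ->
  R)).
Variable C : nat -> A -> A -> A.
Hypotheses (star : star_product (val_tensor P) K)
  (CE : forall n u v, val (C n u v) = K n (val u) (val v)).

Lemma lift_linearl r c u1 u2 v : C r (c *: u1 + u2) v = c *: C r u1 v + C r u2 v.
Proof.
by apply/val_inj; rewrite CE (star_linearl star _ _ (sfun_smooth u1) (sfun_smooth u2)
  (sfun_smooth v)) -!CE.
Qed.

Lemma lift_linearr r c u v1 v2 : C r u (c *: v1 + v2) = c *: C r u v1 + C r u v2.
Proof.
by apply/val_inj; rewrite CE (star_linearr star _ _ (sfun_smooth u) (sfun_smooth v1) (sfun_smooth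
  v2)) -!CE.
Qed.

Lemma lift0l r v : C r 0 v = 0.
Proof. by have := lift_linearl r (-1) 0 0 v; rewrite scaler0 addr0 scaleN1r addNr. Qed.

Lemma lift0r r u : C r u 0 = 0.
Proof. by have := lift_linearr r (-1) u 0 0; rewrite scaler0 addr0 scaleN1r addNr. Qed.

Lemma lift_order0 u v : C 0 u v = u * v.
Proof. by apply/val_inj; rewrite CE (star_order0 star (sfun_smooth u) (sfun_smooth v)). Qed.

Lemma lift_unit r : (0 < r)%N -> C r 1 1 = 0.
Proof.
by move=> r0; apply/val_inj; rewrite CE (star_unitl star (smooth1 (R := R) (m := m)))
  /const_series gtn_eqF.
Qed.

Lemma lift_order1 u v : C 1 u v - C 1 v u = smbracket P u v.
Proof.
apply/val_inj; rewrite -[LHS]/(val (C 1 u v) - val (C 1 v u)) !CE.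
rewrite (star_order1 star (sfun_smooth u) (sfun_smooth v)) val_sum; apply: eq_bigr => i _.
by rewrite val_sum; apply: eq_bigr.
Qed.

Lemma bilin_ext_val (U V : nat -> A) :
  bilin_ext K (fun n => val (U n)) (fun n => val (V n))
  = fun n => val (convol n (fun a k => convol k (fun b r => C r (U a) (V b)))).
Proof.
apply/funext => n; rewrite val_sum; apply: eq_bigr => a _.
have le_n : ((n - a).+1 <= n.+1)%N by rewrite ltnS leq_subr.
rewrite val_sum (bigID (fun b : 'I_n.+1 => (b < (n - a).+1)%N)) /= [X in _ + X]big1 ?addr0 => [|b
  ab]; last first.
  by rewrite big1// => r /eqP E; move: ab E; rewrite ltnS -ltnNge; lia.
rewrite (big_ord_narrow le_n); apply: eq_bigr => b _.
have ltr : (n - a - b < n.+1)%N by rewrite ltnS -subnDA leq_subr.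
rewrite (big_pred1 (Ordinal ltr)) ?CE// => r /=.
by rewrite -val_eqE /=; have := ltn_ord b; have := ltn_ord a; have := ltn_ord r; lia.
Qed.

Definition const_smooth (u : A) (n : nat) : A := if n == 0%N then u else 0.

Lemma const_seriesE (u : A) : const_series (val u) = fun n => val (const_smooth u n).
Proof. by apply/funext => n; rewrite /const_series /const_smooth; case: ifP. Qed.

Lemma convol_const (F : A -> nat -> A) u n : (forall k, F 0 k = 0) ->
  convol n (fun a k => F (const_smooth u a) k) = F u n.
Proof.
by move=> F0; rewrite /convol big_ord_recl /= subn0 big1 ?addr0.
Qed.

(** Associativity is assumed for formal series; applied to constant series, it reduces to the
    identity between the coefficients. *)
Lemma lift_assoc n u v w :
  convol n (fun i j => C j (C i u v) w) = convol n (fun i j => C j u (C i v w)).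
Proof.
have sc (x : A) : smooth_series (const_series (val x)).
  by move=> k; rewrite const_seriesE; apply: sfun_smooth.
have := congr1 (fun U : nat -> 'rV[R]_m -> R => U n) (star_assoc star (sc u) (sc v) (sc w)).
rewrite !const_seriesE !bilin_ext_val => /val_inj E.
have prod x y k : convol k (fun a j => convol j (fun b r => C r (const_smooth x a) (const_smooth
  y b))) = C k x y.
  rewrite (convol_const (F := fun z j => convol j (fun b r => C r z (const_smooth y b)))).
    by rewrite (convol_const (F := fun z r => C r x z))// => j; exact: lift0r.
  by move=> j; rewrite -[RHS](convol_zero A j); apply: eq_convol => b r _; exact: lift0l.
transitivity (convol n (fun a k => convol k (fun b r => C r (C a u v) (const_smooth w b)))).
  apply: eq_convol => i j _; rewrite (convol_const (F := fun z r => C r (C i u v) z))// => k.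
  exact: lift0r.
transitivity (convol n (fun a k => convol k (fun b r => C r (const_smooth u a) (C b v w)))).
  transitivity (convol n (fun a k => convol k (fun b r => C r (convol a (fun a' j => convol j
    (fun b' r' =>
      C r' (const_smooth u a') (const_smooth v b')))) (const_smooth w b)))).
    by apply: eq_convol => a k _; apply: eq_convol => b r _; rewrite prod.
  by rewrite E; apply: eq_convol => a k _; apply: eq_convol => b r _; rewrite prod.
rewrite (convol_const (F := fun z k => convol k (fun b r => C r z (C b v w))))// => k.
by rewrite -[RHS](convol_zero A k); apply: eq_convol => b r _; exact: lift0l.
Qed.

End StarLift.

Section Universality.
Context {R : realType} {m : nat}.
Local Notation A := (smfun R m).
Local Notation tensor := ('I_m -> 'I_m -> A).
Implicit Types (P : tensor).

Lemma universalD (B : finType) (Q Q' : tensor -> (B -> A) -> A) :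
  universal Q -> universal Q' -> universal (fun P F => Q P F + Q' P F).
Proof.
by move=> [L HL] [L' HL']; exists (L ++ L') => P lP F; rewrite big_cat HL// HL'.
Qed.

Definition empty_net (B : finType) : net B :=
  @Net B void (fun e => match e.1 with end) (fun e => match e.1 with end).

Lemma empty_net_op (B : finType) P (F : B -> A) : net_op (empty_net B) P F = \prod_b F b.
Proof.
have noI (I J : {ffun nv (empty_net B) * bool -> 'I_m}) : I = J by apply/ffunP => -[[]].
pose I0 : {ffun nv (empty_net B) * bool -> 'I_m} := [ffun e : nv (empty_net B) * bool => match
  e.1 with end].
rewrite /net_op [LHS](bigD1 I0)//= [X in _ + X]big1 ?addr0 => [|I]; last by rewrite (noI I I0) eqxx.
rewrite /net_coef big1 ?mul1r => [|[]//]; apply: eq_bigr => b _.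
rewrite (_ : incoming _ _ _ = [::])//; rewrite /incoming; case: (enum _) => [//|[[] ?]].
Qed.

Lemma univ1_id : univ1 (fun P (u : A) => u).
Proof.
apply: universal_ext (universal_net (empty_net unit)) => P _ F.
by rewrite empty_net_op (bigD1 tt)//= big1 ?mulr1// => -[].
Qed.

Lemma univ2_mul : univ2 (fun P (u v : A) => u * v).
Proof.
apply: universal_ext (universal_net (empty_net bool)) => P _ F.
by rewrite empty_net_op big_bool mulrC.
Qed.

Lemma univ1_nets (L : seq (R * net unit)) : univ1 (fun P (u : A) => nets_op L P (fun _ => u)).
Proof.
by exists L => P _ F; rewrite (_ : (fun _ => F tt) = F)//; apply/funext => -[].
Qed.

Lemma univ2_nets (L : seq (R * net bool)) :
  univ2 (fun P (u v : A) => nets_op L P (fun b => if b then v else u)).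
Proof.
exists L => P _ F; rewrite (_ : (fun b : bool => if b then F true else F false) = F)//.
by apply/funext => -[].
Qed.

Lemma univ2_convol n (D : nat -> nat -> tensor -> A -> A -> A) :
  (forall i j, univ2 (D i j)) -> univ2 (fun P u v => convol n (fun i j => D i j P u v)).
Proof.
move=> uD; apply: (@universal_sum _ _ _ _ _ _ (fun (i : 'I_n.+1) P F => D i (n - i)%N P (F false)
  (F true))) => i _.
exact: uD.
Qed.

End Universality.

Section GaugeStep.
Context {R : realType} {m : nat}.
Local Notation A := (smfun R m).
Local Notation tensor := ('I_m -> 'I_m -> A).
Implicit Types (P : tensor).
Variables w w' : nat -> star_graph -> R.
Hypotheses (hw : universal_star_product R m w) (hw' : universal_star_product R m w').
Variables L L' : nat -> seq (R * net bool).
Hypothesis LE : forall n, (0 < n)%N -> forall P (u v : A),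
  universal_coef w (val_tensor P) n (val u) (val v)
  = val (nets_op (L n) P (fun b => if b then v else u)).
Hypothesis L'E : forall n, (0 < n)%N -> forall P (u v : A),
  universal_coef w' (val_tensor P) n (val u) (val v)
  = val (nets_op (L' n) P (fun b => if b then v else u)).

Definition star_coef (M : nat -> seq (R * net bool)) P (n : nat) (u v : A) : A :=
  if n == 0%N then u * v else nets_op (M n) P (fun b => if b then v else u).

Definition gauge_coef (Ts : nat -> seq (R * net unit)) P (n : nat) (u : A) : A :=
  if n == 0%N then u else nets_op (Ts n) P (fun _ => u).

(** Linearity makes the graph formulas applicable; the Poisson property makes [w] and [w'] give star
    products at P. *)
Definition good P := linear_tensor P /\ poisson_tensor (val_tensor P).

Let C P := star_coef L P.
Let C' P := star_coef L' P.
Let C'' (f : nat -> R) P n u v := subst_param (C' P) (new_parameter f) n u v.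

Let CE P n (u v : A) : val (C P n u v) = universal_coef w (val_tensor P) n (val u) (val v).
Proof. by have [->//|n0] := posnP n; rewrite LE// /C /star_coef gtn_eqF. Qed.

Let C'E P n (u v : A) : val (C' P n u v) = universal_coef w' (val_tensor P) n (val u) (val v).
Proof. by have [->//|n0] := posnP n; rewrite L'E// /C' /star_coef gtn_eqF. Qed.

Definition gauge_eq (Ts : nat -> seq (R * net unit)) (f : nat -> R) P k := forall u v,
  push_prod (C'' f P) (gauge_coef Ts P) k u v = prod_push (C P) (gauge_coef Ts P) k u v.

Let new_parameter0 f : new_parameter f 0 = 0 :> R. Proof. by []. Qed.

Let fps_exp_agree (f f' : nat -> R) k r : (forall i, (i <= k)%N -> f i = f' i) ->
  fps_exp (new_parameter f) r k = fps_exp (new_parameter f') r k.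
Proof.
move=> ff'; have E i : (i <= k)%N -> new_parameter f i = new_parameter f' i.
  by move=> ik; rewrite /new_parameter ff'.
have [->|r1] := eqVneq r 1%N; first by rewrite !fps_exp1 E.
by apply: fps_exp_congr => // i ik; apply/E/ltnW.
Qed.

(** Order k sees the data up to order k only, so later choices never spoil earlier identities. *)
Lemma gauge_eq_congr Ts Ts' f f' P k :
  (forall i, (i <= k)%N -> Ts i = Ts' i /\ f i = f' i) ->
  gauge_eq Ts f P k -> gauge_eq Ts' f' P k.
Proof.
move=> agree E u v; have ET i x : (i <= k)%N -> gauge_coef Ts' P i x = gauge_coef Ts P i x.
  by move=> /agree[TT _]; rewrite /gauge_coef TT.
have EC j x y : (j <= k)%N -> C'' f' P j x y = C'' f P j x y.
  move=> jk; apply: eq_bigr => r _; congr (_ *: _); apply: fps_exp_agree => i ij.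
  by have [_ ->] := agree i (leq_trans ij jk).
transitivity (push_prod (C'' f P) (gauge_coef Ts P) k u v).
  by apply: eq_convol => i j ij; rewrite ET ?EC//; lia.
rewrite E; apply: eq_convol => i l il; apply: eq_convol => j r jr; rewrite !ET//; lia.
Qed.

Lemma gauge_eq0 Ts f P : gauge_eq Ts f P 0.
Proof.
move=> u v; rewrite /push_prod /prod_push !convol0 /gauge_coef /= /C'' /subst_param big_ord1 /=.
by rewrite scale1r.
Qed.

Let nets_op_linear (M : seq (R * net unit)) P a u v : nets_op M P (fun _ => a *: u + v)
  = a *: nets_op M P (fun _ => u) + nets_op M P (fun _ => v).
Proof.
rewrite /nets_op; elim: M => [|x M IHM]; first by rewrite !big_nil scaler0 addr0.
rewrite !big_cons IHM scalerDr addrACA; congr (_ + _).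
have E f : net_op x.2 P (fun _ => f) = net_op x.2 P (fun b => if b == tt then f else 0).
  by congr net_op; apply/funext => -[].
by rewrite (E (a *: u + v)) (net_op_slotP x.2 tt P a u v (fun _ => 0)) -!E scalerDr !scalerA mulrC.
Qed.

Let gauge_coefD Ts P i u v :
  gauge_coef Ts P i (u + v) = gauge_coef Ts P i u + gauge_coef Ts P i v.
Proof.
rewrite /gauge_coef; case: ifP => // _; have := nets_op_linear (Ts i) P 1 u v.
by rewrite !scale1r.
Qed.

Let univ1_gauge Ts i : univ1 (fun P u => gauge_coef Ts P i u).
Proof. by rewrite /gauge_coef; case: (i == 0%N); [exact: univ1_id|exact: univ1_nets]. Qed.

Let univ2_star M n : univ2 (fun P u v => star_coef M P n u v).
Proof. by rewrite /star_coef; case: (n == 0%N); [exact: univ2_mul|exact: univ2_nets]. Qed.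

Let univ2_subst f n : univ2 (C'' f ^~ n).
Proof.
by apply: universal_sum => r _; apply: universalZ; exact: univ2_star.
Qed.

Let defect_at Ts f n P u v := defect (C P) (C'' f P) (gauge_coef Ts P) n u v.

Let univ2_defect Ts f n : univ2 (defect_at Ts f n).
Proof.
apply: universalD.
  apply: (@univ2_convol _ _ n (fun i j P u v => gauge_coef Ts P i (C'' f P j u v))) => i j.
  exact: (univ1_comp (univ1_gauge Ts i) (univ2_subst f j)).
apply: (universal_ext (Q' := fun P F => -1 *: prod_push (C P) (gauge_coef Ts P) n (F false) (F
  true))).
  by move=> P _ F; rewrite scaleN1r.
apply: universalZ; apply: (@univ2_convol _ _ n (fun i l P u v =>
  convol l (fun j r => C P r (gauge_coef Ts P i u) (gauge_coef Ts P j v)))) => i l.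
apply: (@univ2_convol _ _ l (fun j r P u v => C P r (gauge_coef Ts P i u) (gauge_coef Ts P j v)))
  => j r.
apply: (univ2_compl (univ1_gauge Ts i) (D := fun P u v => C P r u (gauge_coef Ts P j v))).
exact: (univ2_compr (univ1_gauge Ts j) (univ2_star L r)).
Qed.

Let upd (T : Type) (s : nat -> T) n x i := if i == n then x else s i.

Let subst_upd f n c P u v : (1 < n)%N ->
  C'' (upd f n c) P n u v = C'' (upd f n 0) P n u v + c *: C' P 1 u v.
Proof.
move=> n1; have n2 : (1 < n.+1)%N by lia.
have E x : fps_exp (new_parameter (upd f n x)) 1 n = x :> R.
  by rewrite fps_exp1 /new_parameter leqNgt n1 /= /upd eqxx.
have split1 (g : nat -> R) : \sum_(r < n.+1) g r *: C' P r u v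
    = g 1%N *: C' P 1 u v + \sum_(r < n.+1 | r != Ordinal n2) g r *: C' P r u v.
  by rewrite (bigD1 (Ordinal n2)).
rewrite /C'' /subst_param (split1 (fps_exp _ ^~ n)) [in RHS](split1 (fps_exp _ ^~ n)).
rewrite !E scale0r add0r addrC; congr (_ + _); apply: eq_bigr => r; rewrite -val_eqE /= => r1.
congr (_ *: _); apply: fps_exp_congr => // k kn.
by rewrite /new_parameter /upd !(ltn_eqF kn).
Qed.

Let smbracket_affine P xi X Y :
  smbracket P (affine xi X) (affine xi Y) xi = bracket_at P xi X Y.
Proof.
rewrite /smbracket smfun_sumE; apply: eq_bigr => i _; rewrite smfun_sumE.
apply: eq_bigr => j _; rewrite !dpart_affine -[LHS]/(P i j xi * (X 0 i * 1) * (Y 0 j * 1)).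
by rewrite !mulr1.
Qed.

Let defect_upd Ts f n c P u v : (1 < n)%N ->
  defect_at Ts (upd f n c) n P u v = defect_at Ts (upd f n 0) n P u v + c *: C' P 1 u v.
Proof.
move=> n1; rewrite /defect_at /defect addrAC; congr (_ - _).
pose F j := if (j < n)%N then 0 else c *: C' P 1 u v.
have -> : c *: C' P 1 u v = convol n (fun i j => F j).
  by rewrite convol_bot /F ?ltnn// => i j ->.
rewrite -convolD; apply: eq_convol => i j ij; rewrite /F.
have [jn|jn] := ltnP j n; last first.
  have [-> ->] : i = 0%N /\ j = n by lia.
  by rewrite subst_upd.
rewrite addr0; congr (gauge_coef Ts P i _); apply: eq_bigr => r _; congr (_ *: _).
by apply: fps_exp_agree => k kj; rewrite /upd !(ltn_eqF (leq_ltn_trans kj jn)).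
Qed.

Let defect_one Ts f P u v : (forall x, gauge_coef Ts P 1 x = 0) ->
  (forall x y, C P 0 x y = x * y) ->
  defect_at Ts f 1 P u v = C' P 1 u v - C P 1 u v.
Proof.
move=> T1 C0; rewrite /defect_at /defect; congr (_ - _).
  rewrite /push_prod convol_ends//; last by move=> i; lia.
  rewrite T1 addr0 /= /C'' /subst_param !big_ord_recl big_ord0 /= addr0 scale0r add0r.
  by rewrite -[fps_mul _ _]/(fps_exp (new_parameter f) 1) fps_exp1 scale1r.
rewrite /prod_push convol_ends//; last by move=> i; lia.
rewrite convol0 convol_ends//; last by move=> i; lia.
by rewrite !T1 !C0 mul0r mulr0 !addr0.
Qed.

(** The pair is obtained before P from the defect computed with T_n = 0, for an arbitrary state [s];
    the lower-order identities are used only once P is fixed. *)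
Lemma gauge_step n (s : (nat -> seq (R * net unit)) * (nat -> R)) : (0 < n)%N ->
  exists x : seq (R * net unit) * R, forall P, good P ->
    (forall k, (k < n)%N -> gauge_eq s.1 s.2 P k) ->
    forall k, (k <= n)%N -> gauge_eq (upd s.1 n x.1) (upd s.2 n x.2) P k.
Proof.
case: s => Ts f n0 /=; pose Ts0 := upd Ts n [::].
have [kappa Hk] := univ2_skew (univ2_defect Ts0 (upd f n 0) n).
(* For n > 1 this adds - kappa C'_1 to the defect, whose skew part on affine functions is - kappa
   times the bracket. For n = 1 the entry is ignored by [new_parameter]. *)
pose f1 := upd f n (- kappa).
have [T [M HM] HT] := univ_hkr (univ2_defect Ts0 f1 n).
exists (M, - kappa) => P [lP pP] IH k; rewrite leq_eqVlt => /orP[/eqP ->|kn]; last first.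
  apply: gauge_eq_congr (IH k kn) => i ik.
  by rewrite /upd !(ltn_eqF (leq_ltn_trans ik kn)).
have [star star'] := (hw.2 _ pP, hw'.2 _ pP).
have CPl := lift_linearl star (CE P); have CPr := lift_linearr star (CE P).
have C'Pl := lift_linearl star' (C'E P); have C'Pr := lift_linearr star' (C'E P).
have CDl' r u1 u2 v : C P r (u1 + u2) v = C P r u1 v + C P r u2 v.
  by have := CPl r 1 u1 u2 v; rewrite !scale1r.
have CDr' r u v1 v2 : C P r u (v1 + v2) = C P r u v1 + C P r u v2.
  by have := CPr r 1 u v1 v2; rewrite !scale1r.
have T0 u : gauge_coef Ts0 P 0 u = u by [].
have Tn : gauge_coef Ts0 P n = (fun _ => 0).
  by apply/funext => u; rewrite /gauge_coef gtn_eqF// /Ts0 /upd eqxx /nets_op big_nil.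
have C0 := lift_order0 star (CE P).
have C''0 u v : C'' f1 P 0 u v = u * v.
  by rewrite /C'' /subst_param big_ord1 /= scale1r.
have IH0 k' u v : (k' < n)%N -> push_prod (C'' f1 P) (gauge_coef Ts0 P) k' u v
    = prod_push (C P) (gauge_coef Ts0 P) k' u v.
  move=> k'n; apply: (gauge_eq_congr _ (IH k' k'n)) => i ik.
  by rewrite /Ts0 /f1 /upd !(ltn_eqF (leq_ltn_trans ik k'n)).
have C''A := subst_param_assoc (new_parameter0 f1) C'Pl C'Pr (lift_assoc star' (C'E P)).
have C1 := lift_unit star (CE P).
have C''1 r : (0 < r)%N -> C'' f1 P r 1 1 = 0.
  move=> r0; rewrite /C'' /subst_param big_ord_recl /= gtn_eqF// scale0r add0r big1// => i _.
  by rewrite (lift_unit star' (C'E P)) ?scaler0.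
have D11 : defect_at Ts0 f1 n P 1 1 = 0.
  exact: (defect_unit CDl' CDr' (gauge_coefD Ts0 P) C0 C''0 T0 C1 C''1 n0 Tn (fun k' k'n => IH0
    k' _ _ k'n)).
have cocycle := defect_cocycle CDl' CDr' (gauge_coefD Ts0 P) (lift_assoc star (CE P)) C''A C0
  C''0 T0 IH0.
have Dsym xi X Y : defect_at Ts0 f1 n P (affine xi X) (affine xi Y) xi
    = defect_at Ts0 f1 n P (affine xi Y) (affine xi X) xi.
  have EB (g h : A) : (g - h) xi = g xi - h xi by [].
  have [n1|n1] := ltnP 1 n.
    have DE Z W : defect_at Ts0 f1 n P (affine xi Z) (affine xi W) xi
        = defect_at Ts0 (upd f n 0) n P (affine xi Z) (affine xi W) xi
          - kappa * C' P 1 (affine xi Z) (affine xi W) xi.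
      have := congr1 (fun g : A => g xi) (defect_upd Ts0 f (- kappa) P (affine xi Z) (affine xi
        W) n1).
      move=> ->; rewrite -mulNr; exact: erefl.
    rewrite (DE X Y) (DE Y X).
    have := Hk P lP xi X Y.
    have := congr1 (fun g : A => g xi) (lift_order1 star' (C'E P) (affine xi X) (affine xi Y)).
    rewrite smbracket_affine EB => B1 B2.
    apply/eqP; rewrite -subr_eq0; apply/eqP; rewrite -[RHS](subrr (kappa * bracket_at P xi X Y)).
    by rewrite -{1}B2 -B1; ring.
  (* Here the defect is C'_1 - C_1, and both terms have the Poisson bracket as skew part. *)
  have n_1 : n = 1%N by lia.
  have T1 x : gauge_coef Ts0 P 1 x = 0 by rewrite -n_1 Tn.
  have DE Z W : defect_at Ts0 f1 n P (affine xi Z) (affine xi W) xi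
      = C' P 1 (affine xi Z) (affine xi W) xi - C P 1 (affine xi Z) (affine xi W) xi.
    rewrite n_1; exact: (congr1 (fun g : A => g xi) (defect_one f1 (affine xi Z) (affine xi W) T1
      C0)).
  rewrite (DE X Y) (DE Y X).
  have := congr1 (fun g : A => g xi) (lift_order1 star (CE P) (affine xi X) (affine xi Y)).
  have := congr1 (fun g : A => g xi) (lift_order1 star' (C'E P) (affine xi X) (affine xi Y)).
  by rewrite !EB => <- B; lra.
have HE := HT P lP cocycle D11 Dsym.
move=> u v.
have ext i : gauge_coef (upd Ts n M) P i = extend (gauge_coef Ts0 P) n (T P) i.
  apply/funext => x; rewrite /extend /gauge_coef /Ts0 /upd; have [->|] := eqVneq i n.
    by rewrite gtn_eqF// [RHS](HM P lP (fun _ => x)).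
  by [].
have -> : gauge_coef (upd Ts n M) P = extend (gauge_coef Ts0 P) n (T P) by apply/funext => i;
  exact: ext.
by apply: extend_defect => //; exact: HE.
Qed.

Lemma gauge_exists : exists (Ts : nat -> seq (R * net unit)) (f : nat -> R),
  forall P, good P -> forall n, gauge_eq Ts f P n.
Proof.
pose S := ((nat -> seq (R * net unit)) * (nat -> R))%type.
have step n : exists g : S -> seq (R * net unit) * R, forall s P, good P ->
    (forall k, (k < n.+1)%N -> gauge_eq s.1 s.2 P k) ->
    forall k, (k <= n.+1)%N -> gauge_eq (upd s.1 n.+1 (g s).1) (upd s.2 n.+1 (g s).2) P k.
  by have [g Hg] := choice (fun s => @gauge_step n.+1 s isT); exists g.
have [G HG] := choice step.
pose St := fix St n : S := if n is n'.+1 then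
  (upd (St n').1 n'.+1 (G n' (St n')).1, upd (St n').2 n'.+1 (G n' (St n')).2)
  else (fun _ => [::], fun _ => 0).
have StE P n : good P -> forall k, (k <= n)%N -> gauge_eq (St n).1 (St n).2 P k.
  move=> gP; elim: n => [|n IHn]; first by case=> // _; exact: gauge_eq0.
  exact: (HG n (St n) P gP IHn).
have stable n k : (k <= n)%N -> (St n).1 k = (St k).1 k /\ (St n).2 k = (St k).2 k.
  elim: n => [|n IHn]; first by case: k.
  rewrite leq_eqVlt => /orP[/eqP -> //|kn]; have [<- <-] := IHn kn.
  by rewrite /= /upd (ltn_eqF kn).
(* Diagonal sequence: stage n agrees with it up to order n, as later stages modify only higher
   entries. *)
exists (fun n => (St n).1 n), (fun n => (St n).2 n) => P gP n.
by apply: gauge_eq_congr (StE P n gP n (leqnn n)) => i ni; exact: stable.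
Qed.

Lemma universal_equivalence : exists t : nat -> op_graph -> R,
  (forall r, finite_set [set G | t r G != 0]) /\
  exists f : nat -> R, forall P, good P -> forall u v, smooth u -> smooth v ->
    let T := gauge t (val_tensor P) in
    substitute (universal_coef w' (val_tensor P)) (new_parameter f) u v
    = lin_ext_inv T (bilin_ext (universal_coef w (val_tensor P))
        (lin_ext T (const_series u)) (lin_ext T (const_series v))).
Proof.
have [Ts [f E]] := gauge_exists.
have [t Ht] := choice (fun n => @universal_opE R m (Ts n)).
exists t; split=> [r|]; first by case: (Ht r).
exists f => P gP u v su sv; have [lP _] := gP; set T := gauge t _ => /=.
have TE n x : T n (val x) = val (gauge_coef Ts P n x).
  by rewrite /T /gauge /gauge_coef; case: (n == 0%N) => //; rewrite (Ht n).2.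
have T0 : T 0%N = id by [].
pose U := to_sfun su; pose V := to_sfun sv.
have lin_constE (x : A) : lin_ext T (const_series (val x)) = fun n => val (gauge_coef Ts P n x).
  apply/funext => n; rewrite const_seriesE /lin_ext.
  transitivity (val (convol n (fun r a => gauge_coef Ts P r (const_smooth x a)))).
    by rewrite val_sum; apply: eq_bigr => i _; exact: TE.
  rewrite convolC (convol_const (F := fun z k => gauge_coef Ts P k z))// => k.
  by apply: (addIr (gauge_coef Ts P k 0)); rewrite -gauge_coefD !add0r.
(* Writing the left side as T^-1 T of itself leaves T(u *' v) = Tu * Tv, which is [gauge_eq] at
   every order. *)
rewrite -[LHS](lin_extK T0); congr lin_ext_inv.
rewrite -[u]/(val U) -[v]/(val V) !lin_constE (bilin_ext_val (CE P)).
apply/funext => n; transitivity (val (push_prod (C'' f P) (gauge_coef Ts P) n U V)); last first.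
  by rewrite (E P gP n U V).
rewrite val_sum; apply: eq_bigr => i _; rewrite -TE; congr (T _ _).
rewrite val_sum; apply: eq_bigr => r _.
by rewrite -[RHS]/(fps_exp _ r _ *: val (C' P r U V)) C'E.
Qed.

End GaugeStep.

Theorem proposition9 (R : realType) (m : nat) (hm : (0 < m)%N)
    (w w' : nat -> star_graph -> R)
    (hw : universal_star_product R m w) (hw' : universal_star_product R m w') :
  exists t : nat -> op_graph -> R,
    (forall r : nat, (0 < r)%N -> finite_set [set G | t r G != 0]) /\
    forall (g : vectType R) (br : g -> g -> g) (b : m.-tuple g),
      lie_bracket br -> basis_of fullv b ->
      let P := linear_poisson br b in
      let T := gauge t P in
      exists f : nat -> R,
        forall u v : 'rV[R]_m -> R, smooth u -> smooth v ->
          substitute (universal_coef w' P) (new_parameter f) u v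
          = lin_ext_inv T (bilin_ext (universal_coef w P)
              (lin_ext T (const_series u)) (lin_ext T (const_series v))).
Proof.
have [L LE] := @universal_coefE R m w hw.1; have [L' L'E] := @universal_coefE R m w' hw'.1.
have [t [fin_t [f E]]] := universal_equivalence hw hw' LE L'E.
exists t; split=> [r _|g br b lie basis]; first exact: fin_t.
have PE : linear_poisson br b = val_tensor (lie_tensor br b).
  by apply/funext => i; apply/funext => j; exact: linear_poissonE.
have good_lie : good (lie_tensor br b).
  by split; [exact: lie_tensor_linear|rewrite -PE; exact: lie_poisson].
exists f => u v su sv; rewrite PE; exact: E.
Qed.
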